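(* Let $N,k$ be positive integers, $n=kN$, and $q=t^{-2k}$. Then the unique simple quotient of the induced $\mathbb H_{q,t}(GL_n)$-module $M(k^N)=\mathrm{Ind}_{H(\mathcal Y)}^{\mathbb H_{q,t}(GL_n)}\mathrm{Rect}(N,k)$ is $L(k^N)$. In particular this quotient is $\mathcal Y$-semisimple, and its support is $\{\mathrm{wt}(R): R\in \mathrm{P}_n\mathrm{SYT}(k^N)\}$.
   Context: $K$ is a field of characteristic $0$ and $q,t\in K^\times$ are not roots of unity; $n\ge2$. $\mathbb H_{q,t}(GL_n)$ is generated by $T_0,\dots,T_{n-1}$ (indices mod $n$), $\pi^{\pm1},Y_1^{\pm1},\dots,Y_n^{\pm1}$, the $Y_i$ commuting pairwise, with relations $(T_i-t)(T_i+t^{-1})=0$; $T_iT_jT_i=T_jT_iT_j$ if $j\equiv i\pm1$ and $T_iT_j=T_jT_i$ otherwise (both dropped if $n=2$); $\pi T_i\pi^{-1}=T_{i+1}$; $T_iY_iT_i=Y_{i+1}$ $(1\le i\le n-1)$; $T_0Y_nT_0=q^{-1}Y_1$; $T_iY_j=Y_jT_i$ for $j\not\equiv i,i+1$; $\pi Y_i\pi^{-1}=Y_{i+1}$ $(1\le i\le n-1)$; $\pi Y_n\pi^{-1}=q^{-1}Y_1$. $\mathcal Y=K[Y_1^{\pm1},\dots,Y_n^{\pm1}]$, and $H(\mathcal Y)$ is the subalgebra generated by $T_1,\dots,T_{n-1}$ and $\mathcal Y$ (an extended affine Hecke algebra). $H_n$ is the finite Hecke algebra generated by $T_1,\dots,T_{n-1}$;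 there is a homomorphism $H(\mathcal Y)\to H_n$ with $T_i\mapsto T_i$, $Y_1\mapsto1$. $\mathrm{Rect}(N,k)$ is the irreducible $H(\mathcal Y)$-module obtained by inflating along $H(\mathcal Y)\to H_n$ the irreducible $H_n$-module indexed by the partition $(k^N)$ ($N$ rows of length $k$). It has a basis $v_R$ indexed by standard Young tableaux $R$ of shape $(k^N)$, with $Y_iv_R=t^{2\mathrm{diag}_R(i)}v_R$, where $\mathrm{diag}_R(i)=m-j$ if $i$ lies in row $j$, column $m$. $\mathrm P_n\mathrm{SYT}(k^N)$ is the set of $n$-periodic standard tableaux: bijective fillings $R$ of the strip of boxes $(j,c)$, $1\le j\le N$, $c\in\mathbb Z$, by $\mathbb Z$, increasing along rows and down columns, such that the entry of $(j,c+k)$ is the entry of $(j,c)$ plus $n$ and the entries in columns $1,\dots,k$ are distinct mod $n$. If $i$ lies in box $(j,c)$, $\mathrm{diag}_R(i)=c-j$; the weight is $\mathrm{wt}(R)=(t^{2\mathrm{diag}_R(1)},\dots,t^{2\mathrm{diag}_R(n)})$. For $q=t^{-2k}$, $L(k^N)$ is the irreducible $\mathbb H_{q,t}(GL_n)$-module, unique up to isomorphism, on the $K$-span of $\{v_R:R\in\mathrm P_n\mathrm{SYT}(k^N)\}$ in which $Y_iv_R=t^{2\mathrm{diag}_R(i)}v_R$ for $i=1,\dots,n$. A module is $\mathcal Y$-semisimple if it is the direct sum of its simultaneous eigenspaces $M[\underline z]=\{v:Y_iv=z_iv\ \forall i\}$, $\underline z\in(K^\times)^n$; its support is the set of $\underline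 z$ with $M[\underline z]\ne0$. *)

(* Defs.v *)
From HB Require Import structures.
From mathcomp Require Import all_boot all_order all_algebra.
From mathcomp Require Import finmap monalg boolp.

Set Implicit Arguments.
Unset Strict Implicit.
Unset Printing Implicit Defensive.

Import Order.TTheory GRing.Theory Num.Theory.

Local Open Scope ring_scope.
Local Open Scope quotient_scope.

(* The algebras below are not shown to be nontrivial, so they are only
   pzRingTypes; the library's lalgType needs nonzero rings.  A K-algebra is
   therefore a ring A with a structure morphism {rmorphism K -> A}. *)

Section RingQuotient.
Variables (A : pzRingType) (S : A -> Prop).

Definition two_sided_ideal (J : A -> Prop) : Prop :=
  [/\ J 0,
      forall x y, J x -> J y -> J (x - y),
      forall a x, J x -> J (a * x)
    & forall a x, J x -> J (x * a)].

Definition ideal_gen : {pred A} :=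
  fun x => `[< forall J, two_sided_ideal J -> (forall s, S s -> J s) -> J x >].

Lemma ideal_genP x :
  reflect (forall J, two_sided_ideal J -> (forall s, S s -> J s) -> J x)
          (x \in ideal_gen).
Proof. exact: asboolP. Qed.

Lemma ideal_gen_zmod : zmod_closed ideal_gen.
Proof.
split=> [|x y /ideal_genP hx /ideal_genP hy]; apply/ideal_genP=> J hJ hS.
  by case: hJ.
by case: (hJ) => _ hB _ _; apply: hB; [apply: hx | apply: hy].
Qed.

HB.instance Definition _ := GRing.isZmodClosed.Build A ideal_gen ideal_gen_zmod.

Lemma ideal_genMl a x : x \in ideal_gen -> a * x \in ideal_gen.
Proof.
move=> /ideal_genP hx; apply/ideal_genP=> J hJ hS.
by case: (hJ) => _ _ hM _; apply: hM; apply: hx.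
Qed.

Lemma ideal_genMr a x : x \in ideal_gen -> x * a \in ideal_gen.
Proof.
move=> /ideal_genP hx; apply/ideal_genP=> J hJ hS.
by case: (hJ) => _ _ _ hM; apply: hM; apply: hx.
Qed.

Definition quot_ring : Type := Quotient.quot ideal_gen.

HB.instance Definition _ := GRing.Zmodule.on quot_ring.

Definition quot_proj (x : A) : quot_ring := \pi_(Quotient.quot ideal_gen) x.
Definition quot_rep (x : quot_ring) : A := repr (x : Quotient.quot ideal_gen).

Lemma quot_repK : cancel quot_rep quot_proj.
Proof. exact: reprK. Qed.

Lemma quot_projP x y : (x - y \in ideal_gen) = (quot_proj x == quot_proj y).
Proof. exact: Quotient.idealrBE. Qed.

Lemma quot_projD : {morph quot_proj : x y / x + y}.
Proof. by move=> x y; exact: (raddfD (\pi_(Quotient.quot ideal_gen))). Qed.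

Definition quot_one : quot_ring := quot_proj 1.
Definition quot_mul (x y : quot_ring) : quot_ring :=
  quot_proj (quot_rep x * quot_rep y).

Lemma quot_projM x y : quot_proj (x * y) = quot_mul (quot_proj x) (quot_proj y).
Proof.
apply/eqP; rewrite -quot_projP.
set x' := quot_rep _; set y' := quot_rep _.
have -> : x * y - x' * y' = (x - x') * y + x' * (y - y').
  by rewrite mulrBl mulrBr addrA subrK.
by apply: rpredD; [apply: ideal_genMr | apply: ideal_genMl];
  rewrite quot_projP quot_repK.
Qed.

Lemma quot_mulA : associative quot_mul.
Proof.
move=> x y z; rewrite -[x]quot_repK -[y]quot_repK -[z]quot_repK.
by rewrite -!quot_projM mulrA.
Qed.

Lemma quot_mul1l : left_id quot_one quot_mul.
Proof. by move=> x; rewrite -[x]quot_repK -quot_projM mul1r. Qed.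

Lemma quot_mul1r : right_id quot_one quot_mul.
Proof. by move=> x; rewrite -[x]quot_repK -quot_projM mulr1. Qed.

Lemma quot_mulDl : left_distributive quot_mul +%R.
Proof.
move=> x y z; rewrite -[x]quot_repK -[y]quot_repK -[z]quot_repK.
by rewrite -quot_projD -!quot_projM mulrDl quot_projD.
Qed.

Lemma quot_mulDr : right_distributive quot_mul +%R.
Proof.
move=> x y z; rewrite -[x]quot_repK -[y]quot_repK -[z]quot_repK.
by rewrite -quot_projD -!quot_projM mulrDr quot_projD.
Qed.

HB.instance Definition _ := GRing.Zmodule_isPzRing.Build quot_ring
  quot_mulA quot_mul1l quot_mul1r quot_mulDl quot_mulDr.

Lemma quot_proj_zmod : zmod_morphism quot_proj.
Proof. by move=> x y; exact: (raddfB (\pi_(Quotient.quot ideal_gen))). Qed.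

Lemma quot_proj_monoid : monoid_morphism quot_proj.
Proof. by split=> [//|x y]; exact: quot_projM. Qed.

HB.instance Definition _ :=
  GRing.isZmodMorphism.Build A quot_ring quot_proj quot_proj_zmod.
HB.instance Definition _ :=
  GRing.isMonoidMorphism.Build A quot_ring quot_proj quot_proj_monoid.

End RingQuotient.

(* The K-algebra with generators X and relations a = b for rel a b. *)
Section Presented.
Variables (K : fieldType) (X : choiceType).

Definition free_alg : Type := {malg K[{fmonom X}]}.
HB.instance Definition _ := GRing.Lalgebra.on free_alg.

Definition free_gen (x : X) : free_alg := << fmu x >>.

Variable rel : free_alg -> free_alg -> Prop.

Definition presented : Type :=
  quot_ring (fun s : free_alg => exists a b, rel a b /\ s = a - b).
HB.instance Definition _ := GRing.PzRing.on presented.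

Definition presented_proj : free_alg -> presented :=
  @quot_proj free_alg (fun s => exists a b, rel a b /\ s = a - b).
HB.instance Definition _ := GRing.RMorphism.on presented_proj.

Definition presented_scal (c : K) : presented := presented_proj c%:A.

Lemma presented_scal_zmod : zmod_morphism presented_scal.
Proof. by move=> x y; rewrite /presented_scal scalerBl rmorphB. Qed.

Lemma presented_scal_monoid : monoid_morphism presented_scal.
Proof.
split=> [|x y]; rewrite /presented_scal; first by rewrite scale1r rmorph1.
by rewrite -rmorphM -scalerAl mul1r scalerA.
Qed.

HB.instance Definition _ := GRing.isZmodMorphism.Build K presented
  presented_scal presented_scal_zmod.
HB.instance Definition _ := GRing.isMonoidMorphism.Build K presented
  presented_scal presented_scal_monoid.

End Presented.

Section Subalgebra.
Variables (K A : pzRingType) (scal : {rmorphism K -> A}) (G : A -> Prop).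

Definition is_subalgebra (J : A -> Prop) : Prop :=
  [/\ forall c, J (scal c),
      forall x y, J x -> J y -> J (x - y)
    & forall x y, J x -> J y -> J (x * y)].

Definition subalg_gen : {pred A} :=
  fun x => `[< forall J, is_subalgebra J -> (forall g, G g -> J g) -> J x >].

Lemma subalg_genP x :
  reflect (forall J, is_subalgebra J -> (forall g, G g -> J g) -> J x)
          (x \in subalg_gen).
Proof. exact: asboolP. Qed.

Lemma subalg_gen_scal c : scal c \in subalg_gen.
Proof. by apply/subalg_genP=> J [hs _ _] _; apply: hs. Qed.

Lemma subalg_gen_incl g : G g -> g \in subalg_gen.
Proof. by move=> Gg; apply/subalg_genP=> J _; apply. Qed.

Lemma subalg_gen_subring : subring_closed subalg_gen.
Proof.
split=> [|x y /subalg_genP hx /subalg_genP hy|x y /subalg_genP hx /subalg_genP hy].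
- by rewrite -(rmorph1 scal) subalg_gen_scal.
- apply/subalg_genP=> J hJ hG; case: (hJ) => _ hB _.
  by apply: hB; [apply: hx | apply: hy].
- apply/subalg_genP=> J hJ hG; case: (hJ) => _ _ hM.
  by apply: hM; [apply: hx | apply: hy].
Qed.

HB.instance Definition _ :=
  GRing.isSubringClosed.Build A subalg_gen subalg_gen_subring.

Record subalg : Type :=
  Subalg { subalg_val : A; subalg_valP : subalg_val \in subalg_gen }.

HB.instance Definition _ := [isSub for subalg_val].
HB.instance Definition _ := [Choice of subalg by <:].
HB.instance Definition _ :=
  GRing.SubChoice_isSubPzRing.Build A _ subalg subalg_gen_subring.

Lemma subalg_val_zmod : zmod_morphism subalg_val.
Proof. exact: (rmorphB (val : subalg -> A)). Qed.

Lemma subalg_val_monoid : monoid_morphism subalg_val.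
Proof.
by split; [exact: (rmorph1 (val : subalg -> A))
          | exact: (rmorphM (val : subalg -> A))].
Qed.

HB.instance Definition _ :=
  GRing.isZmodMorphism.Build subalg A subalg_val subalg_val_zmod.
HB.instance Definition _ :=
  GRing.isMonoidMorphism.Build subalg A subalg_val subalg_val_monoid.

Definition subalg_scal (c : K) : subalg := Subalg (subalg_gen_scal c).

Lemma subalg_scal_zmod : zmod_morphism subalg_scal.
Proof. by move=> x y; apply: val_inj; rewrite /= rmorphB. Qed.

Lemma subalg_scal_monoid : monoid_morphism subalg_scal.
Proof.
by split=> [|x y]; apply: val_inj; rewrite /= ?rmorph1 ?rmorphM.
Qed.

HB.instance Definition _ := GRing.isZmodMorphism.Build K subalg
  subalg_scal subalg_scal_zmod.
HB.instance Definition _ := GRing.isMonoidMorphism.Build K subalg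
  subalg_scal subalg_scal_monoid.

End Subalgebra.

Section QuotientModule.
Variables (A : pzRingType) (V : lmodType A) (J : submodClosed V).

Definition submod_pred : {pred V} := fun x => x \in J.

Lemma submod_pred_zmod : zmod_closed submod_pred.
Proof.
split=> [|x y hx hy]; first exact: (rpred0 J).
by apply: (rpredD (S := J)) => //; rewrite -scaleN1r; apply: (rpredZ (s := J)).
Qed.

HB.instance Definition _ :=
  GRing.isZmodClosed.Build V submod_pred submod_pred_zmod.

Definition quot_mod : Type := Quotient.quot submod_pred.
HB.instance Definition _ := GRing.Zmodule.on quot_mod.

Definition mod_proj (x : V) : quot_mod := \pi_(Quotient.quot submod_pred) x.
Definition mod_rep (x : quot_mod) : V := repr (x : Quotient.quot submod_pred).

Lemma mod_repK : cancel mod_rep mod_proj.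
Proof. exact: reprK. Qed.

Lemma mod_projP x y : (x - y \in J) = (mod_proj x == mod_proj y).
Proof. exact: (Quotient.idealrBE submod_pred). Qed.

Lemma mod_projD : {morph mod_proj : x y / x + y}.
Proof. by move=> x y; exact: (raddfD (\pi_(Quotient.quot submod_pred))). Qed.

Definition mod_scale (a : A) (x : quot_mod) : quot_mod :=
  mod_proj (a *: mod_rep x).

Lemma mod_projZ a x : mod_proj (a *: x) = mod_scale a (mod_proj x).
Proof.
apply/eqP; rewrite -mod_projP -scalerBr; apply: rpredZ.
by rewrite mod_projP mod_repK.
Qed.

Lemma mod_scaleA a b x : mod_scale a (mod_scale b x) = mod_scale (a * b) x.
Proof. by rewrite -[x]mod_repK -!mod_projZ scalerA. Qed.

Lemma mod_scale1 : left_id 1 mod_scale.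
Proof. by move=> x; rewrite -[x]mod_repK -mod_projZ scale1r. Qed.

Lemma mod_scaleDr : right_distributive mod_scale +%R.
Proof.
move=> a x y; rewrite -[x]mod_repK -[y]mod_repK.
by rewrite -mod_projD -!mod_projZ scalerDr mod_projD.
Qed.

Lemma mod_scaleDl x : {morph mod_scale^~ x : a b / a + b}.
Proof.
by move=> a b; rewrite -[x]mod_repK -!mod_projZ scalerDl mod_projD.
Qed.

HB.instance Definition _ := GRing.Zmodule_isLmodule.Build A quot_mod
  mod_scaleA mod_scale1 mod_scaleDr mod_scaleDl.

Lemma mod_proj_linear : linear mod_proj.
Proof. by move=> a x y; rewrite mod_projD mod_projZ. Qed.

HB.instance Definition _ :=
  GRing.isLinear.Build A V quot_mod *:%R mod_proj mod_proj_linear.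

End QuotientModule.

Section Span.
Variables (A : pzRingType) (V : lmodType A) (S : V -> Prop).

Definition is_submodule (J : V -> Prop) : Prop :=
  J 0 /\ forall a x y, J x -> J y -> J (a *: x + y).

Definition span_gen : {pred V} :=
  fun x => `[< forall J, is_submodule J -> (forall s, S s -> J s) -> J x >].

Lemma span_genP x :
  reflect (forall J, is_submodule J -> (forall s, S s -> J s) -> J x)
          (x \in span_gen).
Proof. exact: asboolP. Qed.

Lemma span_gen_submod : submod_closed span_gen.
Proof.
split=> [|a x y /span_genP hx /span_genP hy]; apply/span_genP=> J hJ hS.
  by case: hJ.
by case: (hJ) => _ hL; apply: hL; [apply: hx | apply: hy].
Qed.

HB.instance Definition _ :=
  GRing.isSubmodClosed.Build A V span_gen span_gen_submod.

End Span.

Section FreeModule.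
Variables (A : pzRingType) (W : choiceType).

Definition free_mod : Type := {malg A[W]}.
HB.instance Definition _ := GRing.Zmodule.on free_mod.

Definition free_scale (a : A) (g : free_mod) : free_mod :=
  [malg w in msupp (g : {malg A[W]}) => a * (g : {malg A[W]})@_w].

Lemma free_scaleE a g w :
  (free_scale a g : {malg A[W]})@_w = a * (g : {malg A[W]})@_w.
Proof. by rewrite mcoeffE; case: msuppP; rewrite ?mulr0. Qed.

Lemma free_scaleA a b g : free_scale a (free_scale b g) = free_scale (a * b) g.
Proof. by apply/malgP=> w; rewrite !free_scaleE mulrA. Qed.

Lemma free_scale1 : left_id 1 free_scale.
Proof. by move=> g; apply/malgP=> w; rewrite free_scaleE mul1r. Qed.

Lemma free_scaleDr : right_distributive free_scale +%R.
Proof.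
by move=> a g h; apply/malgP=> w; rewrite mcoeffD !free_scaleE mcoeffD mulrDr.
Qed.

Lemma free_scaleDl g : {morph free_scale^~ g : a b / a + b}.
Proof.
by move=> a b; apply/malgP=> w; rewrite mcoeffD !free_scaleE mulrDl.
Qed.

HB.instance Definition _ := GRing.Zmodule_isLmodule.Build A free_mod
  free_scaleA free_scale1 free_scaleDr free_scaleDl.

Definition free_elt (a : A) (w : W) : free_mod := << a *g w >>.

End FreeModule.

(* A (x)_B W for f : B -> A.  The symbols a (x) w span the free A-module on W,
   which already makes them additive in a. *)
Section Induced.
Variables (B A : pzRingType) (f : {rmorphism B -> A}) (W : lmodType B).

Inductive tensor_rel : free_mod A W -> Prop :=
| TensorD a w w' :
    tensor_rel (free_elt a (w + w') - free_elt a w - free_elt a w')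
| TensorM a b w :
    tensor_rel (free_elt (a * f b) w - free_elt a (b *: w)).

Definition induced : Type := quot_mod (span_gen tensor_rel).
HB.instance Definition _ := GRing.Lmodule.on induced.

Definition tensor (a : A) (w : W) : induced :=
  mod_proj (span_gen tensor_rel) (free_elt a w).

End Induced.

Definition inflation (B C : pzRingType) (phi : {rmorphism B -> C})
  (V : lmodType C) : Type := V.

Section Inflation.
Variables (B C : pzRingType) (phi : {rmorphism B -> C}) (V : lmodType C).
Local Notation infl := (inflation phi V).

HB.instance Definition _ := GRing.Zmodule.copy infl V.

Definition infl_scale (b : B) (x : infl) : infl := phi b *: (x : V).

Lemma infl_scaleA a b x : infl_scale a (infl_scale b x) = infl_scale (a * b) x.
Proof. by rewrite /infl_scale scalerA rmorphM. Qed.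

Lemma infl_scale1 : left_id 1 infl_scale.
Proof. by move=> x; rewrite /infl_scale rmorph1 scale1r. Qed.

Lemma infl_scaleDr : right_distributive infl_scale +%R.
Proof. by move=> a x y; rewrite /infl_scale scalerDr. Qed.

Lemma infl_scaleDl x : {morph infl_scale^~ x : a b / a + b}.
Proof. by move=> a b; rewrite /infl_scale rmorphD scalerDl. Qed.

HB.instance Definition _ := GRing.Zmodule_isLmodule.Build B infl
  infl_scaleA infl_scale1 infl_scaleDr infl_scaleDl.

End Inflation.

Definition simple_module (A : pzRingType) (V : lmodType A) : Prop :=
  (exists x : V, x != 0) /\
  forall J : submodClosed V, (forall x, x \in J -> x = 0) \/ (forall x, x \in J).

Definition isomorphic (A : pzRingType) (V W : lmodType A) : Prop :=
  exists f : {linear V -> W}, bijective f.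

(* v is a basis of V as a vector space over K; I may be infinite. *)
Definition is_basis (K A : pzRingType) (scal : {rmorphism K -> A})
    (V : lmodType A) (I : Type) (v : I -> V) : Prop :=
  (forall m (e : 'I_m -> I) (c : 'I_m -> K), injective e ->
     \sum_(j < m) scal (c j) *: v (e j) = 0 -> forall j, c j = 0) /\
  (forall x : V, exists m (e : 'I_m -> I) (c : 'I_m -> K),
     x = \sum_(j < m) scal (c j) *: v (e j)).

(* Generators of the double affine Hecke algebra, indexed by residues mod n
   ('I_n.-1.+1 is 'I_n for n > 0).  Residue 0 carries T_0 and Y_n. *)
Inductive daha_gen (n : nat) : Type :=
| GenT of 'I_n.-1.+1
| GenPi
| GenPiV
| GenY of 'I_n.-1.+1
| GenYV of 'I_n.-1.+1.
Arguments GenPi {n}.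
Arguments GenPiV {n}.

Section DahaGenChoice.
Variable n : nat.

Definition daha_gen_code (g : daha_gen n) : nat * 'I_n.-1.+1 :=
  match g with
  | GenT i => (0, i) | GenPi => (1, ord0) | GenPiV => (2, ord0)
  | GenY i => (3, i) | GenYV i => (4, i)
  end%N.

Definition daha_gen_decode (c : nat * 'I_n.-1.+1) : daha_gen n :=
  match c.1 with
  | 0 => GenT c.2 | 1 => GenPi | 2 => GenPiV | 3 => GenY c.2 | _ => GenYV c.2
  end%N.

Lemma daha_gen_codeK : cancel daha_gen_code daha_gen_decode.
Proof. by case. Qed.

HB.instance Definition _ := Choice.copy (daha_gen n) (can_type daha_gen_codeK).

End DahaGenChoice.

Section Daha.
Variables (K : fieldType) (n : nat) (q t : K).

Definition free_T (i : nat) : free_alg K (daha_gen n) :=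
  free_gen K (GenT (inZp i)).
Definition free_Y (i : nat) : free_alg K (daha_gen n) :=
  free_gen K (GenY (inZp i)).
Definition free_YV (i : nat) : free_alg K (daha_gen n) :=
  free_gen K (GenYV (inZp i)).
Definition free_Pi : free_alg K (daha_gen n) := free_gen K GenPi.
Definition free_PiV : free_alg K (daha_gen n) := free_gen K GenPiV.

Local Notation F := (free_alg K (daha_gen n)).
Local Notation T := free_T.
Local Notation Y := free_Y.
Local Notation YV := free_YV.
Local Notation P := free_Pi.
Local Notation PV := free_PiV.

Inductive daha_rel : F -> F -> Prop :=
| Rel_PiV : daha_rel (P * PV) 1
| Rel_VPi : daha_rel (PV * P) 1
| Rel_YV i : daha_rel (Y i * YV i) 1
| Rel_VY i : daha_rel (YV i * Y i) 1
| Rel_YY i j : daha_rel (Y i * Y j) (Y j * Y i)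
| Rel_Quad i : daha_rel ((T i - t%:A) * (T i + t^-1%:A)) 0
| Rel_Braid i j : n != 2%N ->
    (j == i.+1 %[mod n])%N || (i == j.+1 %[mod n])%N ->
    daha_rel (T i * T j * T i) (T j * T i * T j)
| Rel_Comm i j : n != 2%N ->
    (j != i.+1 %[mod n])%N && (i != j.+1 %[mod n])%N ->
    daha_rel (T i * T j) (T j * T i)
| Rel_PiT i : daha_rel (P * T i * PV) (T i.+1)
| Rel_TY i : (1 <= i < n)%N -> daha_rel (T i * Y i * T i) (Y i.+1)
| Rel_T0Y : daha_rel (T 0 * Y n * T 0) (q^-1 *: Y 1)
| Rel_TYcomm i j : (j != i %[mod n])%N && (j != i.+1 %[mod n])%N ->
    daha_rel (T i * Y j) (Y j * T i)
| Rel_PiY i : (1 <= i < n)%N -> daha_rel (P * Y i * PV) (Y i.+1)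
| Rel_PiYn : daha_rel (P * Y n * PV) (q^-1 *: Y 1).

Definition daha : Type := presented daha_rel.
HB.instance Definition _ := GRing.PzRing.on daha.

Definition daha_scal : K -> daha := @presented_scal K (daha_gen n) daha_rel.
HB.instance Definition _ := GRing.RMorphism.on daha_scal.

Definition daha_T (i : nat) : daha := presented_proj daha_rel (T i).
Definition daha_Y (i : nat) : daha := presented_proj daha_rel (Y i).
Definition daha_YV (i : nat) : daha := presented_proj daha_rel (YV i).

Inductive affine_gen : daha -> Prop :=
| AffineT i : (1 <= i < n)%N -> affine_gen (daha_T i)
| AffineY i : (1 <= i <= n)%N -> affine_gen (daha_Y i)
| AffineYV i : (1 <= i <= n)%N -> affine_gen (daha_YV i).

Inductive finite_gen : daha -> Prop :=
| FiniteT i : (1 <= i < n)%N -> finite_gen (daha_T i).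

(* H(Y) and H_n *)
Definition affine_hecke : Type := subalg daha_scal affine_gen.
HB.instance Definition _ := GRing.PzRing.on affine_hecke.

Definition finite_hecke : Type := subalg daha_scal finite_gen.
HB.instance Definition _ := GRing.PzRing.on finite_hecke.

Definition affine_val : affine_hecke -> daha :=
  @subalg_val K daha daha_scal affine_gen.
HB.instance Definition _ := GRing.RMorphism.on affine_val.

Definition finite_val : finite_hecke -> daha :=
  @subalg_val K daha daha_scal finite_gen.
HB.instance Definition _ := GRing.RMorphism.on finite_val.

Definition finite_scal : K -> finite_hecke :=
  @subalg_scal K daha daha_scal finite_gen.
HB.instance Definition _ := GRing.RMorphism.on finite_scal.

(* The K-algebra map H(Y) -> H_n with T_i |-> T_i, Y_1 |-> 1. *)
Definition is_affine_to_finite (phi : {rmorphism affine_hecke -> finite_hecke}) :=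
  [/\ forall (a : affine_hecke) (c : K),
        affine_val a = daha_scal c -> finite_val (phi a) = daha_scal c,
      forall (a : affine_hecke) (i : nat), (1 <= i < n)%N ->
        affine_val a = daha_T i -> finite_val (phi a) = daha_T i
    & forall a : affine_hecke,
        affine_val a = daha_Y 1 -> finite_val (phi a) = 1].

(* jucys_murphy i is the image T_i ... T_1 T_1 ... T_i of Y_{i+1} in H_n. *)
Fixpoint jucys_murphy (i : nat) : daha :=
  if i is i'.+1 then daha_T i * jucys_murphy i' * daha_T i else 1.

(* z : {ffun 'I_n -> K} is the n-tuple (z_1, ..., z_n) with z_{i+1} = z i. *)
Definition eigenvector (V : lmodType daha) (z : {ffun 'I_n -> K}) (v : V) : Prop :=
  forall i : 'I_n, daha_Y i.+1 *: v = daha_scal (z i) *: v.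

Definition Y_semisimple (V : lmodType daha) : Prop :=
  (forall v : V, exists (s : seq {ffun 'I_n -> K}) (f : {ffun 'I_n -> K} -> V),
     (forall z, z \in s -> (forall i, z i != 0) /\ eigenvector z (f z)) /\
     v = \sum_(z <- s) f z) /\
  (forall (s : seq {ffun 'I_n -> K}) (f : {ffun 'I_n -> K} -> V),
     uniq s -> (forall z, z \in s -> (forall i, z i != 0) /\ eigenvector z (f z)) ->
     \sum_(z <- s) f z = 0 -> forall z, z \in s -> f z = 0).

Definition Y_support (V : lmodType daha) (z : {ffun 'I_n -> K}) : Prop :=
  (forall i, z i != 0) /\ exists v : V, v != 0 /\ eigenvector z v.

End Daha.

(* Standard Young tableaux of shape (k^N).  Rows, columns and entries are
   numbered from 0, so the entry i stands for i+1. *)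
Record syt (N k : nat) : Type := Syt {
  syt_entry : 'I_N * 'I_k -> 'I_(k * N);
  syt_box : 'I_(k * N) -> 'I_N * 'I_k;
  syt_entryK : cancel syt_entry syt_box;
  syt_boxK : cancel syt_box syt_entry;
  syt_row : forall j (m m' : 'I_k), (m < m')%N -> (syt_entry (j, m) < syt_entry (j, m'))%N;
  syt_col : forall (j j' : 'I_N) m, (j < j')%N -> (syt_entry (j, m) < syt_entry (j', m))%N
}.

Definition syt_diag N k (R : syt N k) (i : 'I_(k * N)) : int :=
  (nat_of_ord (syt_box R i).2)%:Z - (nat_of_ord (syt_box R i).1)%:Z.

(* n-periodic standard tableaux, n = kN, on the strip of boxes (j, c): rows
   are numbered from 0 (j : 'I_N is row j+1), columns are the integers. *)
Record psyt (N k : nat) : Type := Psyt {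
  psyt_entry : 'I_N * int -> int;
  psyt_box : int -> 'I_N * int;
  psyt_entryK : cancel psyt_entry psyt_box;
  psyt_boxK : cancel psyt_box psyt_entry;
  psyt_row : forall j c c', c < c' -> psyt_entry (j, c) < psyt_entry (j, c');
  psyt_col : forall (j j' : 'I_N) c, (j < j')%N -> psyt_entry (j, c) < psyt_entry (j', c);
  psyt_period : forall j c, psyt_entry (j, c + k%:Z) = psyt_entry (j, c) + (k * N)%:Z;
  psyt_distinct : forall j j' c c', 1 <= c <= k%:Z -> 1 <= c' <= k%:Z ->
    (psyt_entry (j, c) = psyt_entry (j', c') %[mod (k * N)%:Z])%Z ->
    (j, c) = (j', c')
}.

Definition psyt_diag N k (R : psyt N k) (i : int) : int :=
  (psyt_box R i).2 - (nat_of_ord (psyt_box R i).1).+1%:Z.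

Definition psyt_wt (K : fieldType) (t : K) N k (R : psyt N k) :
    {ffun 'I_(k * N) -> K} :=
  [ffun i : 'I_(k * N) => t ^ (2 * psyt_diag R i.+1%:Z)].

(* V is the irreducible H_n-module indexed by the partition (k^N); the indexing
   is the one for which Y_i, through H(Y) -> H_n, acts by t^(2 diag). *)
Definition is_rect_module (K : fieldType) N k (q t : K)
    (V : lmodType (finite_hecke (k * N) q t)) : Prop :=
  simple_module V /\
  exists v : syt N k -> V,
    is_basis (finite_scal (k * N) q t) v /\
    forall (R : syt N k) (i : 'I_(k * N)) (a : finite_hecke (k * N) q t),
      finite_val a = jucys_murphy (k * N) q t i ->
      a *: v R = finite_scal (k * N) q t (t ^ (2 * syt_diag R i)) *: v R.

(* V is (isomorphic to) L(k^N). *)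
Definition is_L_module (K : fieldType) N k (q t : K)
    (V : lmodType (daha (k * N) q t)) : Prop :=
  simple_module V /\
  exists v : psyt N k -> V,
    is_basis (daha_scal (k * N) q t) v /\
    forall R : psyt N k, eigenvector (psyt_wt t R) (v R).

(* M(k^N), built from phi : H(Y) -> H_n and the H_n-module V. *)
Definition M_module (K : fieldType) n (q t : K)
    (phi : {rmorphism affine_hecke n q t -> finite_hecke n q t})
    (V : lmodType (finite_hecke n q t)) : lmodType (daha n q t) :=
  induced (affine_val (n := n) (q := q) (t := t)) (inflation phi V).

Arguments is_rect_module {K} N k {q t} V.
Arguments is_L_module {K} N k {q t} V.

(* Main.v *)
Require Import Defs.
From HB Require Import structures.
From mathcomp Require Import all_boot all_order all_algebra.
From mathcomp Require Import finmap monalg boolp functions.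
From mathcomp Require Import zify ring.

Set Implicit Arguments.
Unset Strict Implicit.
Unset Printing Implicit Defensive.

Import Order.TTheory GRing.Theory Num.Theory.

Local Open Scope ring_scope.

(** The induced module [M] is mapped onto the span of a basis [v_R] indexed by the
    periodic tableaux, in a module with an explicit seminormal action, and this map
    is shown to have the largest proper submodule as its kernel.

    The target.  On the functions of a periodic tableau [R], the generator [T_i] acts
    through the exchange of the entries that are [i] and [i + 1] modulo [n], with
    coefficients [alpha] and [beta] that only depend on the difference of the two
    diagonals; [Pi] adds [1] to all the entries, and [Y_i] acts by the weight.  The
    defining relations are checked in [tableau_rel]; the hypothesis on [q] is what
    makes the weights periodic.

    The map.  In any module with a basis of weight vectors indexed by tableaux,
    [T_i - alpha] sends the vector of [R] to a multiple of the vector of the exchanged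
    tableau ([T_eigen]).  For the standard tableaux of shape [(k^N)] the vectors can be
    rescaled to make the action of the affine Hecke algebra equal to the seminormal
    one ([normal_form]).  This needs a coherence argument: the scaling factors
    accumulated along two sequences of exchanges agree, by the braid and commutation
    relations ([scaled_fun]).  Hence the inducing module maps to the span of the
    [v_R] with [R] the periodic extension of a standard tableau, and similarly to any
    module that has a basis with the weights of [L(k^N)]; both maps extend to [M].

    The kernel.  The module [M] has a filtration by the degree in [Pi], whose degree
    [0] part is the inducing module.  The operator [Pi^-1 (Y_1 - 1)] lowers the degree
    ([lowering_piece]), because [Y_1] acts by [1] in degree [0]; the product of the
    [Y_i] acts in degree [d] by [kappa q^d] ([Yprod_piece]).  On the [v_R] one can
    move from any tableau to one that extends a standard tableau by exchanges, by
    adding [1] to all the entries, and by subtracting [1] when the lowering operator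
    does not vanish ([reach_fundamental]).  So if a submodule contains an element that
    is not killed, it contains one whose image is some [v_R] with [R] of that kind; as
    [q] is not a root of unity, its part in degree [0] can be extracted by the product
    of the [Y_i].  Thus the submodule meets the simple inducing module, and is
    everything ([full_submodule]).  The kernel is therefore the largest proper
    submodule.  A nonzero map from [M] to a simple module has the same kernel, which
    proves uniqueness of the quotient and identifies it with [L(k^N)]; semisimplicity and
    the support are read off from the basis, as distinct tableaux have distinct
    weights. *)

(** * Free modules and the modules given by generators and relations *)

Section LinearExtension.
Variables (A : pzRingType) (X : choiceType) (L : lmodType A) (e : X -> L).

Definition free_ext (g : {malg A[X]}) : L := \sum_(m <- msupp g) g@_m *: e m.

Lemma free_extEw (d : {fset X}) g : (msupp g `<=` d)%fset ->
  free_ext g = \sum_(m <- d) g@_m *: e m.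
Proof.
move=> le; rewrite /free_ext (big_fset_incl _ le) // => x _ /mcoeff_outdom ->.
by rewrite scale0r.
Qed.

Lemma free_extB : {morph free_ext : g h / g - h}.
Proof.
move=> g h; pose d := (msupp g `|` msupp h)%fset.
rewrite (free_extEw (msuppB_le g h : (_ `<=` d)%fset)).
rewrite (free_extEw (fsubsetUl _ _ : (msupp g `<=` d)%fset)).
rewrite (free_extEw (fsubsetUr _ _ : (msupp h `<=` d)%fset)) -sumrB.
by apply: eq_bigr => m _; rewrite -scalerBl mcoeffB.
Qed.

Lemma free_extU c m : free_ext << c *g m >> = c *: e m.
Proof. by rewrite (@free_extEw [fset m]%fset) ?msuppU_le // big_seq_fset1 mcoeffUU. Qed.

End LinearExtension.

(** The action is only known as a function, so the module is packed around the
    given abelian group.  The statement hides that [f] is the identity. *)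
Lemma module_of_action (A : pzRingType) (Z : zmodType) (act : A -> Z -> Z)
    (actA : forall a b v, act a (act b v) = act (a * b) v)
    (act1 : left_id 1 act) (actDr : right_distributive act +%R)
    (actDl : forall v, {morph act^~ v : a b / a + b}) :
  exists (L : lmodType A) (f : Z -> L),
    [/\ bijective f, {morph f : u v / u + v} & forall a w, a *: f w = f (act a w)].
Proof.
case: Z act actA act1 actDr actDl => T cT act actA act1 actDr actDl.
pose Z := Algebra.Zmodule.Pack cT.
pose mx := GRing.Zmodule_isLmodule.Build A Z actA act1 actDr actDl.
pose L : lmodType A := HB.pack T cT mx.
by exists L, (fun w => w); split=> //; exists id.
Qed.

Section PresentedModule.
Variables (K : fieldType) (X : choiceType).
Variable rel : free_alg K X -> free_alg K X -> Prop.
Variables (E : lmodType K) (op : X -> {linear E -> E}).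

Definition word_act (m : seq X) (w : E) : E := foldr (fun x => op x) w m.

Definition free_act (g : free_alg K X) (w : E) : E :=
  free_ext (fun m : {fmonom X} => word_act m w) g.

Lemma word_act_linear m : linear (word_act m).
Proof. by elim: m => [|x m IH] c u v //=; rewrite IH linearP. Qed.

Lemma free_act_linear g : linear (free_act g).
Proof.
move=> c u v; rewrite /free_act /free_ext scaler_sumr -big_split /=.
apply: eq_bigr => m _; rewrite word_act_linear scalerDr !scalerA.
by rewrite mulrC.
Qed.

Lemma free_actB w : {morph free_act^~ w : g h / g - h}.
Proof. exact: free_extB. Qed.

Lemma free_act0 w : free_act 0 w = 0.
Proof. by rewrite -(subrr 0) free_actB subrr. Qed.

Lemma free_actN w : {morph free_act^~ w : g / - g}.
Proof. by move=> g /=; rewrite -sub0r free_actB free_act0 sub0r. Qed.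

Lemma free_actD w : {morph free_act^~ w : g h / g + h}.
Proof. by move=> g h /=; have := free_actB w g (- h); rewrite /= opprK free_actN opprK. Qed.

Lemma free_act_sum w I (r : seq I) (F : I -> free_alg K X) :
  free_act (\sum_(i <- r) F i) w = \sum_(i <- r) free_act (F i) w.
Proof. exact: (big_morph _ (free_actD w) (free_act0 w)). Qed.

Lemma free_actU c m w : free_act << c *g m >> w = c *: word_act m w.
Proof. exact: (free_extU (fun m : {fmonom X} => word_act m w)). Qed.

Lemma free_actM g h w : free_act (g * h) w = free_act g (free_act h w).
Proof.
have -> : g * h = \sum_(k1 <- msupp (g : {malg K[{fmonom X}]}))
   \sum_(k2 <- msupp (h : {malg K[{fmonom X}]}))
   << (g : {malg K[{fmonom X}]})@_k1 * (h : {malg K[{fmonom X}]})@_k2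
      *g mmul k1 k2 >> by [].
rewrite free_act_sum; apply: eq_bigr => i _.
rewrite free_act_sum /free_act /free_ext.
have l0 : word_act i 0 = 0.
  by elim: (i : seq X) => //= x s ->; rewrite linear0.
have lD : {morph word_act i : u v / u + v}.
  by move=> u v; have := word_act_linear i 1 u v; rewrite !scale1r.
rewrite (big_morph _ lD l0) scaler_sumr; apply: eq_bigr => j _.
rewrite [LHS](@free_actU _ (mmul i j) w) -scalerA; congr (_ *: _).
rewrite fmM /word_act foldr_cat -/(word_act i _) -/(word_act j _).
by have := word_act_linear i (h : {malg K[{fmonom X}]})@_j (word_act j w) 0; rewrite l0 !addr0.
Qed.

Lemma free_actZ c w : free_act c%:A w = c *: w.
Proof.
have -> : (c%:A : free_alg K X) = << c *g @mone {fmonom X} >>.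
  by rewrite -[RHS](mulr1 (<< c *g @mone {fmonom X} >> : {malg K[{fmonom X}]})) mul_malgC.
by rewrite (free_actU c (@mone {fmonom X})) fm1.
Qed.

Lemma free_act1 w : free_act 1 w = w.
Proof. by rewrite -[X in free_act X]scale1r free_actZ scale1r. Qed.

Lemma free_act_gen x w : free_act (free_gen K x) w = op x w.
Proof. by rewrite (free_actU 1 (fmu x)) scale1r fmU. Qed.

Hypothesis op_rel : forall a b, rel a b -> forall w, free_act a w = free_act b w.

(** The elements that act by zero form a two-sided ideal, which contains the
    relations as soon as they hold for the operators. *)
Lemma free_act_ideal (g h : free_alg K X) w :
  presented_proj rel g = presented_proj rel h -> free_act g w = free_act h w.
Proof.
move=> e; apply/eqP; rewrite -subr_eq0 -free_actB; apply/eqP.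
have /ideal_genP/(_ (fun g => forall w, free_act g w = 0)) H :
    g - h \in @ideal_gen (free_alg K X)
      (fun s => exists a b, rel a b /\ s = a - b).
  by rewrite quot_projP; apply/eqP.
move: w; apply: H => [|s [a [b [rab ->]]] w]; last first.
  by rewrite free_actB (op_rel rab) subrr.
split=> [w|x y hx hy w|a x hx w|a x hx w].
- exact: free_act0.
- by rewrite free_actB hx hy subrr.
- have := free_act_linear a (-1) 0 0.
  by rewrite free_actM hx scaler0 addr0 scaleN1r addNr.
- by rewrite free_actM hx.
Qed.

Definition pres_act (a : presented rel) (w : E) : E := free_act (quot_rep a) w.

Lemma pres_act_proj g w : pres_act (presented_proj rel g) w = free_act g w.
Proof. by apply: free_act_ideal; apply: quot_repK. Qed.

Lemma pres_proj_surj (a : presented rel) : exists g, a = presented_proj rel g.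
Proof. by exists (quot_rep a); rewrite /presented_proj quot_repK. Qed.

Lemma pres_actA a b v : pres_act a (pres_act b v) = pres_act (a * b) v.
Proof.
have [g ->] := pres_proj_surj a; have [h ->] := pres_proj_surj b.
by rewrite -rmorphM !pres_act_proj free_actM.
Qed.

Lemma pres_act1 : left_id 1 pres_act.
Proof.
move=> v; rewrite -(rmorph1 (presented_proj rel)) pres_act_proj.
exact: free_act1.
Qed.

Lemma pres_actDr : right_distributive pres_act +%R.
Proof. by move=> a u v; have := free_act_linear (quot_rep a) 1 u v; rewrite !scale1r. Qed.

Lemma pres_actDl v : {morph pres_act^~ v : a b / a + b}.
Proof.
move=> a b; have [g ->] := pres_proj_surj a; have [h ->] := pres_proj_surj b.
by rewrite -rmorphD !pres_act_proj free_actD.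
Qed.

(** The universal property of a presented algebra, in the form in which modules
    are constructed: one only has to check the relations on the operators. *)
Lemma presented_module :
  exists (L : lmodType (presented rel)) (f : E -> L),
    [/\ bijective f, {morph f : u v / u + v},
        forall c w, presented_scal rel c *: f w = f (c *: w)
      & forall x w, presented_proj rel (free_gen K x) *: f w = f (op x w)].
Proof.
have [L [f [fbij fD fact]]] := module_of_action pres_actA pres_act1 pres_actDr pres_actDl.
exists L, f; split=> //.
  by move=> c w; rewrite -free_actZ -pres_act_proj fact.
by move=> x w; rewrite -free_act_gen -pres_act_proj fact.
Qed.

End PresentedModule.

(** Every element of a presented algebra is a K-combination of products of
    generators, so membership in a subset closed under these operations can be
    tested on generators. *)
Lemma presented_ind (K : fieldType) (X : choiceType)
    (rel : free_alg K X -> free_alg K X -> Prop) (S : presented rel -> Prop) :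
    S 0 -> (forall a b, S a -> S b -> S (a + b)) ->
    (forall c, S (presented_scal rel c)) ->
    (forall a b, S a -> S b -> S (a * b)) ->
    (forall x, S (presented_proj rel (free_gen K x))) ->
  forall a, S a.
Proof.
move=> S0 SD Sc SM SX a.
have [g ->] : exists g, a = presented_proj rel g.
  by exists (quot_rep a); rewrite /presented_proj quot_repK.
have -> : g = \sum_(m <- msupp (g : {malg K[{fmonom X}]}))
   ((g : {malg K[{fmonom X}]})@_m)%:A * (<< m >> : free_alg K X).
  rewrite {1}[g](@monalgE _ K (g : {malg K[{fmonom X}]})).
  apply: eq_bigr => m _; rewrite -scalerAl mul1r.
  apply/malgP => k; rewrite (mcoeffZ _ (<<m>> : {malg K[{fmonom X}]})).
  by rewrite !mcoeffU mulrnAr mulr1.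
rewrite rmorph_sum; apply: big_ind => // m _; rewrite rmorphM; apply: (SM); first exact: Sc.
case: m => s; elim: s => [|x s IH].
  have -> : (<< FMonom [::] >> : free_alg K X) = 1 by rewrite -fmoneE.
  by rewrite rmorph1 -(rmorph1 (presented_scal rel)); apply: Sc.
have -> : (<< FMonom (x :: s) >> : free_alg K X) = free_gen K x * << FMonom s >>.
  rewrite [RHS](fgmulUU 1 1 (fmu x) (FMonom s)) mulr1; congr (<< _ >>).
  by rewrite fmuE /mul /= fmmulE.
rewrite rmorphM; apply: SM; first exact: SX.
exact: IH.
Qed.

(** * Relations between the generators of the double affine Hecke algebra *)

(** The computations use the following consequences of the relations, in an
    arbitrary ring that satisfies them.  Working in the quotient of a free algebra
    itself is impractical, since comparing two terms may unfold that quotient.  The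
    indices of [alg_T], [alg_Y] and [alg_YV] only matter modulo [n]. *)
Record daha_alg (K : fieldType) (n : nat) (q t : K) := DahaAlg {
  alg_ring :> pzRingType;
  alg_scal : {rmorphism K -> alg_ring};
  alg_T : nat -> alg_ring;
  alg_Y : nat -> alg_ring;
  alg_YV : nat -> alg_ring;
  alg_Pi : alg_ring;
  alg_PiV : alg_ring;
  alg_scalC : forall c a, alg_scal c * a = a * alg_scal c;
  alg_T_mod : forall i j, i = j %[mod n] -> alg_T i = alg_T j;
  alg_Y_mod : forall i j, i = j %[mod n] -> alg_Y i = alg_Y j;
  alg_YV_mod : forall i j, i = j %[mod n] -> alg_YV i = alg_YV j;
  alg_PiK : alg_Pi * alg_PiV = 1;
  alg_PiVK : alg_PiV * alg_Pi = 1;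
  alg_YK : forall i, alg_Y i * alg_YV i = 1;
  alg_YVK : forall i, alg_YV i * alg_Y i = 1;
  alg_YC : forall i j, alg_Y i * alg_Y j = alg_Y j * alg_Y i;
  alg_quad : forall i, alg_T i * alg_T i = 1 + alg_scal (t - t^-1) * alg_T i;
  alg_braid : forall i, (0 < i)%N -> (i.+1 < n)%N ->
    alg_T i * alg_T i.+1 * alg_T i = alg_T i.+1 * alg_T i * alg_T i.+1;
  alg_TC : forall i j, (0 < i < n)%N -> (0 < j < n)%N -> (i.+1 < j)%N ->
    alg_T i * alg_T j = alg_T j * alg_T i;
  alg_PiT : forall i, alg_Pi * alg_T i = alg_T i.+1 * alg_Pi;
  alg_TY : forall i, (0 < i < n)%N -> alg_T i * alg_Y i * alg_T i = alg_Y i.+1;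
  alg_TYC : forall i j, (0 < i < n)%N -> (0 < j <= n)%N -> j != i -> j != i.+1 ->
    alg_T i * alg_Y j = alg_Y j * alg_T i;
  alg_PiY : forall i, (0 < i < n)%N -> alg_Pi * alg_Y i = alg_Y i.+1 * alg_Pi;
  alg_PiYn : alg_Pi * alg_Y n = alg_scal q^-1 * alg_Y 1 * alg_Pi;
  alg_ind : forall S : alg_ring -> Prop,
    S 0 -> (forall a b, S a -> S b -> S (a + b)) -> (forall c, S (alg_scal c)) ->
    (forall a b, S a -> S b -> S (a * b)) ->
    (forall i, S (alg_T i)) -> S alg_Pi -> S alg_PiV -> (forall i, S (alg_Y i)) ->
    (forall i, S (alg_YV i)) -> forall a, S a
}.

Arguments alg_scalC {K n q t d}.
Arguments alg_T_mod {K n q t d}.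
Arguments alg_Y_mod {K n q t d}.
Arguments alg_YV_mod {K n q t d}.
Arguments alg_PiK {K n q t d}.
Arguments alg_PiVK {K n q t d}.
Arguments alg_YK {K n q t d}.
Arguments alg_YVK {K n q t d}.
Arguments alg_YC {K n q t d}.
Arguments alg_quad {K n q t d}.
Arguments alg_braid {K n q t d}.
Arguments alg_TC {K n q t d}.
Arguments alg_PiT {K n q t d}.
Arguments alg_TY {K n q t d}.
Arguments alg_TYC {K n q t d}.
Arguments alg_PiY {K n q t d}.
Arguments alg_PiYn {K n q t d}.
Arguments alg_ind {K n q t d}.

Section AlgRelations.
Variables (K : fieldType) (n : nat) (q t : K) (H : daha_alg n q t).
Hypotheses (n_ge2 : (2 <= n)%N) (t_neq0 : t != 0) (q_neq0 : q != 0).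

Local Notation sc := (alg_scal H).
Local Notation T := (alg_T H).
Local Notation Y := (alg_Y H).
Local Notation YV := (alg_YV H).
Local Notation Pi := (alg_Pi H).
Local Notation PiV := (alg_PiV H).
Local Notation tau := (t - t^-1).

(** The inverse of [T i], by the quadratic relation. *)
Definition alg_Tinv i : H := T i - sc tau.
Local Notation Tinv := alg_Tinv.

Lemma alg_TK i : T i * Tinv i = 1.
Proof. by rewrite mulrBr alg_quad alg_scalC addrK. Qed.

Lemma alg_TVK i : Tinv i * T i = 1.
Proof. by rewrite mulrBl alg_quad addrK. Qed.

Lemma commute_inv (A : pzRingType) (u a b c d : A) :
  a * b = 1 -> d * c = 1 -> u * a = c * u -> u * b = d * u.
Proof.
move=> ab dc e; rewrite -[LHS]mul1r -dc -mulrA (mulrA c) -e -!mulrA ab mulr1 //.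
Qed.

Lemma alg_PiYV i : (0 < i < n)%N -> Pi * YV i = YV i.+1 * Pi.
Proof. by move=> hi; apply: (commute_inv (alg_YK i) (alg_YVK _)); exact: alg_PiY. Qed.

Lemma alg_PiYVn : Pi * YV n = sc q * YV 1 * Pi.
Proof.
apply: (commute_inv (alg_YK n) _ alg_PiYn).
by rewrite mulrA -(mulrA (sc q)) -alg_scalC mulrA -rmorphM mulfV // rmorph1 mul1r alg_YVK.
Qed.

(** The next lemmas move [Y_j] and its inverse to the right of [T_i]; they are
    Bernstein's relations, obtained from [T_i Y_i T_i = Y_{i+1}]. *)
Lemma alg_YTi i : (0 < i < n)%N -> Y i * T i = Tinv i * Y i.+1.
Proof. by move=> hi; rewrite -(alg_TY _ hi) !mulrA alg_TVK mul1r. Qed.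

Lemma alg_YTSi i : (0 < i < n)%N -> Y i.+1 * T i = T i * Y i + sc tau * Y i.+1.
Proof.
move=> hi; rewrite -(alg_TY _ hi) -!mulrA alg_quad !mulrDr mulr1; congr (_ + _).
by rewrite !mulrA alg_scalC -!(mulrA (T i)) (alg_scalC _ (Y i)) !mulrA.
Qed.

Lemma alg_YTC i j : (0 < i < n)%N -> (0 < j <= n)%N -> j != i -> j != i.+1 ->
  Y j * T i = T i * Y j.
Proof. by move=> *; rewrite alg_TYC. Qed.

Lemma alg_YVTi i : (0 < i < n)%N -> YV i * T i = T i * YV i.+1 + sc tau * YV i.
Proof.
move=> hi; apply/eqP; rewrite -subr_eq alg_scalC -mulrBr -/(Tinv i); apply/eqP.
rewrite -[LHS]mulr1 -(alg_YK i.+1) -mulrA (mulrA (Tinv i)) -alg_YTi //.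
by rewrite !mulrA alg_YVK mul1r.
Qed.

Lemma alg_YVTSi i : (0 < i < n)%N -> YV i.+1 * T i = Tinv i * YV i.
Proof.
move=> hi; rewrite -[RHS]mul1r -(alg_YVK i.+1) -mulrA -(alg_TY _ hi).
by rewrite -!(mulrA (T i)) (mulrA (_ * _) (Tinv i)) -(mulrA (Y i)) alg_TK mulr1 alg_YK mulr1.
Qed.

Lemma alg_YVTC i j : (0 < i < n)%N -> (0 < j <= n)%N -> j != i -> j != i.+1 ->
  YV j * T i = T i * YV j.
Proof.
move=> hi hj ji jSi; apply/esym; apply: (commute_inv (alg_YK j) (alg_YVK j)).
exact: alg_TYC.
Qed.

End AlgRelations.

Lemma eqn_mod_small n i j : (0 < i <= n)%N -> (0 < j <= n)%N ->
  (i == j %[mod n])%N = (i == j).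
Proof.
wlog le_ji : i j / (j <= i)%N => [H hi hj|].
  case: (leqP j i) => h; first exact: H.
  by rewrite eq_sym [RHS]eq_sym; apply: H => //; apply: ltnW.
move=> hi hj; rewrite (eqn_mod_dvd n le_ji).
case: eqVneq => [->|ne]; first by rewrite subnn dvdn0.
by rewrite gtnNdvd //; lia.
Qed.

(** The product form of the quadratic relation, expanded. *)
Lemma quad_expand (A : pzRingType) (x s s' d : A) :
  s * s' = 1 -> d = s - s' -> s * x = x * s -> s' * x = x * s' ->
  (x - s) * (x + s') = 0 -> x * x = 1 + d * x.
Proof.
move=> ss' -> sx s'x.
rewrite mulrBl !mulrDr ss' mulrBl s'x => /eqP; rewrite subr_eq0 => /eqP e.
by rewrite addrA [1 + _]addrC -e addrK.
Qed.

Lemma conj_move (A : pzRingType) (p p' a b : A) :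
  p' * p = 1 -> p * a * p' = b -> p * a = b * p.
Proof. by move=> e <-; rewrite -!mulrA e mulr1. Qed.

Section DahaInstance.
Variables (K : fieldType) (n : nat) (q t : K).
Hypotheses (n_ge2 : (2 <= n)%N) (t_neq0 : t != 0).

Local Notation H := (daha n q t).
Local Notation sc := (daha_scal n q t).
Local Notation T := (daha_T n q t).
Local Notation Y := (daha_Y n q t).
Local Notation YV := (daha_YV n q t).
Local Notation pr := (presented_proj (@daha_rel K n q t)).

Definition daha_Pi : H := pr (free_Pi K n).
Definition daha_PiV : H := pr (free_PiV K n).

Local Notation Pi := daha_Pi.
Local Notation PiV := daha_PiV.

Lemma daha_relE a b : @daha_rel K n q t a b -> pr a = pr b.
Proof.
move=> rab; apply/eqP; rewrite /presented_proj -quot_projP.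
by apply/ideal_genP => J _; apply; exists a, b.
Qed.

Lemma daha_projM g h : pr (g * h) = pr g * pr h. Proof. exact: rmorphM. Qed.
Lemma daha_projD g h : pr (g + h) = pr g + pr h. Proof. exact: rmorphD. Qed.
Lemma daha_projB g h : pr (g - h) = pr g - pr h. Proof. exact: rmorphB. Qed.
Lemma daha_proj1 : pr 1 = 1. Proof. exact: rmorph1. Qed.
Lemma daha_proj0 : pr 0 = 0. Proof. exact: rmorph0. Qed.

Lemma daha_projZ c g : pr (c *: g) = sc c * pr g.
Proof. by rewrite -[in LHS](mul1r g) scalerAl daha_projM. Qed.

Lemma gen_mod i j : i = j %[mod n] -> inZp i = inZp j :> 'I_n.-1.+1.
Proof. by move=> e; apply: val_inj => /=; rewrite prednK //; apply: ltnW. Qed.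

Lemma inZp_ord (i : 'I_n.-1.+1) : inZp i = i.
Proof. by apply: val_inj; rewrite /= modn_small. Qed.

Lemma daha_ind (S : H -> Prop) :
  S 0 -> (forall a b, S a -> S b -> S (a + b)) -> (forall c, S (sc c)) ->
  (forall a b, S a -> S b -> S (a * b)) ->
  (forall i, S (T i)) -> S Pi -> S PiV -> (forall i, S (Y i)) ->
  (forall i, S (YV i)) -> forall a, S a.
Proof.
move=> S0 SD Sc SM ST SP SV SY SYV; apply: (presented_ind S0 SD Sc SM).
case=> [i|||i|i]; last 2 first.
- by rewrite -[i]inZp_ord; exact: (SY i).
- by rewrite -[i]inZp_ord; exact: (SYV i).
- by rewrite -[i]inZp_ord; exact: (ST i).
- exact: SP.
- exact: SV.
Qed.

Lemma free_scalC c x :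
  (c%:A : free_alg K (daha_gen n)) * free_gen K x = free_gen K x * c%:A.
Proof.
have e : (c%:A : free_alg K (daha_gen n)) =
   (<< c *g @mone {fmonom daha_gen n} >> : {malg K[{fmonom daha_gen n}]}).
  by rewrite -[RHS](mulr1 (<< c *g @mone _ >> : {malg K[{fmonom daha_gen n}]}))
             mul_malgC.
rewrite e; have -> : free_gen K x = (<< 1 *g fmu x >> : {malg K[{fmonom daha_gen n}]}) by [].
by rewrite [LHS](fgmulUU c 1) [RHS](fgmulUU 1 c) mulm1 mul1m mul1r mulr1.
Qed.

Lemma daha_scalC c (a : H) : sc c * a = a * sc c.
Proof.
have gen x : sc c * pr (free_gen K x) = pr (free_gen K x) * sc c.
  apply: etrans (esym (daha_projM _ _)) (etrans _ (daha_projM _ _)).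
  by rewrite free_scalC.
elim/daha_ind: a => [|a b ha hb|d|a b ha hb|i|||i|i]; try exact: gen.
- exact: etrans (mulr0 _) (esym (mul0r _)).
- by apply: (etrans (mulrDr _ _ _)); rewrite ha hb; apply: (esym (mulrDl _ _ _)).
- apply: (etrans (esym (rmorphM sc c d))); rewrite (mulrC c); exact: (rmorphM sc d c).
- apply: (etrans (mulrA _ _ _)); rewrite ha; apply: (etrans (esym (mulrA _ _ _))).
  by rewrite hb; apply: mulrA.
Qed.

Lemma daha_PiVK : PiV * Pi = 1.
Proof. exact: etrans (esym (daha_projM _ _)) (etrans (daha_relE (Rel_VPi n q t)) daha_proj1). Qed.

Lemma daha_proj3 a b c : pr (a * b * c) = pr a * pr b * pr c.
Proof. exact: etrans (daha_projM _ _) (congr1 ( *%R^~ _) (daha_projM _ _)). Qed.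

Lemma daha_quad i : T i * T i = 1 + sc (t - t^-1) * T i.
Proof.
apply: (@quad_expand H (T i) (sc t) (sc t^-1)).
- by apply: (etrans (esym (rmorphM sc t t^-1))); rewrite mulfV //; exact: (rmorph1 sc).
- exact: (rmorphB sc).
- exact: daha_scalC.
- exact: daha_scalC.
exact: (etrans (congr2 *%R (esym (daha_projB _ _)) (esym (daha_projD _ _)))
  (etrans (esym (daha_projM _ _)) (etrans (daha_relE (Rel_Quad n q t i)) daha_proj0))).
Qed.

Lemma daha_PiT i : Pi * T i = T i.+1 * Pi.
Proof.
apply: (conj_move daha_PiVK).
exact: etrans (esym (daha_proj3 _ _ _)) (daha_relE (Rel_PiT n q t i)).
Qed.

Lemma daha_PiY i : (0 < i < n)%N -> Pi * Y i = Y i.+1 * Pi.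
Proof.
move=> hi; apply: (conj_move daha_PiVK).
exact: etrans (esym (daha_proj3 _ _ _)) (daha_relE (Rel_PiY q t hi)).
Qed.

Lemma daha_PiYn : Pi * Y n = sc q^-1 * Y 1 * Pi.
Proof.
apply: (conj_move daha_PiVK).
exact: etrans (esym (daha_proj3 _ _ _))
  (etrans (daha_relE (Rel_PiYn n q t)) (daha_projZ _ _)).
Qed.

(** Transparent, so that the modules over this instance are the modules over the
    algebra itself. *)
Definition daha_inst : daha_alg n q t.
Proof.
apply: (@DahaAlg K n q t H sc T Y YV Pi PiV).
- exact: daha_scalC.
- by move=> i j e; rewrite /daha_T /free_T (gen_mod e).
- by move=> i j e; rewrite /daha_Y /free_Y (gen_mod e).
- by move=> i j e; rewrite /daha_YV /free_YV (gen_mod e).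
- exact: etrans (esym (daha_projM _ _)) (etrans (daha_relE (Rel_PiV n q t)) daha_proj1).
- exact: daha_PiVK.
- by move=> i; exact: etrans (esym (daha_projM _ _)) (etrans (daha_relE (Rel_YV n q t i)) daha_proj1).
- by move=> i; exact: etrans (esym (daha_projM _ _)) (etrans (daha_relE (Rel_VY n q t i)) daha_proj1).
- move=> i j; exact: etrans (esym (daha_projM _ _))
    (etrans (daha_relE (Rel_YY n q t i j)) (daha_projM _ _)).
- exact: daha_quad.
- move=> i i0 iN; have h1 : n != 2 by lia.
  have h2 : (i.+1 == i.+1 %[mod n])%N || (i == i.+2 %[mod n])%N by rewrite eqxx.
  exact: etrans (esym (daha_proj3 _ _ _)) (etrans (daha_relE (Rel_Braid q t h1 h2)) (daha_proj3 _ _ _)).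
- move=> i j hi hj ij; have h1 : n != 2 by lia.
  have h2 : (j != i.+1 %[mod n])%N && (i != j.+1 %[mod n])%N.
    by rewrite !eqn_mod_small; lia.
  exact: etrans (esym (daha_projM _ _)) (etrans (daha_relE (Rel_Comm q t h1 h2)) (daha_projM _ _)).
- exact: daha_PiT.
- by move=> i hi; exact: etrans (esym (daha_proj3 _ _ _)) (daha_relE (Rel_TY q t hi)).
- move=> i j hi hj ji jSi.
  have h2 : (j != i %[mod n])%N && (j != i.+1 %[mod n])%N.
    by rewrite !eqn_mod_small; lia.
  exact: etrans (esym (daha_projM _ _)) (etrans (daha_relE (Rel_TYcomm q t h2)) (daha_projM _ _)).
- exact: daha_PiY.
- exact: daha_PiYn.
- exact: daha_ind.
Defined.

End DahaInstance.

(** * Periodic tableaux and their diagonals *)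

Section Swap.
Variable n : nat.
Hypothesis n_ge2 : (2 <= n)%N.

(** The simple reflection [s_i] of the affine symmetric group, as a permutation of
    the integers that commutes with the translation by [n]. *)
Definition zswap (i e : int) : int :=
  if (n%:Z %| e - i)%Z then e + 1 else
  if (n%:Z %| e - i - 1)%Z then e - 1 else e.

Variant zswap_spec (i e : int) : int -> Type :=
| ZswapL of (n%:Z %| e - i)%Z : zswap_spec i e (e + 1)
| ZswapR of (n%:Z %| e - i - 1)%Z : zswap_spec i e (e - 1)
| ZswapN of ~~ (n%:Z %| e - i)%Z & ~~ (n%:Z %| e - i - 1)%Z : zswap_spec i e e.

Lemma zswapP i e : zswap_spec i e (zswap i e).
Proof.
rewrite /zswap; case: ifP => [|/negbT] h; first by constructor.
by case: ifP => [|/negbT] h'; constructor.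
Qed.

Lemma dvd_small (x : int) : (n%:Z %| x)%Z -> - n%:Z < x -> x < n%:Z -> x = 0.
Proof. 
rewrite dvdzE /= => /dvdnP[[|m] hm] h1 h2; first by lia.
by have : (n <= m.+1 * n)%N by [rewrite leq_pmull]; lia.
Qed.

Lemma dvd_sub x y : (n%:Z %| x)%Z -> (n%:Z %| y)%Z -> - n%:Z < x - y -> x - y < n%:Z -> x = y.
Proof.
move=> hx hy h1 h2; apply/eqP; rewrite -subr_eq0; apply/eqP.
by apply: dvd_small => //; rewrite rpredB.
Qed.

Lemma zswap_l i : zswap i i = i + 1.
Proof. by rewrite /zswap subrr dvdz0. Qed.

Lemma zswapK i : involutive (zswap i).
Proof.
move=> e; case: (zswapP i e) => [h|h|h h']; case: zswapP => [g|g|g g'] //; try lia.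
- have := dvd_sub g h; lia.
- by move/negP: g'; case; rewrite (_ : e + 1 - i - 1 = e - i) //; lia.
- have := dvd_sub g h; lia.
- by move/negP: g; case; rewrite (_ : e - 1 - i = e - i - 1) //; lia.
Qed.

Lemma zswap_r i : zswap i (i + 1) = i.
Proof. by rewrite -[in LHS](zswap_l i) zswapK. Qed.

Lemma zswap_period i e m : zswap i (e + m * n%:Z) = zswap i e + m * n%:Z.
Proof.
rewrite /zswap; have d x : (n%:Z %| x + m * n%:Z)%Z = (n%:Z %| x)%Z.
  by apply: rpredDr; apply: dvdz_mull; apply: dvdzz.
rewrite (_ : e + m * n%:Z - i = e - i + m * n%:Z) ?d; last by lia.
rewrite (_ : e - i + m * n%:Z - 1 = e - i - 1 + m * n%:Z) ?d; last by lia.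
by case: ifP => _; [lia | case: ifP => _; lia].
Qed.

Lemma zswap_mod i j e : (n%:Z %| i - j)%Z -> zswap i e = zswap j e.
Proof.
move=> /dvdzP[m h]; rewrite /zswap; have d x : (n%:Z %| x + m * n%:Z)%Z = (n%:Z %| x)%Z.
  by apply: rpredDr; apply: dvdz_mull; apply: dvdzz.
rewrite (_ : e - j = e - i + m * n%:Z) ?d; last by lia.
by rewrite (_ : e - i + m * n%:Z - 1 = e - i - 1 + m * n%:Z) ?d //; lia.
Qed.

Lemma zswap_id i e : ~~ (n%:Z %| e - i)%Z -> ~~ (n%:Z %| e - i - 1)%Z -> zswap i e = e.
Proof. by rewrite /zswap => /negbTE -> /negbTE ->. Qed.

(** The only inversions of [s_i] are the pairs [(i + m n, i + 1 + m n)], so that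
    applying it to the entries keeps a tableau standard unless such a pair is
    adjacent in a row or in a column. *)
Lemma zswap_lt i x y : x < y -> ~ (y = x + 1 /\ (n%:Z %| x - i)%Z) ->
  zswap i x < zswap i y.
Proof.
move=> xy nadj; case: (zswapP i x) => [h|h|h h']; case: (zswapP i y) => [g|g|g g']; try lia.
- case: (eqVneq y (x + 1)) => [e|]; first by (case: nadj; split).
  case: (eqVneq y (x + 2)) => [e _|]; last by lia.
  have := dvd_sub g h; lia.
- case: (eqVneq y (x + 1)) => [e|]; last by lia.
  by move/negP: h; case; rewrite (_ : x - i = y - i - 1) //; lia.
Qed.

Lemma zswap_mono_gt0 (i : nat) e : (0 < i < n)%N -> (1 <= zswap i%:Z e) = (1 <= e).
Proof.
move=> hi; case: zswapP => [h|h|//].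
  case: (leP 1 e) => e1; first by lia.
  apply/negbTE/negP => h0; have e0 : e = 0 by lia.
  have := dvd_small h; lia.
case: (leP 1 e) => e1; last by lia.
case: (eqVneq e 1) => [e0|]; last by lia.
have := dvd_small h; lia.
Qed.

Lemma zswap_range (i : nat) e : (0 < i < n)%N ->
  (1 <= zswap i%:Z e <= n%:Z) = (1 <= e <= n%:Z).
Proof.
move=> hi; rewrite zswap_mono_gt0 //; congr (_ && _).
case: zswapP => [h|h|//].
  case: (leP e n%:Z) => e1; last by lia.
  case: (eqVneq e n%:Z) => [e0|]; last by lia.
  have := dvd_small h; rewrite e0.
  have : (n%:Z %| n%:Z - i%:Z - n%:Z)%Z by rewrite rpredB //; subst e.
  by move/dvd_small; lia.
case: (leP e n%:Z) => e1; first by lia.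
apply/negbTE/negP => h0; have e0 : e = n%:Z + 1 by lia.
have : (n%:Z %| n%:Z + 1 - i%:Z - 1 - n%:Z)%Z by rewrite rpredB //; subst e.
by move/dvd_small; lia.
Qed.

(** For [0 < i < n] the reflection preserves the window [1, ..., n]. *)
Lemma sum_zswap (A : nmodType) (F : int -> A) (i : nat) : (0 < i < n)%N ->
  \sum_(e < n) F (zswap i%:Z e.+1%:Z) = \sum_(e < n) F e.+1%:Z.
Proof.
move=> hi.
have rg (e : 'I_n) : (`|zswap i%:Z e.+1%:Z|.-1 < n)%N.
  have : 1 <= e.+1%:Z <= n%:Z by have := ltn_ord e; lia.
  by rewrite -(zswap_range _ hi); lia.
have valE (e : 'I_n) : (`|zswap i%:Z e.+1%:Z|.-1.+1)%:Z = zswap i%:Z e.+1%:Z.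
  have : 1 <= e.+1%:Z <= n%:Z by have := ltn_ord e; lia.
  by rewrite -(zswap_range _ hi); lia.
pose s (e : 'I_n) : 'I_n := Ordinal (rg e).
have sK : involutive s.
  move=> e; apply: val_inj; rewrite /=; move: (valE e) => ->.
  by rewrite zswapK.
rewrite [RHS](reindex_inj (inv_inj sK)) /=; apply: eq_bigr => e _.
by rewrite valE.
Qed.

End Swap.

Section Residue.
Variables (m : nat) (m_gt0 : (0 < m)%N).

Lemma residue_subproof (x : int) : (`|(x %% m%:Z)%Z| < m)%N.
Proof. by have := modz_ge0 x (_ : m%:Z != 0); have := ltz_pmod x (_ : 0 < m%:Z); lia. Qed.

Definition residue (x : int) : 'I_m := Ordinal (residue_subproof x).

Lemma residue_eq (x : int) : x = (residue x)%:Z + (x %/ m%:Z)%Z * m%:Z.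
Proof.
rewrite [LHS](divz_eq x m%:Z) /= addrC; congr (_ + _).
by have := modz_ge0 x (_ : m%:Z != 0); lia.
Qed.

Lemma residueK (i : 'I_m) (a : int) : residue (i%:Z + a * m%:Z) = i.
Proof.
by apply: val_inj => /=; rewrite addrC modzMDl modz_small //; have := ltn_ord i; lia.
Qed.

Lemma quotientK (i : 'I_m) (a : int) : ((i%:Z + a * m%:Z) %/ m%:Z)%Z = a.
Proof.
rewrite addrC divzMDl; last by lia.
by rewrite divz_small ?addr0 ?add0r //; have := ltn_ord i; lia.
Qed.

End Residue.

Section Psyt.
Variables N k : nat.
Hypothesis n_ge2 : (2 <= k * N)%N.

Local Notation n := (k * N)%N.
Local Notation psyt := (psyt N k).
Local Notation ent := psyt_entry.
Local Notation dg := psyt_diag.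

Definition psyt_column (R : psyt) (e : int) : int := (psyt_box R e).2.
Local Notation col := psyt_column.

HB.instance Definition _ := gen_eqMixin psyt.
HB.instance Definition _ := gen_choiceMixin psyt.

Lemma k_pos : (0 < k)%N. Proof. by case: k n_ge2; rewrite ?mul0n. Qed.
Lemma N_pos : (0 < N)%N. Proof. by case: N n_ge2; rewrite ?muln0. Qed.

Lemma psyt_diagE (R : psyt) j c e : psyt_box R e = (j, c) -> dg R e = c - j.+1%:Z.
Proof. by rewrite /dg => ->. Qed.

Lemma psyt_eq (R R' : psyt) : ent R =1 ent R' -> R = R'.
Proof.
case: R R' => f b fK bK r c p d [f' b' fK' bK' r' c' p' d'] /= /funext ff'.
rewrite -{f'}ff' in fK' bK' r' c' p' d' *.
have bb' : b = b' by apply: funext => x; rewrite -[x in LHS]bK' fK.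
rewrite -{b'}bb' in fK' bK' *.
by congr Psyt; apply: Prop_irrelevance.
Qed.

Lemma box_period (R : psyt) e m :
  psyt_box R (e + m * n%:Z) = ((psyt_box R e).1, (psyt_box R e).2 + m * k%:Z).
Proof.
have pos (m' : nat) e' : psyt_box R (e' + m'%:Z * n%:Z)
     = ((psyt_box R e').1, (psyt_box R e').2 + m'%:Z * k%:Z).
  elim: m' => [|m' IH]; first by rewrite !mul0r !addr0; case: psyt_box.
  rewrite (_ : e' + _ = e' + m'%:Z * n%:Z + n%:Z); last by lia.
  have := psyt_boxK R (e' + m'%:Z * n%:Z); rewrite IH => <-.
  by rewrite -psyt_period psyt_entryK /=; congr (_, _); lia.
case: m => m; first exact: pos.
have := pos m.+1 (e + Negz m * n%:Z).
rewrite (_ : e + Negz m * n%:Z + m.+1%:Z * n%:Z = e); last by lia.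
move=> ->; case: psyt_box => j c /=; congr (_, _); lia.
Qed.

Lemma diag_period (R : psyt) e m : dg R (e + m * n%:Z) = dg R e + m * k%:Z.
Proof. by rewrite /dg box_period /=; lia. Qed.

Lemma col_period (R : psyt) e m : col R (e + m * n%:Z) = col R e + m * k%:Z.
Proof. by rewrite /col box_period. Qed.

Lemma ent_row (R : psyt) (j : 'I_N) (c c' : int) : c < c' -> ent R (j, c) < ent R (j, c').
Proof. exact: psyt_row. Qed.

Lemma ent_col (R : psyt) (j j' : 'I_N) (c : int) :
  (j < j')%N -> ent R (j, c) < ent R (j', c).
Proof. exact: psyt_col. Qed.

Lemma ent_lerow (R : psyt) (j : 'I_N) (c c' : int) : c <= c' -> ent R (j, c) <= ent R (j, c').
Proof.
by rewrite le_eqVlt => /orP[/eqP ->|/(ent_row R j)/ltW].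
Qed.

Lemma ent_lecol (R : psyt) (j j' : 'I_N) (c : int) : (j <= j')%N -> ent R (j, c) <= ent R (j', c).
Proof.
rewrite leq_eqVlt => /orP[/eqP/val_inj ->//|/(ent_col R c)/ltW //].
Qed.

Lemma ent_le (R : psyt) (j j' : 'I_N) (c c' : int) :
  (j <= j')%N -> c <= c' -> ent R (j, c) <= ent R (j', c').
Proof. by move=> hj hc; apply: le_trans (ent_lecol _ _ hj) (ent_lerow _ _ hc). Qed.

Lemma ent_lt (R : psyt) (j j' : 'I_N) (c c' : int) :
  (j <= j')%N -> c < c' -> ent R (j, c) < ent R (j', c').
Proof. by move=> hj hc; apply: le_lt_trans (ent_lecol _ _ hj) (ent_row _ _ hc). Qed.

(** Entries on one diagonal are separated by more than [2]: between two boxes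
    [(j, c)] and [(j + 1, c + 1)] of the same diagonal lie [(j, c + 1)] and
    [(j + 1, c)]. *)
Lemma diag_neq1 (R : psyt) e : dg R e != dg R (e + 1).
Proof.
apply/eqP; case E : (psyt_box R e) => [j c]; case E' : (psyt_box R (e + 1)) => [j' c'].
rewrite (psyt_diagE E) (psyt_diagE E') => d.
have he := psyt_boxK R e; have he' := psyt_boxK R (e + 1); rewrite E E' in he he'.
case: (ltngtP j j') => h.
- have c1 : c < c' by lia.
  have h1 := ent_row R j c1. have h2 := ent_col R c' h. lia.
- have c1 : c' < c by lia.
  have h1 := ent_lt R (ltnW h) c1. lia.
- have jj : j = j' by apply: val_inj.
  have cc : c = c' by lia.
  by move: he'; rewrite -jj -cc he; lia.
Qed.

Lemma diag_neq2 (R : psyt) e : dg R e != dg R (e + 2).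
Proof.
apply/eqP; case E : (psyt_box R e) => [j c]; case E' : (psyt_box R (e + 2)) => [j' c'].
rewrite (psyt_diagE E) (psyt_diagE E') => d.
have he := psyt_boxK R e; have he' := psyt_boxK R (e + 2); rewrite E E' in he he'.
case: (ltngtP j j') => h.
- have c1 : c < c' by lia.
  have h1 := ent_row R j c1; have h2 := ent_col R c' h.
  have h3 := ent_row R j' c1; have h4 := ent_col R c h.
  have : ent R (j, c') = ent R (j', c) by lia.
  by move/(can_inj (psyt_entryK R)) => [] jj; rewrite jj ltnn in h.
- have c1 : c' < c by lia.
  have h1 := ent_lt R (ltnW h) c1. lia.
- have jj : j = j' by apply: val_inj.
  have cc : c = c' by lia.
  by move: he'; rewrite -jj -cc he; lia.
Qed.

(** Consecutive entries in one row or one column are adjacent there, hence on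
    neighbouring diagonals; so under this condition exchanging [i] and [i + 1]
    keeps the tableau standard. *)
Definition swappable (R : psyt) (i : int) : bool := `|dg R (i + 1) - dg R i| != 1.

Section SwapTableau.
Variables (R : psyt) (i : int) (sw : swappable R i).
Local Notation s := (zswap n i).

Lemma swap_entryK : cancel (s \o ent R) (psyt_box R \o s).
Proof. by move=> x /=; rewrite zswapK // psyt_entryK. Qed.

Lemma swap_boxK : cancel (psyt_box R \o s) (s \o ent R).
Proof. by move=> x /=; rewrite psyt_boxK zswapK. Qed.

(** Consecutive entries exchanged by [s_i] cannot be neighbours in a row or a
    column, as those lie on neighbouring diagonals. *)
Lemma swap_adj (j : 'I_N) (c : int) (j' : 'I_N) (c' : int) : ent R (j', c') = ent R (j, c) + 1 ->
  (n%:Z %| ent R (j, c) - i)%Z -> `|(c' - j'%:Z) - (c - j%:Z)| != 1.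
Proof.
move=> e1 /dvdzP[m hm]; have e0 : ent R (j, c) = i + m * n%:Z by lia.
have b0 := psyt_entryK R (j, c); have b1 := psyt_entryK R (j', c').
rewrite e0 in b0; rewrite e1 e0 (_ : _ + 1 = i + 1 + m * n%:Z) in b1; last by lia.
move: sw; rewrite /swappable.
have := psyt_diagE b0; have := psyt_diagE b1; rewrite !diag_period; lia.
Qed.

Lemma swap_row (j : 'I_N) (c c' : int) : c < c' -> (s \o ent R) (j, c) < (s \o ent R) (j, c').
Proof.
move=> cc /=; apply: (zswap_lt n_ge2); first exact: ent_row.
move=> [e1 h]; have := swap_adj e1 h.
case: (eqVneq c' (c + 1)) => [->|ne]; first by lia.
have c1 : c < c + 1 by lia.
have c2 : c + 1 < c' by lia.
have h1 := ent_row R j c1. have h2 := ent_row R j c2. lia.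
Qed.

Lemma swap_col (j j' : 'I_N) (c : int) : (j < j')%N -> (s \o ent R) (j, c) < (s \o ent R) (j', c).
Proof.
move=> jj /=; apply: (zswap_lt n_ge2); first exact: ent_col.
move=> [e1 h]; have := swap_adj e1 h.
case: (eqVneq (val j') j.+1) => [->|ne]; first by lia.
have c1 : (j.+1 < j')%N by move: jj ne => /=; lia.
pose j1 := Ordinal (ltn_trans c1 (ltn_ord j')).
have h1 := @ent_col R j j1 c (ltnSn _).
have h2 := @ent_col R j1 j' c c1. lia.
Qed.

Lemma swap_period (j : 'I_N) (c : int) : (s \o ent R) (j, c + k%:Z) = (s \o ent R) (j, c) + n%:Z.
Proof. by rewrite /= psyt_period; have := zswap_period n_ge2 i (ent R (j, c)) 1; rewrite !mul1r. Qed.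

Lemma swap_distinct (j j' : 'I_N) (c c' : int) : 1 <= c <= k%:Z -> 1 <= c' <= k%:Z ->
  ((s \o ent R) (j, c) = (s \o ent R) (j', c') %[mod n%:Z])%Z -> (j, c) = (j', c').
Proof.
move=> hc hc' /= /eqP; rewrite eqz_mod_dvd => /dvdzP[m hm].
have key : (n%:Z %| ent R (j, c) - ent R (j', c'))%Z; last first.
  by apply: (psyt_distinct hc hc'); apply/eqP; rewrite eqz_mod_dvd; exact: key.
apply/dvdzP; exists m.
have : s (ent R (j, c)) = s (ent R (j', c') + m * n%:Z) by rewrite zswap_period; lia.
by move/(inv_inj (zswapK n_ge2 i)) => ->; lia.
Qed.

Definition swap_tableau : psyt :=
  Psyt swap_entryK swap_boxK swap_row swap_col swap_period swap_distinct.

End SwapTableau.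

(** The value [R] when [i] and [i + 1] cannot be exchanged is a convention: this
    term always comes with the coefficient zero. *)
Definition psyt_swap (i : int) (R : psyt) : psyt :=
  match boolP (swappable R i) with
  | AltTrue sw => swap_tableau sw
  | AltFalse _ => R
  end.

Lemma box_swap i R e : swappable R i ->
  psyt_box (psyt_swap i R) e = psyt_box R (zswap n i e).
Proof. by rewrite /psyt_swap; case: {-}_ / boolP => [sw _|/negP]. Qed.

Lemma psyt_swap_id i R : ~~ swappable R i -> psyt_swap i R = R.
Proof. by rewrite /psyt_swap; case: {-}_ / boolP => [sw /negP|]. Qed.

Lemma diag_swap i R e : swappable R i -> dg (psyt_swap i R) e = dg R (zswap n i e).
Proof. by move=> sw; rewrite /dg box_swap. Qed.

Lemma col_swap i R e : swappable R i -> col (psyt_swap i R) e = col R (zswap n i e).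
Proof. by move=> sw; rewrite /col box_swap. Qed.

Section ShiftTableau.
Variables (R : psyt) (x : int).

Lemma shift_entryK : cancel (fun b => ent R b + x) (fun e => psyt_box R (e - x)).
Proof. by move=> b /=; rewrite addrK psyt_entryK. Qed.

Lemma shift_boxK : cancel (fun e => psyt_box R (e - x)) (fun b => ent R b + x).
Proof. by move=> e /=; rewrite psyt_boxK subrK. Qed.

Lemma shift_row (j : 'I_N) (c c' : int) : c < c' -> ent R (j, c) + x < ent R (j, c') + x.
Proof. by move=> h; rewrite ltrD2r ent_row. Qed.

Lemma shift_col (j j' : 'I_N) (c : int) : (j < j')%N -> ent R (j, c) + x < ent R (j', c) + x.
Proof. by move=> h; rewrite ltrD2r ent_col. Qed.

Lemma shift_period (j : 'I_N) (c : int) : ent R (j, c + k%:Z) + x = ent R (j, c) + x + n%:Z.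
Proof. by rewrite psyt_period addrAC. Qed.

Lemma shift_distinct (j j' : 'I_N) (c c' : int) : 1 <= c <= k%:Z -> 1 <= c' <= k%:Z ->
  (ent R (j, c) + x = ent R (j', c') + x %[mod n%:Z])%Z -> (j, c) = (j', c').
Proof.
move=> hc hc' /eqP h; apply: (psyt_distinct hc hc'); apply/eqP.
move: h; rewrite !eqz_mod_dvd => h.
have key : (n%:Z %| ent R (j, c) - ent R (j', c'))%Z; last exact: key.
have e : (ent R (j, c) + x) - (ent R (j', c') + x) = ent R (j, c) - ent R (j', c') by lia.
by rewrite -e; exact: h.
Qed.

Definition psyt_shift : psyt :=
  Psyt shift_entryK shift_boxK shift_row shift_col shift_period shift_distinct.

End ShiftTableau.

Lemma diag_shift R x e : dg (psyt_shift R x) e = dg R (e - x).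
Proof. by []. Qed.

Lemma col_shift R x e : col (psyt_shift R x) e = col R (e - x).
Proof. by []. Qed.

Definition diag_entry (R : psyt) (d : int) (j : 'I_N) : int := ent R (j, d + j.+1%:Z).

Lemma diag_entry_lt R d : {homo diag_entry R d : j j' / (j < j')%N >-> j < j'}.
Proof. by move=> j j' h; rewrite /diag_entry; apply: ent_lt; lia. Qed.

Lemma diag_entryP R d e : reflect (exists j, e = diag_entry R d j) (dg R e == d).
Proof.
apply: (iffP eqP) => [<-|[j ->]].
  exists (psyt_box R e).1; have := psyt_boxK R e; rewrite /diag_entry /dg.
  by case: psyt_box => j c <- /=; congr (ent R (_, _)); lia.
rewrite /diag_entry /dg psyt_entryK /=; lia.
Qed.

(** On a diagonal the entries increase from top to bottom, so the set that they
    form determines them.  With [s] the identity, the diagonals determine the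
    tableau; with [s] a reflection, this compares [R'] with the filling obtained
    from [R] by an exchange of entries. *)
Lemma entry_of_diag (R R' : psyt) (s : int -> int) : involutive s ->
  (forall e, dg R' e = dg R (s e)) ->
  (forall x y, x < y -> dg R x = dg R y -> s x < s y) ->
  forall b, ent R' b = s (ent R b).
Proof.
move=> sK dE sI [j c]; pose d := c - j.+1%:Z.
have dO R1 : {in enum 'I_N, forall j', dg R1 (diag_entry R1 d j') = d}.
  by move=> j' _; apply/eqP/diag_entryP; exists j'.
have srt (f : 'I_N -> int) : {homo f : j j' / (j < j')%N >-> j < j'} ->
    sorted <%R (map f (enum 'I_N)).
  move=> hf; apply: (homo_sorted (e := relpre val ltn)) => [x y|]; first exact: hf.
  by rewrite -sorted_map val_enum_ord iota_ltn_sorted.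
have : map (diag_entry R' d) (enum 'I_N) = map (s \o diag_entry R d) (enum 'I_N).
  apply: lt_sorted_eq.
  - exact/srt/diag_entry_lt.
  - apply: srt => x y h /=; apply: sI; first exact: diag_entry_lt.
    by rewrite !dO ?mem_enum.
  move=> x; apply/mapP/mapP => [[y _ ->]|[y _ ->]].
    have /eqP/diag_entryP[y' hy'] : dg R (s (diag_entry R' d y)) = d.
      by rewrite -dE dO ?mem_enum.
    by exists y'; rewrite ?mem_enum //= -hy' sK.
  have /eqP/diag_entryP[y' hy'] : dg R' (s (diag_entry R d y)) = d.
    by rewrite dE sK dO ?mem_enum.
  by exists y'; rewrite ?mem_enum.
move/eq_in_map/(_ j (mem_enum _ _)); rewrite /= /diag_entry.
by have -> : d + j.+1%:Z = c by rewrite /d; lia.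
Qed.

Lemma diag_inj (R R' : psyt) : dg R =1 dg R' -> R = R'.
Proof. by move=> h; apply: psyt_eq => b; rewrite -(@entry_of_diag R R' id). Qed.

Lemma entry_reduce (e : int) : exists (i : 'I_n) m, e = i.+1%:Z + m * n%:Z.
Proof.
have n0 : n%:Z != 0 by lia.
have h : (`|(e - 1) %% n%:Z|%Z < n)%N.
  by have := modz_ge0 (e - 1) n0; have := ltz_pmod (e - 1) (_ : 0 < n%:Z); lia.
exists (Ordinal h), ((e - 1) %/ n%:Z)%Z => /=.
by have := divz_eq (e - 1) n%:Z; have := modz_ge0 (e - 1) n0; lia.
Qed.

Lemma diag_inj_ord (R R' : psyt) :
  (forall i : 'I_n, dg R i.+1%:Z = dg R' i.+1%:Z) -> R = R'.
Proof.
move=> h; apply: diag_inj => e; have [i [m ->]] := entry_reduce e.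
by rewrite !diag_period h.
Qed.

Lemma swappable_sym R i : swappable R i -> swappable (psyt_swap i R) i.
Proof.
move=> sw; rewrite /swappable !diag_swap // zswap_l zswap_r //.
by rewrite distrC.
Qed.

Lemma psyt_swapK i R : psyt_swap i (psyt_swap i R) = R.
Proof.
case: (boolP (swappable R i)) => sw; last by rewrite !psyt_swap_id.
apply: diag_inj => e; rewrite diag_swap; last exact: swappable_sym.
by rewrite diag_swap // zswapK.
Qed.

(** A tableau [R'] with these diagonals would be [R] with [i] and [i + 1]
    exchanged.  But these are adjacent in [R], so the result is not standard. *)
Lemma not_swappable (R R' : psyt) i : ~~ swappable R i ->
  (forall e, dg R' e = dg R (zswap n i e)) -> False.
Proof.
move=> /negPn/eqP ns dE.
have eE : forall b, ent R' b = zswap n i (ent R b).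
  apply: entry_of_diag => //; first exact: zswapK.
  move=> x y xy dxy; apply: zswap_lt => // -[yx _].
  by have := diag_neq1 R x; rewrite dxy yx eqxx.
case E : (psyt_box R i) => [j c]; case E' : (psyt_box R (i + 1)) => [j' c'].
have he : ent R (j, c) = i by rewrite -E psyt_boxK.
have he' : ent R (j', c') = i + 1 by rewrite -E' psyt_boxK.
have fe : ent R' (j, c) = i + 1 by rewrite eE he zswap_l.
have fe' : ent R' (j', c') = i by rewrite eE he' zswap_r.
rewrite (psyt_diagE E) (psyt_diagE E') in ns.
case: (leqP j j') => jj; last first.
  have cc : c' <= c by lia.
  by have := ent_le R (ltnW jj) cc; lia.
case: (leP c c') => cc; first by have := ent_le R' jj cc; lia.
have jj' : j = j' by apply: val_inj => /=; lia.
by move: he'; rewrite -jj' => he'; have := ent_row R j cc; lia.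
Qed.

Lemma swappable_col R e : col R (e + 1) < col R e -> swappable R e.
Proof.
rewrite /swappable /col.
case E : (psyt_box R e) => [j c]; case E' : (psyt_box R (e + 1)) => [j' c'] /= cc.
have he : ent R (j, c) = e by rewrite -E psyt_boxK.
have he' : ent R (j', c') = e + 1 by rewrite -E' psyt_boxK.
rewrite (psyt_diagE E) (psyt_diagE E').
case: (leqP j' j) => jj; last by lia.
by have := ent_lt R jj cc; lia.
Qed.

(** These are the periodic extensions of the standard tableaux of shape [(k^N)]. *)
Definition fundamental (R : psyt) : Prop :=
  forall e, 1 <= e <= n%:Z -> 1 <= col R e <= k%:Z.

Definition positive (R : psyt) : Prop := forall e, 1 <= col R e -> 1 <= e.

Lemma positive_shift R : exists m : nat, positive (psyt_shift R m%:Z).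
Proof.
pose a := ent R (Ordinal N_pos, 1); exists `|a|%N.+1 => e; rewrite col_shift /col.
case E : (psyt_box R _) => [j c] /= c1.
have he : ent R (j, c) = e - (`|a|.+1)%N%:Z by rewrite -E psyt_boxK.
have := @ent_le R (Ordinal N_pos) j 1 c (leq0n _) c1; rewrite -/a; lia.
Qed.

(** An entry in [1, ..., n] and a column beyond [k] would come from a nonpositive
    entry in a positive column by the translation by [n]. *)
Lemma positive_fundamental R : positive R ->
  (forall e, 1 <= e <= n%:Z -> 1 <= col R e) -> fundamental R.
Proof.
move=> pR h e he; rewrite h //=; case: leP => // ck.
have := pR (e + -1 * n%:Z); rewrite col_period; lia.
Qed.

(** The number of steps by which the entries [1, ..., n] lie to the left of the
    column [k]: exchanges do not change it, and [depth_shift] decreases it. *)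
Definition height (c : int) : nat := if c <= k%:Z then `|k%:Z - c|%N else 0%N.

Definition depth (R : psyt) : nat := \sum_(e < n) height (col R e.+1%:Z).

Lemma depth_swap R (i : nat) : (0 < i < n)%N -> swappable R i%:Z ->
  depth (psyt_swap i%:Z R) = depth R.
Proof.
move=> hi sw; rewrite /depth -[RHS](sum_zswap n_ge2 (fun e => height (col R e)) hi).
by apply: eq_bigr => e _; rewrite col_swap.
Qed.

Lemma depth_shift R : col R 1 <= 0 -> (depth (psyt_shift R (-1)) < depth R)%N.
Proof.
move=> c1; pose F (e : nat) := height (col R e%:Z).
have e1 : depth R = (\sum_(e < n) F e.+1)%N by [].
have e2 : depth (psyt_shift R (-1)) = (\sum_(e < n) F e.+2)%N.
  apply: eq_bigr => e _; rewrite col_shift /F; congr (height (col R _)); lia.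
have eq : (\sum_(e < n) F e.+2 + F 1 = \sum_(e < n) F e.+1 + F n.+1)%N.
  have <- : (\sum_(e < n.+1) F e.+1 = \sum_(e < n) F e.+1 + F n.+1)%N.
    by rewrite big_ord_recr.
  by rewrite big_ord_recl addnC.
have hn : F n.+1 = height (col R 1 + k%:Z).
  by rewrite /F -[k%:Z]mul1r -col_period; congr (height (col R _)); lia.
have h1 : F 1%N = height (col R 1) by [].
have : (F n.+1 < F 1%N)%N.
  have kp := k_pos; rewrite hn h1 /height; case: ifP => ?; case: ifP => ?; lia.
rewrite e1 e2; move: (F 1%N) (F n.+1) eq; clear; lia.
Qed.

(** Raising all the entries makes the positive columns carry positive entries only.
    Then, as long as some entry of the window lies in a column [<= 0], it is moved
    down to [1] by exchanges, and lowering all the entries by [1] removes it from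
    the window.  At that moment [1] lies in a column [<= 0], hence on a negative
    diagonal; so the lowering move is only required when the diagonal of [1] is not
    [0], which is when the lowering operator does not vanish. *)
Lemma reach_fundamental (S : psyt -> Prop) :
  (forall R, S R -> S (psyt_shift R 1)) ->
  (forall R (i : nat), (0 < i < n)%N -> swappable R i%:Z -> S R -> S (psyt_swap i%:Z R)) ->
  (forall R, dg R 1 != 0 -> S R -> S (psyt_shift R (-1))) ->
  forall R, S R -> exists R', fundamental R' /\ S R'.
Proof.
move=> Sup Ssw Sdn R0 SR0; have [m pR] := positive_shift R0.
have {SR0} : S (psyt_shift R0 m%:Z).
  elim: m {pR} => [|m IH].
    by rewrite (_ : psyt_shift R0 0 = R0) //; apply: diag_inj => e; rewrite diag_shift subr0.
  rewrite (_ : psyt_shift R0 m.+1 = psyt_shift (psyt_shift R0 m%:Z) 1); first exact: Sup.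
  by apply: diag_inj => e; rewrite !diag_shift; congr (dg _ _); lia.
move: (psyt_shift _ _) pR => R; have [d] := ubnP (depth R).
elim: d R => // d IHd R; rewrite ltnS => dR pR SR.
case: (pselect (forall e, 1 <= e <= n%:Z -> 1 <= col R e)) => [h|].
  by exists R; split=> //; apply: positive_fundamental.
move=> /existsNP[e /not_implyP[he /negP ce]].
have {he} [i hi ei] : exists2 i : nat, (i < n)%N & e = i.+1%:Z by exists (`|e|.-1); lia.
move: ce; rewrite {e}ei; elim: i R dR pR SR hi => [|i IHi] R dR pR SR hi ce.
  have c1' : col R 1%:Z <= 0 by lia.
  have c1 : col R 1 <= 0 := c1'.
  apply: (IHd (psyt_shift R (-1))).
  - exact: leq_trans (depth_shift c1) dR.
  - move=> e; rewrite col_shift => ce'; have := pR _ ce'.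
    case: (eqVneq e 0) => [e0|]; last by lia.
    by move: ce'; rewrite e0 (_ : 0 - -1 = 1) // => ce'; have := le_trans ce' c1'.
  - apply: Sdn => //; move: c1; rewrite /col /dg; case: psyt_box => j c /=; lia.
case: (leP 1 (col R i.+1%:Z)) => c1; last first.
  by apply: (IHi R) => //; [exact: ltnW | lia].
have hi' : (0 < i.+1 < n)%N by lia.
have sw : swappable R i.+1%:Z.
  by apply: swappable_col; rewrite (_ : i.+1%:Z + 1 = i.+2%:Z); lia.
apply: (IHi (psyt_swap i.+1%:Z R)).
- by rewrite depth_swap.
- by move=> e; rewrite col_swap // => /pR; rewrite zswap_mono_gt0.
- exact: Ssw.
- exact: ltnW.
rewrite col_swap // zswap_l (_ : i.+1%:Z + 1 = i.+2%:Z); lia.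
Qed.

Section ExtendSyt.
Variable S : syt N k.
Local Notation rk := (residue k_pos).
Local Notation rn := (residue (ltnW n_ge2)).

Definition ext_entry (b : 'I_N * int) : int :=
  (syt_entry S (b.1, rk (b.2 - 1)))%:Z + ((b.2 - 1) %/ k%:Z)%Z * n%:Z + 1.

Definition ext_box (e : int) : 'I_N * int :=
  let b := syt_box S (rn (e - 1)) in (b.1, b.2%:Z + ((e - 1) %/ n%:Z)%Z * k%:Z + 1).

Lemma ext_entryK : cancel ext_entry ext_box.
Proof.
move=> [j c]; rewrite /ext_box /ext_entry /= addrK residueK (quotientK (ltnW n_ge2)) (syt_entryK S) /=.
by rewrite -(residue_eq k_pos) subrK.
Qed.

Lemma ext_boxK : cancel ext_box ext_entry.
Proof.
move=> e; rewrite /ext_box /ext_entry /= addrK residueK (quotientK k_pos) -surjective_pairing.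
by rewrite (syt_boxK S) -(residue_eq (ltnW n_ge2)) subrK.
Qed.

Lemma ext_row (j : 'I_N) (c c' : int) : c < c' -> ext_entry (j, c) < ext_entry (j, c').
Proof.
move=> cc; rewrite /ext_entry /=.
have e := residue_eq k_pos (c - 1); have e' := residue_eq k_pos (c' - 1).
set x := syt_entry S _; set x' := syt_entry S _.
have hx := ltn_ord x; have hx' := ltn_ord x'.
set a := ((c - 1) %/ _)%Z in e *; set a' := ((c' - 1) %/ _)%Z in e' *.
have hr := ltn_ord (rk (c - 1)); have hr' := ltn_ord (rk (c' - 1)).
case: (ltgtP a a') => aa.
- have : (a + 1) * n%:Z <= a' * n%:Z by rewrite ler_wpM2r //; lia.
  lia.
- have : (a' + 1) * k%:Z <= a * k%:Z by rewrite ler_wpM2r //; lia.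
  lia.
have : (x < x')%N by apply: syt_row; rewrite -aa in e'; lia.
by rewrite aa; lia.
Qed.

Lemma ext_col (j j' : 'I_N) (c : int) : (j < j')%N -> ext_entry (j, c) < ext_entry (j', c).
Proof. by move=> jj; rewrite /ext_entry /= !ltrD2r ltz_nat syt_col. Qed.

Lemma ext_period (j : 'I_N) (c : int) : ext_entry (j, c + k%:Z) = ext_entry (j, c) + n%:Z.
Proof.
rewrite /ext_entry /=.
have -> : c + k%:Z - 1 = (rk (c - 1))%:Z + (((c - 1) %/ k%:Z)%Z + 1) * k%:Z.
  by have := residue_eq k_pos (c - 1); lia.
by rewrite residueK (quotientK k_pos); lia.
Qed.

Lemma ext_small (j : 'I_N) (c : int) : 1 <= c <= k%:Z ->
  ext_entry (j, c) = (syt_entry S (j, rk (c - 1)))%:Z + 1 /\ c = (rk (c - 1))%:Z + 1.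
Proof.
move=> hc; have e := residue_eq k_pos (c - 1).
have z : ((c - 1) %/ k%:Z)%Z = 0 by rewrite divz_small //; lia.
by rewrite /ext_entry /= z in e *; split; lia.
Qed.

Lemma ext_distinct (j j' : 'I_N) (c c' : int) : 1 <= c <= k%:Z -> 1 <= c' <= k%:Z ->
  (ext_entry (j, c) = ext_entry (j', c') %[mod n%:Z])%Z -> (j, c) = (j', c').
Proof.
move=> /(ext_small j)[-> ec] /(ext_small j')[-> ec'] /eqP; rewrite eqz_mod_dvd.
set x := syt_entry S _; set x' := syt_entry S _ => h.
have hx := ltn_ord x; have hx' := ltn_ord x'.
have := dvd_small n_ge2 h.
have -> : x%:Z + 1 - (x'%:Z + 1) = x%:Z - x'%:Z by lia.
move=> h'; have xx : x = x' by apply: val_inj => /=; lia.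
have E := can_inj (syt_entryK S) xx.
have r1 : rk (c - 1) = rk (c' - 1) := congr1 snd E.
have j1 : j = j' := congr1 fst E.
by rewrite j1; congr (_, _); rewrite ec ec' r1.
Qed.

Definition psyt_of_syt : psyt :=
  Psyt ext_entryK ext_boxK ext_row ext_col ext_period ext_distinct.

Lemma box_of_syt (i : 'I_n) :
  psyt_box psyt_of_syt i.+1%:Z = ((syt_box S i).1, (syt_box S i).2%:Z + 1).
Proof.
rewrite /= /ext_box; have -> : i.+1%:Z - 1 = i%:Z + 0 * n%:Z by lia.
by rewrite residueK (quotientK (ltnW n_ge2)) mul0r addr0.
Qed.

Lemma diag_of_syt (i : 'I_n) : dg psyt_of_syt i.+1%:Z = syt_diag S i.
Proof. by rewrite /psyt_diag box_of_syt /syt_diag /=; lia. Qed.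

Lemma fundamental_of_syt : fundamental psyt_of_syt.
Proof.
move=> e he; have [i ->] : exists i : 'I_n, e = i.+1%:Z.
  have h : (`|e|.-1 < n)%N by lia.
  by exists (Ordinal h); rewrite /=; lia.
by rewrite /col box_of_syt /=; have := ltn_ord (syt_box S i).2; lia.
Qed.

End ExtendSyt.

Lemma syt_of_fundamental R : fundamental R -> exists S, R = psyt_of_syt S.
Proof.
move=> fR.
have colE (i : 'I_n) : (`|(psyt_box R i.+1%:Z).2|.-1 < k)%N.
  by have := fR i.+1%:Z; rewrite /col; have := ltn_ord i; lia.
have entE (b : 'I_N * 'I_k) : (`|ent R (b.1, b.2.+1%:Z)|.-1 < n)%N
    /\ ent R (b.1, b.2.+1%:Z) = (`|ent R (b.1, b.2.+1%:Z)|.-1).+1%:Z.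
  case: b => j m /=; set e := ent R _.
  have [i [a he]] := entry_reduce e.
  have := fR i.+1%:Z; rewrite /col.
  have := psyt_entryK R (j, m.+1%:Z); rewrite -/e he box_period => /= -[_ hm].
  have hi := ltn_ord i; have hm' := ltn_ord m => h.
  have {}h := h (_ : 1 <= i.+1%:Z <= n%:Z).
  have a0 : a = 0.
    have kp := k_pos; case: (ltgtP a 0) => // a0.
      have : a * k%:Z <= -1 * k%:Z by rewrite ler_wpM2r //; lia.
      lia.
    have : 1 * k%:Z <= a * k%:Z by rewrite ler_wpM2r //; lia.
    lia.
  by rewrite a0 mul0r addr0; split; lia.
pose en b : 'I_n := Ordinal (entE b).1.
pose bx (i : 'I_n) : 'I_N * 'I_k := ((psyt_box R i.+1%:Z).1, Ordinal (colE i)).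
have enE b : (en b).+1%:Z = ent R (b.1, b.2.+1%:Z) by rewrite [RHS](entE b).2.
have bxE i : (bx i).2.+1%:Z = (psyt_box R i.+1%:Z).2.
  by rewrite /=; have := fR i.+1%:Z; rewrite /col; have := ltn_ord i; lia.
have enK : cancel en bx.
  move=> [j m]; rewrite /bx; congr pair.
    by rewrite enE psyt_entryK.
  have e2 : (psyt_box R (en (j, m)).+1%:Z).2 = m.+1%:Z by rewrite enE psyt_entryK.
  by apply: val_inj; change (`|(psyt_box R (en (j, m)).+1%:Z).2|%N.-1 = m); rewrite e2.
have bxK : cancel bx en.
  move=> i; apply: val_inj; have := enE (bx i); rewrite bxE /bx /= -surjective_pairing.
  by rewrite psyt_boxK => -[].
have rw j (m m' : 'I_k) : (m < m')%N -> (en (j, m) < en (j, m'))%N.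
  move=> mm; have : (en (j, m)).+1%:Z < (en (j, m')).+1%:Z by rewrite !enE; apply: ent_row => /=; lia.
  by lia.
have cl (j j' : 'I_N) m : (j < j')%N -> (en (j, m) < en (j', m))%N.
  move=> mm; have : (en (j, m)).+1%:Z < (en (j', m)).+1%:Z by rewrite !enE; apply: ent_col.
  by lia.
exists (Syt enK bxK rw cl); apply: diag_inj_ord => i.
rewrite diag_of_syt /syt_diag /=.
by have := bxE i; rewrite /dg /=; lia.
Qed.

End Psyt.

(** * The seminormal coefficients *)

Section Coefficients.
Variables (K : fieldType) (t : K).
Hypotheses (t_neq0 : t != 0) (t_nroot : forall m : nat, (0 < m)%N -> t ^+ m != 1).

(** [alpha D] is the diagonal coefficient of [T_i] at a tableau in which the
    diagonals of [i] and [i + 1] differ by [D], and [beta D] the coefficient of the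
    exchanged tableau, which must vanish when the exchange is impossible. *)
Definition alpha (D : int) : K := (t - t^-1) / (1 - t ^ (- (2 * D))).
Definition beta (D : int) : K := if `|D| == 1 then 0 else t^-1 + alpha D.

Lemma exprz_neq1 (m : int) : m != 0 -> t ^ m != 1.
Proof.
case: m => m m0; first by apply: t_nroot; lia.
by change (t ^- m.+1 != 1); rewrite invr_eq1; apply: t_nroot.
Qed.

Lemma exprz_inj (a b : int) : t ^ a = t ^ b -> a = b.
Proof.
move=> e; apply/eqP; rewrite -subr_eq0; apply/negPn/negP => /exprz_neq1/negP; apply.
by rewrite expfzDr // e -expfzDr // subrr expr0z.
Qed.

Lemma den_neq0 (D : int) : D != 0 -> 1 - t ^ (- (2 * D)) != 0.
Proof. by move=> h; rewrite subr_eq0 eq_sym exprz_neq1 //; lia. Qed.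

Lemma alphaN D : D != 0 -> alpha D + alpha (- D) = t - t^-1.
Proof.
move=> D0; rewrite /alpha; have h1 := den_neq0 D0.
have h2 : 1 - t ^ (- (2 * - D)) != 0 by apply: den_neq0; lia.
have e : t ^ (- (2 * - D)) = (t ^ (- (2 * D)))^-1.
  by rewrite [RHS]invr_expz; congr (_ ^ _); lia.
rewrite e in h2 *; have u0 : t ^ (- (2 * D)) != 0 by rewrite expfz_neq0.
move: (t ^ _) u0 h1 h2 => u u0 h1 h2; rewrite -mulrDr -[RHS]mulr1; congr (_ * _).
have h3 : u - 1 != 0 by rewrite -opprB oppr_eq0.
have -> : 1 - u^-1 = (u - 1) / u by field.
by field; rewrite u0 h1 h3.
Qed.

Lemma alpha1 : alpha 1 = t.
Proof.
rewrite /alpha; have := @den_neq0 1 isT; rewrite -[- (2 * 1)]/(Negz 1) NegzE -exprz_inv.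
rewrite -[(t^-1) ^ 2]/(t^-1 ^+ 2) => h.
have -> : t - t^-1 = t * (1 - t^-1 ^+ 2) by field.
by rewrite mulfK.
Qed.

Lemma alphaN1 : alpha (-1) = - t^-1.
Proof. by have := @alphaN 1 isT; rewrite alpha1 => /(canRL (addKr _)) ->; ring. Qed.

(** Up to rescaling the basis, only this product of off-diagonal coefficients
    matters.  With [alphaN] it says that on a pair of exchanged tableaux [T_i] has
    trace [t - t^-1] and determinant [- 1], hence eigenvalues [t] and [- t^-1].  At
    [D = 1] and [D = - 1] both sides vanish. *)
Lemma betaM D : D != 0 ->
  beta D * beta (- D) = 1 + (t - t^-1) * alpha D - alpha D ^+ 2.
Proof.
move=> D0; rewrite /beta normrN; case: ifP => [D1|_].
  have : D = 1 \/ D = -1 by lia.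
  by rewrite mul0r; case=> ->; rewrite ?alpha1 ?alphaN1; field.
have -> : alpha (- D) = t - t^-1 - alpha D by rewrite -(alphaN D0); ring.
by field.
Qed.

(** [t^-1 + alpha D = 0] forces [t^(- 2 D) = t^2], that is [D = - 1]. *)
Lemma beta_neq0 D : D != 0 -> `|D| != 1 -> beta D != 0.
Proof.
move=> D0 D1; apply/negP => /eqP b0.
have D1' : (`|D| == 1) = false by apply: negbTE.
move: b0; rewrite /beta D1' => /eqP; rewrite addrC addr_eq0 /alpha => /eqP.
move=> e0; have e := divfK (den_neq0 D0) (t - t^-1); rewrite e0 in e.
have : t ^ (- (2 * D)) = t ^+ 2.
  have -> : t ^ (- (2 * D)) = 1 - (1 - t ^ (- (2 * D))) by ring.
  have -> : 1 - t ^ (- (2 * D)) = - (t * (t - t^-1)).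
    by rewrite -e mulrA mulrN mulfV // mulN1r opprK.
  by field.
by move/(@exprz_inj _ 2); lia.
Qed.

(** The diagonal part of the braid relation, for three entries with successive
    differences of diagonals [D] and [E]. *)
Lemma alpha3 D E : D != 0 -> E != 0 -> D + E != 0 ->
  alpha D * alpha E = alpha (D + E) * (alpha D + alpha E - (t - t^-1)).
Proof.
move=> D0 E0 F0; rewrite /alpha; have := den_neq0 D0; have := den_neq0 E0.
have := den_neq0 F0; have -> : - (2 * (D + E)) = - (2 * D) + - (2 * E) by ring.
rewrite expfzDr //; move: (t ^ _) (t ^ _) (t - t^-1) => u v x h1 h2 h3.
by field; rewrite h1 h2 h3.
Qed.

Lemma weight_neq1 D : D != 0 -> t ^ (2 * D) != 1.
Proof. by move=> D0; apply: exprz_neq1; lia. Qed.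

Lemma weight_inj a b : t ^ (2 * a) = t ^ (2 * b) -> a = b.
Proof. by move/exprz_inj; lia. Qed.

(** The relation that makes [T_i Y_i T_i = Y_{i+1}] hold on weight vectors. *)
Lemma alpha_weight a b : a != b ->
  alpha (b - a) * t ^ (2 * a) = (alpha (b - a) - (t - t^-1)) * t ^ (2 * b).
Proof.
move=> ab; have d0 : b - a != 0 by lia.
have h := den_neq0 d0.
have -> : t ^ (2 * a) = t ^ (2 * b) * t ^ (- (2 * (b - a))).
  by rewrite -expfzDr //; congr (_ ^ _); lia.
rewrite /alpha; move: (t ^ (- _)) (t ^ (2 * b)) (t - t^-1) h => u w x h.
by field.
Qed.

Lemma weightS (a : int) (m : nat) : t ^ (2 * (a + m%:Z)) = t ^ (2 * a) * t ^+ (2 * m).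
Proof. by rewrite mulrDr expfzDr // -[t ^+ _]/(t ^ (2 * m)%:Z) PoszM. Qed.

(** The braid relation at one tableau.  The [x]'s are the values of a function at
    the six tableaux obtained by permuting three consecutive entries; the
    hypotheses are the shapes of [alphaN], [alpha3] and [betaM]. *)
Lemma braid_scalar (x0 x1 x2 x12 x21 x121 aD aE aF aD' aE' p p' r r' f tau : K) :
  aD + aD' = tau -> aE + aE' = tau -> aD * aE = aF * (aD + aE - tau) ->
  p * p' = 1 + tau * aD - aD ^+ 2 -> r * r' = 1 + tau * aE - aE ^+ 2 ->
  aD * (aE * (aD * x0 + p * x1) + r * (aF * x2 + f * x12))
    + p * (aF * (aD' * x1 + p' * x0) + f * (aE * x21 + r * x121)) =
  aE * (aD * (aE * x0 + r * x2) + p * (aF * x1 + f * x21))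
    + r * (aF * (aE' * x2 + r' * x0) + f * (aD * x12 + p * x121)).
Proof.
move=> hD hE h3 hp hr.
have -> : aD' = tau - aD by rewrite -hD; ring.
have -> : aE' = tau - aE by rewrite -hE; ring.
apply/eqP; rewrite -subr_eq0; apply/eqP.
(* the difference of the two sides, in the ideal of the three relations *)
transitivity ((aD * aE - aF * (aD + aE - tau)) * (x0 * (aD - aE) + x1 * p - x2 * r)
  + aF * x0 * ((p * p' - (1 + tau * aD - aD ^+ 2))
              - (r * r' - (1 + tau * aE - aE ^+ 2)))); first by ring.
by rewrite h3 hp hr !subrr mul0r mulr0 addr0.
Qed.

End Coefficients.

(** * The module with a basis of periodic tableaux *)

Section SwapRelations.
Variable n : nat.
Hypothesis n_ge2 : (2 <= n)%N.

Lemma zswap_out i x (m : int) : ~~ (n%:Z %| x)%Z -> ~~ (n%:Z %| x - 1)%Z ->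
  zswap n i (i + x + m * n%:Z) = i + x + m * n%:Z.
Proof.
move=> h h'; rewrite zswap_period //; congr (_ + _).
by apply: zswap_id; [rewrite (_ : i + x - i = x) | rewrite (_ : i + x - i - 1 = x - 1)] => //; lia.
Qed.

Lemma not_dvd_small x : x != 0 -> - n%:Z < x -> x < n%:Z -> ~~ (n%:Z %| x)%Z.
Proof. by move=> x0 h1 h2; apply/negP => /dvd_small h; have := h n_ge2 h1 h2; lia. Qed.

(** The braid and commutation relations of the affine symmetric group. *)
Lemma zswap_braid i e : (3 <= n)%N ->
  zswap n i (zswap n (i + 1) (zswap n i e)) =
  zswap n (i + 1) (zswap n i (zswap n (i + 1) e)).
Proof.
move=> n3.
have l j (m : int) : zswap n j (j + m * n%:Z) = j + 1 + m * n%:Z.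
  by rewrite zswap_period // zswap_l.
have r j (m : int) : zswap n j (j + 1 + m * n%:Z) = j + m * n%:Z.
  by rewrite zswap_period // zswap_r.
have o2 (m : int) : zswap n i (i + 1 + 1 + m * n%:Z) = i + 1 + 1 + m * n%:Z.
  by rewrite -(addrA i) zswap_out //; apply: not_dvd_small; lia.
have o0 (m : int) : zswap n (i + 1) (i + m * n%:Z) = i + m * n%:Z.
  have := @zswap_out (i + 1) (-1) m; rewrite addrK; apply; apply: not_dvd_small; lia.
have ex x : (n%:Z %| e - x)%Z -> exists m : int, e = x + m * n%:Z.
  by move=> /dvdzP[m h]; exists m; lia.
case: (boolP (n%:Z %| e - i)%Z) => [/ex[m ->]|h0].
  by rewrite l l o2 o0 l l.
case: (boolP (n%:Z %| e - (i + 1))%Z) => [/ex[m ->]|h1].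
  by rewrite r o0 l l o2 r.
case: (boolP (n%:Z %| e - (i + 1 + 1))%Z) => [/ex[m ->]|h2].
  by rewrite o2 !r o0.
have s0 : zswap n i e = e by apply: zswap_id => //; rewrite -addrA -opprD.
have s1 : zswap n (i + 1) e = e.
  by apply: zswap_id => //; rewrite (_ : e - (i + 1) - 1 = e - (i + 1 + 1)) //; lia.
by rewrite !(s0, s1).
Qed.

Lemma zswap_comm i j e : ~~ (n%:Z %| i - j)%Z -> ~~ (n%:Z %| i - j - 1)%Z ->
  ~~ (n%:Z %| i - j + 1)%Z -> zswap n i (zswap n j e) = zswap n j (zswap n i e).
Proof.
move=> h0 h1 h2.
have l j' (m : int) : zswap n j' (j' + m * n%:Z) = j' + 1 + m * n%:Z.
  by rewrite zswap_period // zswap_l.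
have r j' (m : int) : zswap n j' (j' + 1 + m * n%:Z) = j' + m * n%:Z.
  by rewrite zswap_period // zswap_r.
have fj0 (m : int) : zswap n j (i + m * n%:Z) = i + m * n%:Z.
  by rewrite zswap_period // zswap_id.
have fj1 (m : int) : zswap n j (i + 1 + m * n%:Z) = i + 1 + m * n%:Z.
  rewrite zswap_period // zswap_id //; first by rewrite addrAC.
  by rewrite (_ : i + 1 - j - 1 = i - j) //; lia.
have dN x : (n%:Z %| - x)%Z = (n%:Z %| x)%Z by rewrite rpredN.
have fi0 (m : int) : zswap n i (j + m * n%:Z) = j + m * n%:Z.
  rewrite zswap_period // zswap_id // -dN; first by rewrite opprB.
  by rewrite (_ : - (j - i - 1) = i - j + 1) //; lia.
have fi1 (m : int) : zswap n i (j + 1 + m * n%:Z) = j + 1 + m * n%:Z.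
  rewrite zswap_period // zswap_id // -dN.
    by rewrite (_ : - (j + 1 - i) = i - j - 1) //; lia.
  by rewrite (_ : - (j + 1 - i - 1) = i - j) //; lia.
have ex x : (n%:Z %| e - x)%Z -> exists m : int, e = x + m * n%:Z.
  by move=> /dvdzP[m h]; exists m; lia.
case: (boolP (n%:Z %| e - i)%Z) => [/ex[m ->]|a0]; first by rewrite fj0 l fj1.
case: (boolP (n%:Z %| e - (i + 1))%Z) => [/ex[m ->]|a1]; first by rewrite fj1 r fj0.
case: (boolP (n%:Z %| e - j)%Z) => [/ex[m ->]|b0]; first by rewrite fi0 l fi1.
case: (boolP (n%:Z %| e - (j + 1))%Z) => [/ex[m ->]|b1]; first by rewrite fi1 r fi0.
have si : zswap n i e = e by apply: zswap_id => //; rewrite -addrA -opprD.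
have sj : zswap n j e = e by apply: zswap_id => //; rewrite -addrA -opprD.
by rewrite !(si, sj).
Qed.

End SwapRelations.

Section FunctionSpace.
Variables (I : Type) (K : fieldType).
Local Notation E := (I -> K^o).

Lemma funDE (f g : E) x : (f + g) x = f x + g x. Proof. by []. Qed.
Lemma funNE (f : E) x : (- f) x = - f x. Proof. by []. Qed.
Lemma fun0E x : (0 : E) x = 0. Proof. by []. Qed.
Lemma funZE c (f : E) x : (c *: f) x = c * f x. Proof. by []. Qed.

End FunctionSpace.

Section Gaps.
Variables N k : nat.
Hypothesis n_ge2 : (2 <= k * N)%N.

Local Notation n := (k * N)%N.
Local Notation psyt := (psyt N k).
Local Notation dg := psyt_diag.
Local Notation sw := (psyt_swap n_ge2).

Definition gap (i : int) (R : psyt) : int := dg R (i + 1) - dg R i.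

Lemma gap_neq0 i R : gap i R != 0.
Proof. by rewrite /gap subr_eq0 eq_sym diag_neq1. Qed.

Lemma gap_neq2 i R : gap i R + gap (i + 1) R != 0.
Proof.
by have := diag_neq2 n_ge2 R i; rewrite /gap (_ : i + 1 + 1 = i + 2); lia.
Qed.

Lemma gap_mod (i j : int) R : (n%:Z %| i - j)%Z -> gap i R = gap j R.
Proof.
move=> /dvdzP[m h]; have -> : i = j + m * n%:Z by lia.
by rewrite /gap (addrAC j) !diag_period // opprD addrACA subrr addr0.
Qed.

Lemma swap_mod (i j : int) R : (n%:Z %| i - j)%Z -> sw i R = sw j R.
Proof.
move=> h; have e : swappable R i = swappable R j.
  by rewrite /swappable -!/(gap _ _) (gap_mod _ h).
case: (boolP (swappable R i)) => s; last first.
  by rewrite !psyt_swap_id // -e.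
apply: diag_inj => // x; rewrite !diag_swap //; last by rewrite -e.
by rewrite (zswap_mod n_ge2 x h).
Qed.

Lemma gap_swap i R : swappable R i -> gap i (sw i R) = - gap i R.
Proof.
by move=> s; rewrite /gap !diag_swap // zswap_l zswap_r // [RHS]opprB.
Qed.

Lemma gap_swap_next i R : (3 <= n)%N -> swappable R i ->
  gap (i + 1) (sw i R) = gap i R + gap (i + 1) R.
Proof.
move=> n3 s; rewrite /gap !diag_swap // zswap_r //.
have -> : zswap n i (i + 1 + 1) = i + 1 + 1; last by lia.
rewrite (_ : i + 1 + 1 = i + 2); last by lia.
by have := @zswap_out n n_ge2 i 2 0; rewrite mul0r !addr0; apply; apply: not_dvd_small; lia.
Qed.

Lemma gap_swap_prev i R : (3 <= n)%N -> swappable R (i + 1) ->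
  gap i (sw (i + 1) R) = gap i R + gap (i + 1) R.
Proof.
move=> n3 s; rewrite /gap !diag_swap // zswap_l.
have -> : zswap n (i + 1) i = i; last first.
  by move: (dg R _) (dg R _) (dg R _) => x y z; ring.
have := @zswap_out n n_ge2 (i + 1) (-1) 0; rewrite mul0r !addr0 addrK.
by apply; apply: not_dvd_small; lia.
Qed.

Lemma psyt_swap_braid i R : (3 <= n)%N ->
  swappable R i -> swappable R (i + 1) -> `|gap i R + gap (i + 1) R| != 1 ->
  [/\ swappable (sw i R) (i + 1), swappable (sw (i + 1) R) i,
      swappable (sw (i + 1) (sw i R)) i, swappable (sw i (sw (i + 1) R)) (i + 1)
    & sw i (sw (i + 1) (sw i R)) = sw (i + 1) (sw i (sw (i + 1) R))].
Proof.
move=> n3 sI sJ nF.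
have sJI : swappable (sw i R) (i + 1) by rewrite /swappable -/(gap _ _) gap_swap_next.
have sIJ : swappable (sw (i + 1) R) i by rewrite /swappable -/(gap _ _) gap_swap_prev.
have sIJI : swappable (sw (i + 1) (sw i R)) i.
  by rewrite /swappable -/(gap _ _) gap_swap_prev // gap_swap_next // gap_swap // addKr.
have sJIJ : swappable (sw i (sw (i + 1) R)) (i + 1).
  by rewrite /swappable -/(gap _ _) gap_swap_next // gap_swap_prev // gap_swap // addrK.
by split=> //; apply: diag_inj => // e; rewrite !diag_swap // zswap_braid.
Qed.

(** Nodes that are distinct and not adjacent in the cyclic Dynkin diagram. *)
Definition far (i j : int) : bool :=
  [&& ~~ (n%:Z %| i - j)%Z, ~~ (n%:Z %| i - j - 1)%Z & ~~ (n%:Z %| i - j + 1)%Z].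

Lemma far_sym i j : far i j -> far j i.
Proof.
have dN x : (n%:Z %| - x)%Z = (n%:Z %| x)%Z by rewrite rpredN.
case/and3P=> h0 h1 h2; rewrite /far -dN opprB h0 /= -dN.
rewrite (_ : - (j - i - 1) = i - j + 1); last by lia.
by rewrite h2 -dN (_ : - (j - i + 1) = i - j - 1) //; lia.
Qed.

Lemma gap_swap_far i j R : far i j -> swappable R j -> gap i (sw j R) = gap i R.
Proof.
case/and3P=> h0 h1 h2 s; rewrite /gap !diag_swap // [zswap n j i]zswap_id // zswap_id //.
  by rewrite (_ : i + 1 - j = i - j + 1) //; lia.
by rewrite (_ : i + 1 - j - 1 = i - j) //; lia.
Qed.

Lemma psyt_swap_comm i j R : far i j -> swappable R i -> swappable R j ->
  [/\ swappable (sw i R) j, swappable (sw j R) i & sw j (sw i R) = sw i (sw j R)].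
Proof.
move=> ij sI sJ.
have s1 : swappable (sw i R) j by rewrite /swappable -/(gap _ _) gap_swap_far //; exact: far_sym.
have s2 : swappable (sw j R) i by rewrite /swappable -/(gap _ _) gap_swap_far.
split=> //; apply: diag_inj => // e; rewrite !diag_swap //.
by case/and3P: ij => *; rewrite zswap_comm.
Qed.

Lemma shiftK x R : psyt_shift n_ge2 (psyt_shift n_ge2 R x) (- x) = R.
Proof. by apply: diag_inj => // e; rewrite !diag_shift opprK addrK. Qed.

Lemma gap_shift i R x : gap i (psyt_shift n_ge2 R x) = gap (i - x) R.
Proof. by rewrite /gap !diag_shift (addrAC i 1). Qed.

Lemma zswap_shift (i e x : int) : zswap n (i - x) (e - x) = zswap n i e - x.
Proof.
rewrite /zswap (_ : e - x - (i - x) = e - i); last by lia.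
by case: ifP => _; [lia | case: ifP => _; lia].
Qed.

Lemma swap_shift i R x :
  psyt_shift n_ge2 (sw (i - x) R) x = sw i (psyt_shift n_ge2 R x).
Proof.
have e : swappable (psyt_shift n_ge2 R x) i = swappable R (i - x).
  by rewrite /swappable -!/(gap _ _) gap_shift.
case: (boolP (swappable R (i - x))) => s; last by rewrite !psyt_swap_id // e.
apply: diag_inj => // y; rewrite diag_shift !diag_swap ?e //.
by rewrite diag_shift zswap_shift.
Qed.

Lemma mod_dvdz (a b : nat) : (a == b %[mod n])%N = (n%:Z %| a%:Z - b%:Z)%Z.
Proof. by rewrite -eqz_mod_dvd !modz_nat eqz_nat. Qed.

End Gaps.

Section TableauModule.
Variables (K : fieldType) (N k : nat) (q t : K).
Hypotheses (n_ge2 : (2 <= k * N)%N) (t_neq0 : t != 0).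
Hypothesis t_nroot : forall m : nat, (0 < m)%N -> t ^+ m != 1.
Hypothesis qE : q = t ^- (2 * k).

Local Notation n := (k * N)%N.
Local Notation psyt := (psyt N k).
Local Notation dg := psyt_diag.
Local Notation E := (psyt -> K^o).
Local Notation sw := (psyt_swap n_ge2).
Local Notation al := (alpha t).
Local Notation be := (beta t).

(** All the coefficients of exchanges that do not exist are zero, so formulas below
    may be written as if every exchange existed. *)
Lemma beta_unswappable i (R : psyt) : ~~ swappable R i -> be (- gap i R) = 0.
Proof. by rewrite /swappable -/(gap i R) negbK /beta normrN => ->. Qed.

(** The operators on functions of the tableau; on the functions concentrated at one
    tableau they are the seminormal formulas.  Working with functions avoids
    formal linear combinations. *)
Definition opT_fun (i : int) (g : E) : E :=
  fun R => al (gap i R) * g R + be (- gap i R) * g (sw i R).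
Definition opPi_fun (x : int) (g : E) : E := fun R => g (psyt_shift n_ge2 R x).
Definition opY_fun (c : psyt -> K) (g : E) : E := fun R => c R * g R.

Fact opT_linear i : linear (opT_fun i).
Proof.
by move=> c f g; apply: funext => R; rewrite funDE funZE /opT_fun !funDE !funZE; ring.
Qed.
Fact opPi_linear x : linear (opPi_fun x).
Proof. by []. Qed.
Fact opY_linear c : linear (opY_fun c).
Proof.
by move=> a f g; apply: funext => R; rewrite funDE funZE /opY_fun funDE funZE; ring.
Qed.

HB.instance Definition _ i := GRing.isLinear.Build K E E *:%R (opT_fun i) (opT_linear i).
HB.instance Definition _ i := GRing.isLinear.Build K E E *:%R (opPi_fun i) (opPi_linear i).
HB.instance Definition _ i := GRing.isLinear.Build K E E *:%R (opY_fun i) (opY_linear i).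

(** The generator of residue [0] is [Y_n], not [Y_0]. *)
Definition Y_index (i : nat) : int := if i == 0%N then n%:Z else i%:Z.
Definition Y_weight (i : nat) (R : psyt) : K := t ^ (2 * dg R (Y_index i)).

Definition tableau_op (x : daha_gen n) : {linear E -> E} :=
  match x with
  | GenT i => opT_fun (val i)%:Z
  | GenPi => opPi_fun (-1)
  | GenPiV => opPi_fun 1
  | GenY i => opY_fun (Y_weight (val i))
  | GenYV i => opY_fun (fun R => (Y_weight (val i) R)^-1)
  end.

Local Notation act := (free_act tableau_op).

Lemma opT_mod (i j : int) g : (n%:Z %| i - j)%Z -> opT_fun i g = opT_fun j g.
Proof.
by move=> h; apply: funext => R; rewrite /opT_fun (gap_mod n_ge2 _ h) (swap_mod _ _ h).
Qed.

Lemma act_T (i : nat) g : act (free_T K n i) g = opT_fun i%:Z g.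
Proof.
rewrite free_act_gen /=; apply: opT_mod.
by rewrite prednK ?(ltnW n_ge2) // {2}(divn_eq i n) PoszD opprD addrA PoszM
  addrAC subrr add0r rpredN dvdz_mull.
Qed.

Lemma act_Pi g : act (free_Pi K n) g = opPi_fun (-1) g.
Proof. exact: free_act_gen. Qed.

Lemma act_PiV g : act (free_PiV K n) g = opPi_fun 1 g.
Proof. exact: free_act_gen. Qed.

Lemma act_Y (i : nat) g : act (free_Y K n i) g = opY_fun (Y_weight (i %% n)) g.
Proof. by rewrite free_act_gen /= prednK ?(ltnW n_ge2). Qed.

Lemma act_YV (i : nat) g :
  act (free_YV K n i) g = opY_fun (fun R => (Y_weight (i %% n) R)^-1) g.
Proof. by rewrite free_act_gen /= prednK ?(ltnW n_ge2). Qed.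

Lemma Y_weight_neq0 i R : Y_weight i R != 0.
Proof. exact: expfz_neq0. Qed.

Lemma Y_weightE (i : nat) R : (0 < i <= n)%N -> Y_weight (i %% n) R = t ^ (2 * dg R i%:Z).
Proof.
rewrite /Y_weight /Y_index => hi; case: (eqVneq i n) => [->|ne]; first by rewrite modnn.
rewrite modn_small; last by lia.
by case: eqP => // i0; lia.
Qed.

Lemma op_quad i g : opT_fun i (opT_fun i g) = g + (t - t^-1) *: opT_fun i g.
Proof.
apply: funext => R; rewrite funDE funZE /opT_fun.
have a := alphaN t_neq0 t_nroot (gap_neq0 n_ge2 i R).
have b := betaM t_neq0 t_nroot (gap_neq0 n_ge2 i R).
case: (boolP (swappable R i)) => s.
  rewrite gap_swap // psyt_swapK // opprK.
  apply/eqP; rewrite -subr_eq0; apply/eqP.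
  (* the difference of the two sides, as a combination of [a] and [b] *)
  transitivity ((al (gap i R) + al (- gap i R) - (t - t^-1)) * be (- gap i R) * g (sw i R)
    + (be (gap i R) * be (- gap i R)
       - (1 + (t - t^-1) * al (gap i R) - al (gap i R) ^+ 2)) * g R); first by ring.
  by rewrite a b !subrr !mul0r addr0.
have b0 := beta_unswappable s.
rewrite b0 mulr0 in b; rewrite b0 !mul0r !addr0 mulrA.
have -> : al (gap i R) * al (gap i R) = 1 + (t - t^-1) * al (gap i R).
  by apply/eqP; rewrite -subr_eq0 -oppr_eq0 opprB b; apply/eqP; ring.
by ring.
Qed.

(** For neighbours [i] and [j] the six coefficients on either side of the braid
    relation only depend on two differences of diagonals [D] and [F]; exchanges
    that do not exist are absorbed by the zeros of [beta]. *)
Lemma op_word i j R g : (forall R, swappable R i -> gap j (sw i R) = gap i R + gap j R) ->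
  (forall R, swappable R j -> gap i (sw j R) = gap i R + gap j R) ->
  let D := gap i R in let F := gap j R in
  opT_fun i (opT_fun j (opT_fun i g)) R =
  al D * (al F * (al D * g R + be (- D) * g (sw i R))
          + be (- F) * (al (D + F) * g (sw j R) + be (- (D + F)) * g (sw i (sw j R))))
  + be (- D) * (al (D + F) * (al (- D) * g (sw i R) + be D * g R)
          + be (- (D + F)) * (al F * g (sw j (sw i R)) + be (- F) * g (sw i (sw j (sw i R))))).
Proof.
move=> hj hi D F; rewrite {1}/opT_fun -/D; congr (_ + _).
  congr (_ * _); rewrite {1}/opT_fun -/F; congr (_ + _).
  case: (boolP (swappable R j)) => s; last by rewrite (beta_unswappable s) !mul0r.
  by rewrite /opT_fun hi.
case: (boolP (swappable R i)) => s; last by rewrite (beta_unswappable s) !mul0r.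
congr (_ * _); rewrite {1}/opT_fun hj // -/D -/F; congr (_ + _).
  by rewrite /opT_fun gap_swap // opprK psyt_swapK.
case: (boolP (swappable (sw i R) j)) => s'; last first.
  by have := beta_unswappable s'; rewrite hj // -/D -/F => ->; rewrite !mul0r.
congr (_ * _); rewrite /opT_fun hi // gap_swap // hj //.
by rewrite (_ : - gap i R + (gap i R + gap j R) = F) // addKr.
Qed.

(** By [op_word] this is the scalar identity [braid_scalar], once the two longest
    words lead to the same tableau; when one of the exchanges involved does not
    exist, the coefficient of this term is zero. *)
Lemma op_braid i g : (3 <= n)%N ->
  opT_fun i (opT_fun (i + 1) (opT_fun i g)) =
  opT_fun (i + 1) (opT_fun i (opT_fun (i + 1) g)).
Proof.
move=> n3; apply: funext => R.
have h1 R' : swappable R' i -> gap (i + 1) (sw i R') = gap i R' + gap (i + 1) R'.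
  exact: gap_swap_next.
have h2 R' : swappable R' (i + 1) -> gap i (sw (i + 1) R') = gap i R' + gap (i + 1) R'.
  exact: gap_swap_prev.
have h1' R' : swappable R' i -> gap (i + 1) (sw i R') = gap (i + 1) R' + gap i R'.
  by move=> s; rewrite h1 // addrC.
have h2' R' : swappable R' (i + 1) -> gap i (sw (i + 1) R') = gap (i + 1) R' + gap i R'.
  by move=> s; rewrite h2 // addrC.
rewrite (op_word _ _ h1 h2) (op_word _ _ h2' h1').
have D0 := gap_neq0 n_ge2 i R; have F0 := gap_neq0 n_ge2 (i + 1) R; have S0 := gap_neq2 n_ge2 i R.
rewrite (addrC (gap (i + 1) R)).
set D := gap i R in D0 S0 *; set F := gap (i + 1) R in F0 S0 *.
have last : be (- D) * be (- (D + F)) * be (- F) * g (sw i (sw (i + 1) (sw i R)))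
    = be (- D) * be (- (D + F)) * be (- F) * g (sw (i + 1) (sw i (sw (i + 1) R))).
  case: (eqVneq (be (- D) * be (- (D + F)) * be (- F)) 0) => [->|nz]; first by rewrite !mul0r.
  congr (_ * g _).
  have sI : swappable R i.
    by apply: contraT => /beta_unswappable e; case/negP: nz; rewrite -/D in e; rewrite e !mul0r.
  have sJ : swappable R (i + 1).
    by apply: contraT => /beta_unswappable e; case/negP: nz; rewrite -/F in e; rewrite e mulr0.
  have nF : `|D + F| != 1.
    apply/negP => h; case/negP: nz; rewrite (_ : be (- (D + F)) = 0) ?mulr0 ?mul0r //.
    by rewrite /beta normrN h.
  by have [] := psyt_swap_braid n_ge2 n3 sI sJ nF.
transitivity (al D * (al F * (al D * g R + be (- D) * g (sw i R)) +
    be (- F) * (al (D + F) * g (sw (i + 1) R) + be (- (D + F)) * g (sw i (sw (i + 1) R)))) +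
  be (- D) * (al (D + F) * (al (- D) * g (sw i R) + be D * g R) +
    be (- (D + F)) * (al F * g (sw (i + 1) (sw i R))
        + be (- F) * g (sw (i + 1) (sw i (sw (i + 1) R)))))).
  congr (_ + _); rewrite !mulrDr; congr (_ + (_ + _)).
  by rewrite !mulrA last.
apply: (@braid_scalar K _ _ _ _ _ _ _ _ _ _ _ _ _ _ _ _ (t - t^-1)).
- exact: alphaN.
- exact: alphaN.
- exact: alpha3.
- by rewrite mulrC betaM.
- by rewrite mulrC betaM.
Qed.

Lemma op_comm (i j : int) g : far N k i j -> opT_fun i (opT_fun j g) = opT_fun j (opT_fun i g).
Proof.
move=> ij; apply: funext => R.
have hj R' : swappable R' i -> gap j (sw i R') = gap j R'.
  by apply: gap_swap_far; apply: far_sym.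
have hi R' : swappable R' j -> gap i (sw j R') = gap i R' by apply: gap_swap_far.
have e : be (- gap i R) * be (- gap j R) * g (sw j (sw i R)) =
         be (- gap i R) * be (- gap j R) * g (sw i (sw j R)).
  case: (boolP (swappable R i)) => [s|/beta_unswappable ->]; last by rewrite !mul0r.
  case: (boolP (swappable R j)) => [s'|/beta_unswappable ->]; last by rewrite mulr0 !mul0r.
  by have [_ _ ->] := psyt_swap_comm n_ge2 ij s s'.
have eL (i' j' : int) : (forall R', swappable R' i' -> gap j' (sw i' R') = gap j' R') ->
    opT_fun i' (opT_fun j' g) R =
    al (gap i' R) * (al (gap j' R) * g R + be (- gap j' R) * g (sw j' R)) +
    be (- gap i' R) * (al (gap j' R) * g (sw i' R) + be (- gap j' R) * g (sw j' (sw i' R))).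
  move=> h; rewrite {1}/opT_fun; congr (_ + _).
  case: (boolP (swappable R i')) => [s|/beta_unswappable ->]; last by rewrite !mul0r.
  by rewrite /opT_fun h.
rewrite (eL _ _ hj) (eL _ _ hi).
rewrite !mulrDr; move: e.
rewrite -mulrA => ->; ring.
Qed.


(** On a pair of exchanged tableaux this is [alpha_weight] on the diagonal, and
    [alphaN] and [betaM] for the remaining terms. *)
Lemma op_TY i g :
  opT_fun i (opY_fun (fun R => t ^ (2 * dg R i)) (opT_fun i g)) =
  opY_fun (fun R => t ^ (2 * dg R (i + 1))) g.
Proof.
apply: funext => R; rewrite /opT_fun /opY_fun.
have a := alphaN t_neq0 t_nroot (gap_neq0 n_ge2 i R).
have b := betaM t_neq0 t_nroot (gap_neq0 n_ge2 i R).
have c := alpha_weight t_neq0 t_nroot (diag_neq1 n_ge2 R i).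
rewrite -/(gap i R) in c.
set z := t ^ (2 * dg R i) in c *; set z' := t ^ (2 * dg R (i + 1)) in c *.
have -> : be (- gap i R) * (t ^ (2 * dg (sw i R) i) *
     (al (gap i (sw i R)) * g (sw i R) + be (- gap i (sw i R)) * g (sw i (sw i R)))) =
  be (- gap i R) * (z' * (al (- gap i R) * g (sw i R) + be (gap i R) * g R)).
  case: (boolP (swappable R i)) => s; last by rewrite (beta_unswappable s) !mul0r.
  by rewrite gap_swap // opprK psyt_swapK diag_swap // zswap_l.
apply/eqP; rewrite -subr_eq0; apply/eqP.
(* the difference of the two sides, as a combination of [a], [b] and [c] *)
transitivity ((al (gap i R) * z - (al (gap i R) - (t - t^-1)) * z')
     * (al (gap i R) * g R + be (- gap i R) * g (sw i R))
  + be (- gap i R) * z' * g (sw i R) * (al (gap i R) + al (- gap i R) - (t - t^-1))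
  + z' * g R * (be (gap i R) * be (- gap i R)
       - (1 + (t - t^-1) * al (gap i R) - al (gap i R) ^+ 2))); first by ring.
by rewrite a b c !subrr !mulr0 mul0r !addr0.
Qed.

Lemma op_PiT i g : opPi_fun (-1) (opT_fun i (opPi_fun 1 g)) = opT_fun (i + 1) g.
Proof.
apply: funext => R; rewrite /opPi_fun /opT_fun gap_shift opprK.
have -> : psyt_shift n_ge2 (psyt_shift n_ge2 R (-1)) 1 = R by exact: (shiftK n_ge2 (-1)).
have := swap_shift n_ge2 i R (-1); rewrite opprK => <-.
by congr (_ + _ * g _); exact: (shiftK n_ge2 (-1)).
Qed.

(** The only place where [q = t^(- 2 k)] enters: adding [n] to an entry moves it by
    [k] columns. *)
Lemma weight_shift (R : psyt) : t ^ (2 * dg R (n%:Z + 1)) = q^-1 * t ^ (2 * dg R 1).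
Proof.
have -> : n%:Z + 1 = 1 + 1 * n%:Z by lia.
by rewrite diag_period // mul1r weightS // qE invrK mulrC.
Qed.

(** The lemmas about [acts_as] translate a word in the generators into a composite
    of operators by unification, so that each relation becomes an identity between
    functions. *)
Definition acts_as (a : free_alg K (daha_gen n)) (f : E -> E) := forall w, act a w = f w.

Lemma acts2 a b f g : acts_as a f -> acts_as b g -> acts_as (a * b) (f \o g).
Proof. by move=> ha hb w; rewrite free_actM ha hb. Qed.

Lemma acts3 a b c f g h : acts_as a f -> acts_as b g -> acts_as c h ->
  acts_as (a * b * c) (f \o (g \o h)).
Proof. by move=> ha hb hc w; rewrite !free_actM ha hb hc. Qed.

Lemma actsB a b f g : acts_as a f -> acts_as b g -> acts_as (a - b) (fun w => f w - g w).
Proof. by move=> ha hb w; rewrite free_actB ha hb. Qed.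

Lemma actsD a b f g : acts_as a f -> acts_as b g -> acts_as (a + b) (fun w => f w + g w).
Proof. by move=> ha hb w; rewrite free_actD ha hb. Qed.

Lemma actsC c : acts_as c%:A (fun w => c *: w).
Proof. by move=> w; rewrite free_actZ. Qed.

Lemma actsZ c a f : acts_as a f -> acts_as (c *: a) (fun w => c *: f w).
Proof.
move=> ha w; have -> : c *: a = c%:A * a by rewrite -scalerAl mul1r.
by rewrite free_actM free_actZ ha.
Qed.

Lemma acts1 : acts_as 1 id.
Proof. by move=> w; rewrite free_act1. Qed.

Lemma acts0 : acts_as 0 (fun _ => 0).
Proof. by move=> w; rewrite free_act0. Qed.

Lemma acts_eq a b f g : acts_as a f -> acts_as b g -> f =1 g ->
  forall w, act a w = act b w.
Proof. by move=> ha hb fg w; rewrite ha hb fg. Qed.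

Lemma tableau_rel a b : @daha_rel K n q t a b -> forall w, act a w = act b w.
Proof.
case=> {a b} [||i|i|i j|i|i j n2 ij|i j n2 ij|i|i hi||i j ij|i hi|].
- apply: (acts_eq (acts2 act_Pi act_PiV) acts1) => g; apply: funext => R.
  by rewrite /= /opPi_fun (shiftK n_ge2 (-1)).
- apply: (acts_eq (acts2 act_PiV act_Pi) acts1) => g; apply: funext => R.
  by rewrite /= /opPi_fun (shiftK n_ge2 1).
- apply: (acts_eq (acts2 (act_Y i) (act_YV i)) acts1) => g; apply: funext => R.
  by rewrite /= /opY_fun mulrA mulfV ?mul1r ?Y_weight_neq0.
- apply: (acts_eq (acts2 (act_YV i) (act_Y i)) acts1) => g; apply: funext => R.
  by rewrite /= /opY_fun mulrA mulVf ?mul1r ?Y_weight_neq0.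
- apply: (acts_eq (acts2 (act_Y i) (act_Y j)) (acts2 (act_Y j) (act_Y i))) => g.
  by apply: funext => R; rewrite /= /opY_fun mulrCA.
- apply: (acts_eq (acts2 (actsB (act_T i) (actsC t)) (actsD (act_T i) (actsC t^-1))) acts0) => g.
  rewrite /= linearD linearZ /= op_quad; apply: funext => R.
  by rewrite !(funDE, funNE, funZE) fun0E; field.
- apply: (acts_eq (acts3 (act_T i) (act_T j) (act_T i)) (acts3 (act_T j) (act_T i) (act_T j))) => g /=.
  case/orP: ij; rewrite mod_dvdz => h.
    rewrite -addn1 PoszD in h; rewrite !(opT_mod _ h); apply: op_braid.
    by move: n2 n_ge2; case: (k * N)%N => [|[|[]]].
  rewrite -addn1 PoszD in h; rewrite !(opT_mod _ h); apply/esym/op_braid.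
  by move: n2 n_ge2; case: (k * N)%N => [|[|[]]].
- apply: (acts_eq (acts2 (act_T i) (act_T j)) (acts2 (act_T j) (act_T i))) => g /=.
  case: (boolP (i == j %[mod n])%N); rewrite mod_dvdz => h0.
    by rewrite !(opT_mod _ h0).
  have dN x : (n%:Z %| - x)%Z = (n%:Z %| x)%Z by rewrite rpredN.
  case/andP: ij; rewrite !mod_dvdz -(addn1 i) -(addn1 j) !PoszD => h1 h2.
  apply: op_comm; rewrite /far h0 /= -dN.
  rewrite (_ : - (i%:Z - j%:Z - 1) = - (i%:Z - (j%:Z + 1))); last by lia.
  by rewrite dN h2 -dN (_ : - (i%:Z - j%:Z + 1) = j%:Z - (i%:Z + 1)) //; lia.
- apply: (acts_eq (acts3 act_Pi (act_T i) act_PiV) (act_T i.+1)) => g /=.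
  by rewrite op_PiT -(addn1 i) PoszD.
- apply: (acts_eq (acts3 (act_T i) (act_Y i) (act_T i)) (act_Y i.+1)) => g /=.
  have -> : Y_weight (i %% n) = (fun R => t ^ (2 * dg R i%:Z)).
    by apply: funext => R; rewrite Y_weightE //; lia.
  have -> : Y_weight (i.+1 %% n) = (fun R => t ^ (2 * dg R (i%:Z + 1))).
    by apply: funext => R; rewrite Y_weightE; [rewrite -(addn1 i) PoszD | lia].
  exact: op_TY.
- apply: (acts_eq (acts3 (act_T 0) (act_Y n) (act_T 0)) (actsZ q^-1 (act_Y 1))) => g /=.
  have -> : Y_weight (n %% n) = (fun R => t ^ (2 * dg R n%:Z)).
    by apply: funext => R; rewrite Y_weightE //; lia.
  have h : (n%:Z %| 0%:Z - n%:Z)%Z by rewrite rpredB ?dvdz0.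
  rewrite !(opT_mod _ h) op_TY; apply: funext => R.
  rewrite funZE /opY_fun weight_shift Y_weightE; last by lia.
  by rewrite mulrA.
- apply: (acts_eq (acts2 (act_T i) (act_Y j)) (acts2 (act_Y j) (act_T i))) => g /=.
  case/andP: ij; rewrite !mod_dvdz -(addn1 i) PoszD => h0 h1.
  apply: funext => R; rewrite /opT_fun /opY_fun.
  have [m hm] : exists m : int, Y_index (j %% n) = j%:Z + m * n%:Z.
    rewrite /Y_index; have e := divn_eq j n; case: eqP => [j0|_].
      exists (1 - (j %/ n)%N%:Z); move: e; rewrite j0 addn0 => e; rewrite {1}e PoszM; ring.
    by exists (- (j %/ n)%N%:Z); rewrite {2}e PoszD PoszM; ring.
  have e : be (- gap i%:Z R) * Y_weight (j %% n) (sw i%:Z R) =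
           be (- gap i%:Z R) * Y_weight (j %% n) R.
    case: (boolP (swappable R i%:Z)) => s; last by rewrite (beta_unswappable s) !mul0r.
    rewrite /Y_weight diag_swap // hm zswap_period // zswap_id //.
    by rewrite (_ : j%:Z - i%:Z - 1 = j%:Z - (i%:Z + 1)) //; lia.
  by rewrite !mulrA e; ring.
- apply: (acts_eq (acts3 act_Pi (act_Y i) act_PiV) (act_Y i.+1)) => g /=.
  apply: funext => R; rewrite /opPi_fun /opY_fun.
  rewrite (shiftK n_ge2 (-1)) !Y_weightE ?diag_shift; [|lia|lia].
  by rewrite opprK -(addn1 i) PoszD.
- apply: (acts_eq (acts3 act_Pi (act_Y n) act_PiV) (actsZ q^-1 (act_Y 1))) => g /=.
  apply: funext => R; rewrite funZE /opPi_fun /opY_fun.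
  rewrite (shiftK n_ge2 (-1)) !Y_weightE ?diag_shift; [|lia|lia].
  by rewrite opprK weight_shift mulrA.
Qed.

End TableauModule.

Definition free_family (K A : pzRingType) (sc : {rmorphism K -> A}) (V : lmodType A)
    (I : eqType) (v : I -> V) : Prop :=
  forall (s : seq I) (c : I -> K), uniq s ->
    \sum_(i <- s) sc (c i) *: v i = 0 -> forall i, i \in s -> c i = 0.

(** The normal form of the module [L(k^N)].  The family is only required to be
    free: the module of all functions on tableaux, where it is constructed, is
    larger than its span. *)
Record seminormal (K : fieldType) (N k : nat) (n_ge2 : (2 <= k * N)%N) (q t : K)
    (H : daha_alg (k * N) q t) (F : lmodType H) (v : psyt N k -> F) : Prop :=
  Seminormal {
  sn_free : free_family (alg_scal H) v;
  sn_T : forall i R, (0 < i < k * N)%N -> alg_T H i *: v R =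
    alg_scal H (alpha t (gap i%:Z R)) *: v R
    + alg_scal H (beta t (gap i%:Z R)) *: v (psyt_swap n_ge2 i%:Z R);
  sn_Y : forall i R, (0 < i <= k * N)%N ->
    alg_Y H i *: v R = alg_scal H (t ^ (2 * psyt_diag R i%:Z)) *: v R;
  sn_Pi : forall R, alg_Pi H *: v R = v (psyt_shift n_ge2 R 1);
  sn_PiV : forall R, alg_PiV H *: v R = v (psyt_shift n_ge2 R (-1))
}.

Section Existence.
Variables (K : fieldType) (N k : nat) (q t : K).
Hypotheses (n_ge2 : (2 <= k * N)%N) (t_neq0 : t != 0).
Hypothesis t_nroot : forall m : nat, (0 < m)%N -> t ^+ m != 1.
Hypothesis qE : q = t ^- (2 * k).

Local Notation n := (k * N)%N.
Local Notation E := (psyt N k -> K^o).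
Local Notation sw := (psyt_swap n_ge2).

Definition delta (R : psyt N k) : E := fun R' => (R' == R)%:R.

Lemma delta_T i R : opT_fun t n_ge2 i (delta R) =
  alpha t (gap i R) *: delta R + beta t (gap i R) *: delta (sw i R).
Proof.
apply: funext => R'; rewrite funDE !funZE /opT_fun /delta; congr (_ + _).
  by case: eqP => [->|_]; rewrite ?mulr0.
have -> : (sw i R' == R) = (R' == sw i R).
  by apply/eqP/eqP => [<-|->]; rewrite psyt_swapK.
case: eqP => [->|_]; last by rewrite !mulr0.
rewrite !mulr1; case: (boolP (swappable R i)) => s; first by rewrite gap_swap // opprK.
rewrite psyt_swap_id //; move: s; rewrite /swappable -/(gap i R) negbK /beta normrN.
by move=> ->.
Qed.

Lemma delta_shift x R :
  opPi_fun n_ge2 x (delta R) = delta (psyt_shift n_ge2 R (- x)).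
Proof.
apply: funext => R'; rewrite /opPi_fun /delta; congr (_%:R); congr nat_of_bool.
apply/eqP/eqP => [<-|->]; first by rewrite shiftK.
by have := shiftK n_ge2 (- x) R; rewrite opprK.
Qed.

Lemma delta_free (s : seq (psyt N k)) (c : psyt N k -> K) : uniq s ->
  \sum_(R <- s) c R *: delta R = 0 -> forall R, R \in s -> c R = 0.
Proof.
move=> us e R Rs; have := congr1 (fun g : E => g R) e.
rewrite fct_sumE fun0E (bigD1_seq R) //= funZE /delta eqxx mulr1.
rewrite big1 ?addr0 // => R' ne; rewrite funZE eq_sym.
by rewrite (negbTE ne) mulr0.
Qed.

(** The functions concentrated at one tableau, in the module defined by
    [tableau_op]. *)
Lemma exists_seminormal : exists (F : lmodType (daha_inst q n_ge2 t_neq0))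
  (v : psyt N k -> F), seminormal n_ge2 v.
Proof.
have [L [f [fbij fD fZ fop]]] :=
  presented_module (tableau_rel n_ge2 t_neq0 t_nroot qE).
have f0 : f 0 = 0.
  by apply: (addrI (f 0)); rewrite -fD !addr0.
exists L, (f \o delta); split.
- move=> s c us e; apply: delta_free us _.
  apply: (bij_inj fbij); rewrite f0 -[RHS]e.
  rewrite (big_morph f fD f0); apply: eq_bigr => R _; symmetry; exact: fZ.
- move=> i R hi; apply: (etrans (fop _ _)) => /=.
  have -> : opT_fun t n_ge2 (i %% n.-1.+1)%N = opT_fun t n_ge2 i%:Z.
    by rewrite prednK ?modn_small //; lia.
  by rewrite delta_T fD -!fZ.
- move=> i R hi; apply: (etrans (fop _ _)); apply: (etrans _ (esym (fZ _ _))).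
  congr f; apply: funext => R' /=; rewrite prednK; last by lia.
  by rewrite /opY_fun Y_weightE // funZE /delta; case: eqP => [->|]; rewrite ?mulr0.
- by move=> R; apply: (etrans (fop _ _)); rewrite /= delta_shift opprK.
- by move=> R; apply: (etrans (fop _ _)); rewrite /= delta_shift.
Qed.

End Existence.

(** * Bases of simultaneous eigenvectors *)

Section Combinations.
Variables (K : fieldType) (A : pzRingType) (sc : {rmorphism K -> A}) (I : eqType).

Definition combination (V : lmodType A) (v : I -> V) (r : seq (K * I)) : V :=
  \sum_(p <- r) sc p.1 *: v p.2.

Definition total_coef (r : seq (K * I)) (i : I) : K := \sum_(p <- r | p.2 == i) p.1.

Definition scale_comb (c : K) (r : seq (K * I)) := [seq (c * p.1, p.2) | p <- r].

Lemma combination_group (V : lmodType A) (v : I -> V) r :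
  combination v r = \sum_(i <- undup (unzip2 r)) sc (total_coef r i) *: v i.
Proof.
transitivity (\sum_(i <- undup (unzip2 r)) \sum_(p <- r | p.2 == i) sc p.1 *: v p.2).
  rewrite (exchange_big_dep predT) //= /combination [LHS]big_seq [RHS]big_seq.
  apply: eq_bigr => p pr; rewrite -big_filter.
  have u : uniq [seq i <- undup (unzip2 r) | p.2 == i] by rewrite filter_uniq ?undup_uniq.
  rewrite (perm_big [:: p.2]) ?big_seq1 //; apply: uniq_perm => // i.
  rewrite mem_filter mem_undup inE eq_sym andb_idr // => /eqP ->.
  exact: (map_f snd pr).
apply: eq_bigr => i _; rewrite /total_coef rmorph_sum scaler_suml.
by apply: eq_bigr => p /eqP ->.
Qed.

Lemma combination_coef0 (V : lmodType A) (v : I -> V) r :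
  (forall i, total_coef r i = 0) -> combination v r = 0.
Proof.
by move=> h; rewrite combination_group big1 // => i _; rewrite h rmorph0 scale0r.
Qed.

Lemma combination_cat (V : lmodType A) (v : I -> V) r r' :
  combination v (r ++ r') = combination v r + combination v r'.
Proof. exact: big_cat. Qed.

Lemma combination_scale (V : lmodType A) (v : I -> V) c r :
  combination v (scale_comb c r) = sc c *: combination v r.
Proof.
rewrite /combination big_map scaler_sumr; apply: eq_bigr => p _ /=.
by rewrite rmorphM scalerA.
Qed.

Lemma total_coef_cat r r' i : total_coef (r ++ r') i = total_coef r i + total_coef r' i.
Proof. exact: big_cat. Qed.

Lemma total_coef_scale c r i : total_coef (scale_comb c r) i = c * total_coef r i.
Proof. by rewrite /total_coef big_map /= mulr_sumr. Qed.

Lemma free_total_coef (V : lmodType A) (v : I -> V) r : free_family sc v ->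
  combination v r = 0 -> forall i, total_coef r i = 0.
Proof.
move=> fv; rewrite combination_group => e i.
case: (boolP (i \in undup (unzip2 r))) => ir; first exact: (fv _ _ (undup_uniq _) e).
rewrite /total_coef big1_seq // => p /andP[/eqP pi pr]; case/negP: ir.
by rewrite mem_undup -pi map_f.
Qed.

Definition spanning (V : lmodType A) (v : I -> V) : Prop :=
  forall x, exists r, x = combination v r.

Lemma is_basisP (V : lmodType A) (v : I -> V) :
  is_basis sc v <-> free_family sc v /\ spanning v.
Proof.
split=> [[fv sv]|[fv sv]]; split.
- move=> s c us e i si; pose f (j : 'I_(size s)) := tnth (in_tuple s) j.
  have fI : injective f by apply/tuple_uniqP.
  have [j ->] : exists j, i = f j by apply/tnthP.
  apply: (fv _ f (c \o f) fI) => /=; rewrite -[RHS]e.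
  by rewrite (big_tnth 0 +%R s predT).
- move=> x; have [m [e [c ->]]] := sv x.
  by exists [seq (c j, e j) | j <- index_enum 'I_m]; rewrite /combination big_map.
- move=> m e c ie s0 j.
  pose r := [seq (c j, e j) | j <- index_enum 'I_m].
  have /(free_total_coef fv)/(_ (e j)) : combination v r = 0.
    by rewrite /combination big_map.
  rewrite /total_coef big_map /= (big_pred1 j) // => j' /=.
  exact: inj_eq.
- move=> x; have [r ->] := sv x.
  exists (size r), (fun j => (tnth (in_tuple r) j).2), (fun j => (tnth (in_tuple r) j).1).
  by rewrite /combination big_tnth.
Qed.

Section WithBasis.
Variables (V : lmodType A) (v : I -> V).
Hypotheses (fv : free_family sc v) (sv : spanning v).

Lemma coordinates : exists chi : I -> V -> K,
  [/\ forall i x y, chi i (x + y) = chi i x + chi i y,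
      forall i c x, chi i (sc c *: x) = c * chi i x
    & forall i j, chi i (v j) = (i == j)%:R].
Proof.
have [r hr] := choice sv.
have uniq_coef r1 r2 i : combination v r1 = combination v r2 -> total_coef r1 i = total_coef r2 i.
  move=> e; have := @free_total_coef _ v (r1 ++ scale_comb (-1) r2) fv.
  rewrite combination_cat combination_scale e rmorphN1 scaleN1r subrr => /(_ erefl i).
  by rewrite total_coef_cat total_coef_scale mulN1r => /eqP; rewrite subr_eq0 => /eqP.
exists (fun i x => total_coef (r x) i); split.
- move=> i x y; rewrite -total_coef_cat; apply: uniq_coef.
  by rewrite combination_cat -!hr.
- move=> i c x; rewrite -total_coef_scale; apply: uniq_coef.
  by rewrite combination_scale -!hr.
move=> i j; transitivity (total_coef [:: (1, j)] i).
  by apply: uniq_coef; rewrite -hr /combination big_seq1 rmorph1 scale1r.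
by rewrite /total_coef big_mkcond big_seq1 /= eq_sym; case: eqP.
Qed.

Lemma linear_extension (W : lmodType A) (w : I -> W) : exists g : V -> W,
  [/\ forall x y, g (x + y) = g x + g y, forall c x, g (sc c *: x) = sc c *: g x
    & forall i, g (v i) = w i].
Proof.
have [r hr] := choice sv.
have wd r1 r2 : combination v r1 = combination v r2 -> combination w r1 = combination w r2.
  move=> e; apply/eqP; rewrite -subr_eq0 -scaleN1r -(rmorphN1 sc) -combination_scale.
  rewrite -combination_cat; apply/eqP/combination_coef0/(@free_total_coef V v) => //.
  by rewrite combination_cat combination_scale e rmorphN1 scaleN1r subrr.
exists (fun x => combination w (r x)); split.
- by move=> x y; rewrite -combination_cat; apply: wd; rewrite combination_cat -!hr.
- by move=> c x; rewrite -combination_scale; apply: wd; rewrite combination_scale -!hr.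
move=> i; rewrite -[RHS](_ : combination w [:: (1, i)] = _); last first.
  by rewrite /combination big_seq1 rmorph1 scale1r.
by apply: wd; rewrite -hr /combination big_seq1 rmorph1 scale1r.
Qed.

Lemma spanning_uniq x : exists s c, uniq s /\ x = \sum_(i <- s) sc (c i) *: v i.
Proof.
have [r ->] := sv x; rewrite combination_group.
by exists (undup (unzip2 r)), (total_coef r); rewrite undup_uniq.
Qed.

Hypothesis scC : forall c a, sc c * a = a * sc c.
Variables (J : Type) (y : J -> A) (w : I -> J -> K).
Hypothesis vw : forall i j, y j *: v i = sc (w i j) *: v i.

Lemma eigenvector_coef (z : J -> K) s c i : uniq s ->
  (forall j, y j *: (\sum_(i <- s) sc (c i) *: v i)
             = sc (z j) *: (\sum_(i <- s) sc (c i) *: v i)) ->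
  i \in s -> c i != 0 -> w i =1 z.
Proof.
move=> us e si ci j; have := e j; rewrite !scaler_sumr => /eqP.
rewrite -subr_eq0 -sumrB => /eqP e'.
have : \sum_(i <- s) sc (c i * (w i j - z j)) *: v i = 0.
  rewrite -[RHS]e'; apply: eq_bigr => i' _.
  rewrite scalerA -scC -scalerA vw scalerA scalerA -scalerBl.
  by rewrite -!rmorphM -rmorphB mulrBr (mulrC (z j)).
move/(fv us)/(_ i si)/eqP; rewrite mulf_eq0 (negbTE ci) /= subr_eq0.
by move/eqP.
Qed.

Hypothesis w_inj : forall i i', w i =1 w i' -> i = i'.

(** Distinct basis vectors have distinct eigenvalues, so only one of them can occur
    in an eigenvector. *)
Lemma eigenvector_basis (z : J -> K) x : (forall j, y j *: x = sc (z j) *: x) ->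
  x = 0 \/ exists i c, [/\ w i =1 z, c != 0 & x = sc c *: v i].
Proof.
have [s [c [us ->]]] := spanning_uniq x => e.
case: (boolP (has (fun i => c i != 0) s)) => [/hasP[i si ci]|/hasPn h]; last first.
  left; rewrite big1_seq // => i /andP[_ /h]; rewrite negbK => /eqP ->.
  by rewrite rmorph0 scale0r.
right; have wi := eigenvector_coef us e si ci.
exists i, (c i); split=> //; rewrite (bigD1_seq i) //= big1_seq ?addr0 // => i' /andP[ne si'].
case: (eqVneq (c i') 0) => [->|ci']; first by rewrite rmorph0 scale0r.
case/eqP: ne; apply: w_inj => j.
by rewrite (eigenvector_coef us e si' ci') wi.
Qed.

(** A predicate stable under the operators [y_j - a] is inherited by the components
    of a vector: [y_j - w i' j] removes the component [i'] and only rescales the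
    component [i], by a nonzero factor for a suitable [j]. *)
Lemma isolate (P : V -> Prop) s c i : uniq s -> i \in s -> c i != 0 ->
  (forall x, P x -> forall j (a : K), P (y j *: x - sc a *: x)) ->
  P (\sum_(i <- s) sc (c i) *: v i) -> exists2 b, b != 0 & P (sc b *: v i).
Proof.
move=> + + + PS; have [m] := ubnP (size s); elim: m s c => // m IH s c sm us si ci Ps.
case: (boolP (all (pred1 i) s)) => [/all_pred1P h|/allPn[i' si' ne]].
  exists (c i) => //; suff e : s = [:: i] by rewrite e big_seq1 in Ps.
  by move: us si; rewrite h; case: (size s) => [|[|l]] //=; rewrite inE eqxx.
have [j wj] : exists j, w i j != w i' j.
  apply: contrapT => h; case/negP: ne; apply/eqP/esym/w_inj => j.
  by apply: contrapT => /eqP hj; apply: h; exists j.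
have e : y j *: (\sum_(l <- s) sc (c l) *: v l) - sc (w i' j) *: (\sum_(l <- s) sc (c l) *: v l)
    = \sum_(l <- rem i' s) sc (c l * (w l j - w i' j)) *: v l.
  rewrite !scaler_sumr -sumrB (perm_big _ (perm_to_rem si')) big_cons /=.
  have E l : y j *: (sc (c l) *: v l) - sc (w i' j) *: (sc (c l) *: v l)
      = sc (c l * (w l j - w i' j)) *: v l.
    rewrite scalerA -scC -scalerA vw scalerA scalerA -scalerBl.
    by rewrite -!rmorphM -rmorphB mulrBr (mulrC (w i' j)).
  rewrite E subrr mulr0 rmorph0 scale0r add0r.
  by apply: eq_bigr => l _; rewrite E.
have [|||||b b0 Pb] := IH (rem i' s) (fun l => c l * (w l j - w i' j)).
- by rewrite size_rem //; case: (s) si' sm.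
- exact: rem_uniq.
- by rewrite mem_rem_uniq // inE si andbT eq_sym.
- by rewrite mulf_neq0 // subr_eq0.
- by rewrite -e; apply: PS.
by exists b.
Qed.

End WithBasis.

Lemma rescale_basis (V : lmodType A) (v : I -> V) (c : I -> K) : (forall i, c i != 0) ->
  free_family sc v -> spanning v ->
  free_family sc (fun i => sc (c i) *: v i) /\ spanning (fun i => sc (c i) *: v i).
Proof.
move=> c0 fv sv; split=> [s d us e i si|x].
  have : d i * c i = 0.
    apply: (fv s (fun i => d i * c i) us) si; rewrite -[RHS]e.
    by apply: eq_bigr => j _; rewrite scalerA rmorphM.
  by move/eqP; rewrite mulf_eq0 (negbTE (c0 i)) orbF => /eqP.
have [r ->] := sv x; exists [seq (p.1 / c p.2, p.2) | p <- r].
by rewrite /combination big_map; apply: eq_bigr => p _; rewrite scalerA -rmorphM divfK.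
Qed.

Section Eigenbasis.
Variables (V : lmodType A) (v : I -> V).
Hypotheses (fv : free_family sc v) (sv : spanning v).
Hypothesis scC : forall c a, sc c * a = a * sc c.
Variables (J : finType) (y : J -> A) (w : I -> {ffun J -> K}).
Hypotheses (vw : forall i j, y j *: v i = sc (w i j) *: v i) (w_inj : injective w).

Lemma eigenvectorP (z : {ffun J -> K}) x : (forall j, y j *: x = sc (z j) *: x) ->
  x = 0 \/ exists i c, [/\ z = w i, c != 0 & x = sc c *: v i].
Proof.
have w_inj' i i' : w i =1 w i' -> i = i' by move/ffunP/w_inj.
move/(eigenvector_basis fv sv scC vw w_inj') => [->|[i [c [e c0 ->]]]]; first by left.
by right; exists i, c; split=> //; apply/ffunP => j.
Qed.

Lemma eigenvector_scale i c j : y j *: (sc c *: v i) = sc (w i j) *: (sc c *: v i).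
Proof. by rewrite scalerA -scC -scalerA vw !scalerA scC. Qed.

Lemma eigenvector_sum x : exists (s : seq {ffun J -> K}) (f : {ffun J -> K} -> V),
  (forall z, z \in s -> (exists i, z = w i) /\ forall j, y j *: f z = sc (z j) *: f z) /\
  x = \sum_(z <- s) f z.
Proof.
have [s [c [us ->]]] := spanning_uniq sv x.
pose f z := \sum_(i <- s | w i == z) sc (c i) *: v i.
have fE i : i \in s -> f (w i) = sc (c i) *: v i.
  move=> si; rewrite /f big_mkcond (bigD1_seq i) //= eqxx big1 ?addr0 // => i' ne.
  by rewrite inj_eq // (negbTE ne).
exists [seq w i | i <- s], f; split=> [_ /mapP[i si ->]|].
  by split=> [|j]; [exists i | rewrite fE // eigenvector_scale].
by rewrite big_map [LHS]big_seq [RHS]big_seq; apply: eq_bigr => i /fE.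
Qed.

Lemma eigenvector_free (s : seq {ffun J -> K}) (f : {ffun J -> K} -> V) : uniq s ->
  (forall z, z \in s -> forall j, y j *: f z = sc (z j) *: f z) ->
  \sum_(z <- s) f z = 0 -> forall z, z \in s -> f z = 0.
Proof.
move=> us fs e z zs; have [//|[i [c [zw c0 fz]]]] := eigenvectorP (fs z zs).
have [chi [chiD chiZ chiv]] := coordinates fv sv.
have chi0 : chi i 0 = 0 by rewrite -(scale0r 0) -(rmorph0 sc) chiZ mul0r.
have := congr1 (chi i) e; rewrite (big_morph _ (chiD i) chi0) (bigD1_seq z) //=.
rewrite big1_seq ?addr0 => [|z' /andP[ne zs']].
  by rewrite fz chiZ chiv eqxx mulr1 chi0 => c1; rewrite c1 eqxx in c0.
have [->//|[i' [c' [zw' _ ->]]]] := eigenvectorP (fs z' zs').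
rewrite chiZ chiv; case: eqP => [ii'|]; last by rewrite mulr0.
by rewrite zw' zw ii' eqxx in ne.
Qed.

Lemma eigenvector_weight (z : {ffun J -> K}) :
  (exists x : V, x != 0 /\ forall j, y j *: x = sc (z j) *: x) <-> exists i, z = w i.
Proof.
split=> [[x [x0 /eigenvectorP[e|[i [c [-> _ _]]]]]]|[i ->]]; [by rewrite e eqxx in x0 | by exists i |].
exists (v i); split=> //; apply/eqP => vi0.
have : (1 : K) = 0; last by move/eqP; rewrite oner_eq0.
by apply: (fv (s := [:: i]) (c := fun=> 1)) (mem_head i _); rewrite ?big_seq1 ?vi0 ?scaler0.
Qed.

End Eigenbasis.

End Combinations.

(** * Rescaling a basis of standard tableaux to seminormal form *)

HB.instance Definition _ N k := gen_eqMixin (syt N k).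

Section SytSwap.
Variables (N k : nat).
Hypothesis n_ge2 : (2 <= k * N)%N.
Local Notation n := (k * N)%N.
Local Notation ext := (psyt_of_syt n_ge2).
Local Notation sw := (psyt_swap n_ge2).

Lemma syt_eq (S S' : syt N k) : syt_entry S =1 syt_entry S' -> S = S'.
Proof.
case: S S' => f b fK bK r c [f' b' fK' bK' r' c'] /= /funext ff'.
rewrite -{f'}ff' in fK' bK' r' c' *.
have bb' : b = b' by apply: funext => x; rewrite -[x in LHS]bK' fK.
rewrite -{b'}bb' in fK' bK' *.
by congr Syt; apply: Prop_irrelevance.
Qed.

Lemma psyt_of_syt_inj : injective ext.
Proof.
move=> S S' e; apply: syt_eq => -[j m]; apply: val_inj.
have h (T : syt N k) : psyt_entry (ext T) (j, m.+1%:Z) = (syt_entry T (j, m)).+1%:Z.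
  have hm : 1 <= m.+1%:Z <= k%:Z by have := ltn_ord m; lia.
  apply: (etrans (proj1 (ext_small n_ge2 T j hm))).
  have -> : residue (k_pos n_ge2) (m.+1%:Z - 1) = m.
    have -> : m.+1%:Z - 1 = m%:Z + 0 * k%:Z by lia.
    exact: residueK.
  by rewrite -(addn1 (syt_entry T _)) PoszD.
by have := h S; rewrite e h => -[].
Qed.

Lemma fundamental_swap (i : nat) R : (0 < i < n)%N -> fundamental R -> fundamental (sw i%:Z R).
Proof.
move=> hi fR; case: (boolP (swappable R i%:Z)) => s; last by rewrite psyt_swap_id.
by move=> e; rewrite -(zswap_range n_ge2 _ hi) col_swap // => /fR.
Qed.

Lemma syt_swap_ex (i : nat) (S : syt N k) :
  exists S', (0 < i < n)%N -> ext S' = sw i%:Z (ext S).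
Proof.
case: (boolP (0 < i < n)%N) => hi; last by exists S.
have [S' h] := syt_of_fundamental n_ge2 (fundamental_swap hi (fundamental_of_syt n_ge2 S)).
by exists S'.
Qed.

(** Chosen through the periodic extension, where the exchange is already
    available. *)
Definition syt_swap (i : nat) (S : syt N k) : syt N k := projT1 (cid (syt_swap_ex i S)).

Lemma syt_swapE i S : (0 < i < n)%N -> ext (syt_swap i S) = sw i%:Z (ext S).
Proof. exact: (projT2 (cid (syt_swap_ex i S))). Qed.

Definition syt_gap (i : nat) (S : syt N k) : int := gap i%:Z (ext S).

Definition syt_swappable (i : nat) (S : syt N k) : bool := swappable (ext S) i%:Z.

Lemma syt_swappableE i S : syt_swappable i S = (`|syt_gap i S| != 1).
Proof. by []. Qed.

Lemma syt_swapK i S : (0 < i < n)%N -> syt_swap i (syt_swap i S) = S.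
Proof. by move=> hi; apply: psyt_of_syt_inj; rewrite !syt_swapE // psyt_swapK. Qed.

Lemma syt_gap_swap i S : (0 < i < n)%N -> syt_swappable i S -> syt_gap i (syt_swap i S) = - syt_gap i S.
Proof. by move=> hi s; rewrite /syt_gap syt_swapE // gap_swap. Qed.

Lemma far_nat i j : (0 < i)%N -> (i.+1 < j < n)%N -> far N k i%:Z j%:Z.
Proof. by move=> *; apply/and3P; split; apply: not_dvd_small => //; lia. Qed.

Lemma syt_swap_comm i j S : (0 < i)%N -> (i.+1 < j < n)%N -> syt_swappable i S -> syt_swappable j S ->
  [/\ syt_swappable j (syt_swap i S), syt_swappable i (syt_swap j S),
      syt_swap j (syt_swap i S) = syt_swap i (syt_swap j S),
      syt_gap j (syt_swap i S) = syt_gap j S & syt_gap i (syt_swap j S) = syt_gap i S].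
Proof.
move=> i0 ij si sj; have f := far_nat i0 ij.
have hi : (0 < i < n)%N by lia.
have hj : (0 < j < n)%N by lia.
have [s1 s2 e] := psyt_swap_comm n_ge2 f si sj.
split; rewrite /syt_swappable /syt_gap ?syt_swapE //.
- by apply: psyt_of_syt_inj; rewrite !syt_swapE.
- by rewrite gap_swap_far //; apply: far_sym.
- by rewrite gap_swap_far.
Qed.

Lemma syt_swap_braid i S : (0 < i)%N -> (i.+1 < n)%N -> syt_swappable i S -> syt_swappable i.+1 S ->
  `|syt_gap i S + syt_gap i.+1 S| != 1 ->
  [/\ [/\ syt_swappable i.+1 (syt_swap i S), syt_swappable i (syt_swap i.+1 S),
       syt_swappable i (syt_swap i.+1 (syt_swap i S)) & syt_swappable i.+1 (syt_swap i (syt_swap i.+1 S))],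
      syt_swap i (syt_swap i.+1 (syt_swap i S)) = syt_swap i.+1 (syt_swap i (syt_swap i.+1 S)),
      syt_gap i.+1 (syt_swap i S) = syt_gap i S + syt_gap i.+1 S,
      syt_gap i (syt_swap i.+1 S) = syt_gap i S + syt_gap i.+1 S
    & syt_gap i (syt_swap i.+1 (syt_swap i S)) = syt_gap i.+1 S /\
      syt_gap i.+1 (syt_swap i (syt_swap i.+1 S)) = syt_gap i S].
Proof.
move=> i0 iS; rewrite /syt_swappable /syt_gap -(addn1 i) PoszD => si sj F.
have n3 : (3 <= n)%N by lia.
have hi : (0 < i < n)%N by lia.
have hj : (0 < i + 1 < n)%N by lia.
have [s1 s2 s3 s4 e] := psyt_swap_braid n_ge2 n3 si sj F.
rewrite !syt_swapE // PoszD; split=> //.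
- by apply: psyt_of_syt_inj; rewrite !syt_swapE // PoszD.
- exact: gap_swap_next.
- exact: gap_swap_prev.
- by split; rewrite ?gap_swap_prev ?gap_swap_next ?gap_swap // ?addKr ?addrK //;
    rewrite gap_swap_prev // addrK.
Qed.

(** Then [i] lies above and to the right of [i + 1]; exchanging them brings the
    tableau closer to the one that is filled column by column. *)
Definition descent (i : nat) (S : syt N k) : bool := (0 < i < n)%N && (syt_gap i S <= -2).

Lemma descent_sw i S : descent i S -> syt_swappable i S.
Proof. by case/andP => _ h; rewrite syt_swappableE; lia. Qed.

(** Moving small entries to small diagonals decreases this weighted sum; the shift
    by [N] makes all the terms nonnegative. *)
Definition disorder (S : syt N k) : int :=
  \sum_(e < n) (n%:Z - e%:Z) * (psyt_diag (ext S) e.+1%:Z + N%:Z).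

Lemma disorder_ge0 S : 0 <= disorder S.
Proof.
apply: sumr_ge0 => e _; apply: mulr_ge0; first by have := ltn_ord e; lia.
by rewrite diag_of_syt /syt_diag; have := ltn_ord (syt_box S e).1; lia.
Qed.

Lemma disorder_swap i S : descent i S -> disorder (syt_swap i S) < disorder S.
Proof.
move=> ds; have si := descent_sw ds; case/andP: ds => hi g2.
pose d x := psyt_diag (ext S) x + N%:Z.
have e1 : disorder (syt_swap i S) = \sum_(e < n) (n%:Z + 1 - zswap n i%:Z e.+1%:Z) * d e.+1%:Z.
  rewrite -(sum_zswap n_ge2 (fun x => (n%:Z + 1 - zswap n i%:Z x) * d x) hi).
  by apply: eq_bigr => e _; rewrite zswapK // syt_swapE // diag_swap // /d; congr (_ * _); lia.
rewrite -subr_lt0 e1 -sumrB.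
have hi1 : (i.-1 < n)%N by lia.
have hi2 : (i < n)%N by lia.
rewrite (bigD1 (Ordinal hi1)) // (bigD1 (Ordinal hi2)) /=; last first.
  by rewrite -val_eqE /=; lia.
rewrite big1 ?addr0 => [|e /andP[ne1 ne2]]; last first.
  rewrite -!val_eqE /= in ne1 ne2.
  rewrite zswap_id; last 2 first.
  - by apply: not_dvd_small => //; have := ltn_ord e; lia.
  - by apply: not_dvd_small => //; have := ltn_ord e; lia.
  by rewrite -mulrBl (_ : _ - _ - _ = 0) ?mul0r //; lia.
have -> : (i.-1).+1%:Z = i%:Z by lia.
have -> : i.+1%:Z = i%:Z + 1 by lia.
rewrite zswap_l zswap_r // /d.
move: g2; rewrite /syt_gap /gap.
have -> : (i.-1)%:Z = i%:Z - 1 by lia.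
move: (psyt_diag _ (i%:Z + 1)) (psyt_diag _ i%:Z) => x y; nia.
Qed.

End SytSwap.

Section Coherence.
Variables (K : fieldType) (N k : nat) (t : K).
Hypotheses (n_ge2 : (2 <= k * N)%N) (t_neq0 : t != 0).
Hypothesis t_nroot : forall m : nat, (0 < m)%N -> t ^+ m != 1.
Local Notation n := (k * N)%N.
Local Notation syt := (syt N k).
Local Notation ssw := (syt_swap n_ge2).
Local Notation sg := (syt_gap n_ge2).
Local Notation be := (beta t).

(** [b i S] stands for the coefficient of the exchanged tableau in [T_i v_S], for a
    basis of weight vectors; the hypotheses are what the relations of the finite
    Hecke algebra say about these coefficients.  Rescaling the basis turns [b] into
    [beta] if the product of the ratios [edge] along a path of exchanges only
    depends on its ends. *)
Variable b : nat -> syt -> K.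
Hypothesis b_quad : forall i S, (0 < i < n)%N -> syt_swappable n_ge2 i S ->
  b i S * b i (ssw i S) = be (sg i S) * be (- sg i S).
Hypothesis b_comm : forall i j S, (0 < i)%N -> (i.+1 < j < n)%N ->
  syt_swappable n_ge2 i S -> syt_swappable n_ge2 j S ->
  b i S * b j (ssw i S) = b j S * b i (ssw j S).
Hypothesis b_braid : forall i S, (0 < i)%N -> (i.+1 < n)%N ->
  syt_swappable n_ge2 i S -> syt_swappable n_ge2 i.+1 S -> `|sg i S + sg i.+1 S| != 1 ->
  b i S * b i.+1 (ssw i S) * b i (ssw i.+1 (ssw i S)) =
  b i.+1 S * b i (ssw i.+1 S) * b i.+1 (ssw i (ssw i.+1 S)).

Lemma beta_sw i S : syt_swappable n_ge2 i S -> be (sg i S) != 0.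
Proof. by rewrite syt_swappableE => h; apply: beta_neq0 => //; apply: gap_neq0. Qed.

Lemma beta_swN i S : syt_swappable n_ge2 i S -> be (- sg i S) != 0.
Proof.
rewrite syt_swappableE => h; apply: beta_neq0 => //; last by rewrite normrN.
by rewrite oppr_eq0 gap_neq0.
Qed.

Definition edge i S : K := b i S / be (sg i S).

Lemma edgeK i S : (0 < i < n)%N -> syt_swappable n_ge2 i S -> edge i S * edge i (ssw i S) = 1.
Proof.
move=> hi s; rewrite /edge syt_gap_swap // mulrACA b_quad // -invfM mulfV //.
by apply: mulf_neq0; [exact: beta_sw | exact: beta_swN].
Qed.

Lemma edge_neq0 i S : (0 < i < n)%N -> syt_swappable n_ge2 i S -> edge i S != 0.
Proof.
move=> hi s; apply/negP => /eqP e; have := edgeK hi s; rewrite e mul0r => /eqP.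
by rewrite eq_sym oner_eq0.
Qed.

(** The factors accumulated along a path of descents that cannot be continued; a
    relation, since a tableau may have several descents. *)
Inductive scaled : syt -> K -> Prop :=
| Scaled0 S : (forall i, ~~ descent n_ge2 i S) -> scaled S 1
| ScaledS i S c : descent n_ge2 i S -> scaled (ssw i S) c ->
    scaled S (c * edge i (ssw i S)).

Lemma syt_ind (P : syt -> Prop) :
  (forall S, (forall i, descent n_ge2 i S -> P (ssw i S)) -> P S) -> forall S, P S.
Proof.
move=> IH S; have [m] := ubnP `|disorder n_ge2 S|%N; elim: m S => // m IHm S hS.
apply: IH => i ds; apply: IHm; have := disorder_swap ds.
have := disorder_ge0 n_ge2 S; have := disorder_ge0 n_ge2 (ssw i S); lia.
Qed.

Lemma scaled_total S : exists c, scaled S c.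
Proof.
elim/syt_ind: S => S IH.
case: (pselect (exists i, descent n_ge2 i S)) => [[i ds]|h].
  by have [c hc] := IH i ds; exists (c * edge i (ssw i S)); apply: ScaledS.
by exists 1; apply: Scaled0 => i; apply/negP => ds; apply: h; exists i.
Qed.

Lemma descent_range i S : descent n_ge2 i S -> (0 < i < n)%N.
Proof. by case/andP. Qed.

(** The square formed by two distant descents, closed by [b_comm]. *)
Lemma scaled_comm i j S a a' : (i.+1 < j)%N ->
  descent n_ge2 i S -> descent n_ge2 j S ->
  (forall Q c c', scaled Q c -> scaled Q c' -> (disorder n_ge2 Q < disorder n_ge2 S) -> c = c') ->
  scaled (ssw i S) a -> scaled (ssw j S) a' ->
  a * edge i (ssw i S) = a' * edge j (ssw j S).
Proof.
move=> ij di dj IH ha ha'.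
have hi := descent_range di; have hj := descent_range dj.
have i0 : (0 < i)%N by lia.
have ij' : (i.+1 < j < n)%N by lia.
have si := descent_sw di; have sj := descent_sw dj.
have [s1 s2 e g1 g2] := syt_swap_comm i0 ij' si sj.
have dj' : descent n_ge2 j (ssw i S) by move: dj; rewrite /descent g1.
have di' : descent n_ge2 i (ssw j S) by move: di; rewrite /descent g2.
have lti := disorder_swap di; have ltj := disorder_swap dj.
have [c hc] := scaled_total (ssw j (ssw i S)).
have -> : a = c * edge j (ssw j (ssw i S)) by apply: (IH (ssw i S)) => //; apply: ScaledS.
have -> : a' = c * edge i (ssw i (ssw j S)).
  by apply: (IH (ssw j S)) => //; apply: ScaledS => //; rewrite -e.
rewrite -!mulrA; congr (_ * _); rewrite -e.
set Q := ssw j (ssw i S).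
have ei : ssw i S = ssw j Q by rewrite /Q syt_swapK.
have ej : ssw j S = ssw i Q by rewrite /Q e syt_swapK.
have sQj : syt_swappable n_ge2 j Q by rewrite syt_swappableE syt_gap_swap // normrN -syt_swappableE.
have sQi : syt_swappable n_ge2 i Q by rewrite /Q e syt_swappableE syt_gap_swap // normrN -syt_swappableE.
have [_ _ _ k1 k2] := syt_swap_comm i0 ij' sQi sQj.
have bc := b_comm i0 ij' sQi sQj.
rewrite ei ej /edge k1 k2.
transitivity (b i Q * b j (ssw i Q) * ((be (sg i Q))^-1 * (be (sg j Q))^-1)); last by ring.
by rewrite bc; ring.
Qed.

(** The hexagon formed by two neighbouring descents, closed by [b_braid]. *)
Lemma scaled_braid i S a a' :
  descent n_ge2 i S -> descent n_ge2 i.+1 S ->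
  (forall Q c c', scaled Q c -> scaled Q c' -> (disorder n_ge2 Q < disorder n_ge2 S) -> c = c') ->
  scaled (ssw i S) a -> scaled (ssw i.+1 S) a' ->
  a * edge i (ssw i S) = a' * edge i.+1 (ssw i.+1 S).
Proof.
move=> di dj IH ha ha'.
have hi := descent_range di; have hj := descent_range dj.
have i0 : (0 < i)%N by lia.
have iS : (i.+1 < n)%N by lia.
have si := descent_sw di; have sj := descent_sw dj.
have gi : sg i S <= -2 by case/andP: di.
have gj : sg i.+1 S <= -2 by case/andP: dj.
have gle : sg i S + sg i.+1 S <= -2.
  by move: (sg i S) (sg i.+1 S) gi gj => x y; clear; lia.
have F : `|sg i S + sg i.+1 S| != 1.
  by move: (sg i S + _) gle => x; clear; lia.
have [[s1 s2 s3 s4] e g1 g2 [g3 g4]] := syt_swap_braid i0 iS si sj F.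
have d1 : descent n_ge2 i.+1 (ssw i S) by rewrite /descent g1 hj.
have d2 : descent n_ge2 i (ssw i.+1 S) by rewrite /descent g2 hi.
have d3 : descent n_ge2 i (ssw i.+1 (ssw i S)) by rewrite /descent g3 hi.
have d4 : descent n_ge2 i.+1 (ssw i (ssw i.+1 S)) by rewrite /descent g4 hj.
have lti := disorder_swap di; have ltj := disorder_swap dj.
set Q := ssw i (ssw i.+1 (ssw i S)) in e.
have [c hc] := scaled_total Q.
have -> : a = c * edge i Q * edge i.+1 (ssw i.+1 (ssw i S)).
  by apply: (IH (ssw i S)) => //; apply: ScaledS => //; apply: ScaledS.
have -> : a' = c * edge i.+1 Q * edge i (ssw i (ssw i.+1 S)).
  by apply: (IH (ssw i.+1 S)) => //; apply: ScaledS => //; rewrite e; apply: ScaledS; rewrite // -e.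
have q1 : ssw i.+1 (ssw i S) = ssw i Q by rewrite /Q syt_swapK.
have q2 : ssw i S = ssw i.+1 (ssw i Q) by rewrite -q1 syt_swapK.
have q3 : ssw i (ssw i.+1 S) = ssw i.+1 Q by rewrite e syt_swapK.
have q4 : ssw i.+1 S = ssw i (ssw i.+1 Q) by rewrite -q3 syt_swapK.
have sQi : syt_swappable n_ge2 i Q by rewrite syt_swappableE syt_gap_swap // normrN -syt_swappableE.
have sQj : syt_swappable n_ge2 i.+1 Q by rewrite e syt_swappableE syt_gap_swap // normrN -syt_swappableE.
have FQ : `|sg i Q + sg i.+1 Q| != 1.
  have -> : sg i Q = - sg i.+1 S by rewrite /Q syt_gap_swap // g3.
  have -> : sg i.+1 Q = - sg i S by rewrite e syt_gap_swap // g4.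
  by rewrite -opprD normrN addrC.
have [_ _ k1 k2 [k3 k4]] := syt_swap_braid i0 iS sQi sQj FQ.
have bb := b_braid i0 iS sQi sQj FQ.
rewrite q1 q2 q3 q4 -!(mulrA c); congr (c * _).
rewrite /edge k1 k2 k3 k4.
transitivity (b i Q * b i.+1 (ssw i Q) * b i (ssw i.+1 (ssw i Q)) *
  ((be (sg i Q))^-1 * (be (sg i Q + sg i.+1 Q))^-1 * (be (sg i.+1 Q))^-1)); first by ring.
by rewrite bb; ring.
Qed.

Lemma scaled_inv S c : scaled S c ->
  (c = 1 /\ forall i, ~~ descent n_ge2 i S) \/
  exists i a, [/\ descent n_ge2 i S, scaled (ssw i S) a & c = a * edge i (ssw i S)].
Proof. by case=> [S' h|i S' a di ha]; [left | right; exists i, a]. Qed.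

(** Two paths of descents from [S] are compared through the square or the hexagon of
    their first steps, and by induction on [disorder] further down. *)
Lemma scaled_fun S c c' : scaled S c -> scaled S c' -> c = c'.
Proof.
have [m] := ubnP `|disorder n_ge2 S|%N; elim: m S c c' => // m IHm S c c' hS.
have IH Q d d' : scaled Q d -> scaled Q d' -> (disorder n_ge2 Q < disorder n_ge2 S) -> d = d'.
  move=> hd hd' lt; apply: IHm hd hd'.
  by have := disorder_ge0 n_ge2 S; have := disorder_ge0 n_ge2 Q; lia.
case/scaled_inv=> [[-> nd]|[i [a [di ha ->]]]].
  by case/scaled_inv=> [[-> //]|[i [a [di _ _]]]]; have := nd i; rewrite di.
case/scaled_inv=> [[_ nd]|[j [a' [dj ha' ->]]]]; first by have := nd i; rewrite di.
case: (ltngtP i j) => ij.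
- case: (ltngtP i.+1 j) => ij'; first exact: scaled_comm.
    by lia.
  by move: dj ha'; rewrite -ij' => dj ha'; apply: scaled_braid.
- case: (ltngtP j.+1 i) => ij'; first by symmetry; apply: scaled_comm => //; exact: ij'.
    by lia.
  by move: di ha; rewrite -ij' => di ha; symmetry; apply: scaled_braid.
by move: ha'; rewrite -ij => ha'; rewrite (IH _ _ _ ha ha') // disorder_swap.
Qed.

Lemma scaled_neq0 S c : scaled S c -> c != 0.
Proof.
elim=> [S' _|i S' a di _ a0]; first exact: oner_neq0.
rewrite mulf_neq0 // edge_neq0 //; first exact: descent_range di.
have s := descent_sw di.
by rewrite syt_swappableE syt_gap_swap ?normrN -?syt_swappableE //; apply: descent_range di.
Qed.

Lemma rescaling : exists c : syt -> K, (forall S, c S != 0) /\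
  forall i S, (0 < i < n)%N -> syt_swappable n_ge2 i S -> c S * b i S = be (sg i S) * c (ssw i S).
Proof.
have [c hc] := choice scaled_total; exists c; split; first by move=> S; apply: scaled_neq0 (hc S).
move=> i S hi s.
suff e : c S * edge i S = c (ssw i S).
  by rewrite -e /edge; field; apply: beta_sw.
have s' : syt_swappable n_ge2 i (ssw i S) by rewrite syt_swappableE syt_gap_swap // normrN -syt_swappableE.
have := s; rewrite syt_swappableE => g1.
have [g|g] : sg i S <= -2 \/ 2 <= sg i S.
  by have : sg i S != 0 := gap_neq0 n_ge2 _ _; lia.
  have di : descent n_ge2 i S by rewrite /descent hi.
  have -> : c S = c (ssw i S) * edge i (ssw i S).
    by apply: scaled_fun (hc S) _; apply: ScaledS.
  by rewrite -mulrA [X in _ * X]mulrC edgeK // mulr1.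
have di : descent n_ge2 i (ssw i S) by rewrite /descent hi syt_gap_swap //=; lia.
symmetry; apply: scaled_fun (hc _) _.
by have := @ScaledS i (ssw i S) (c S) di; rewrite syt_swapK //; apply; apply: hc.
Qed.

End Coherence.

(** The affine Hecke algebra, given by an embedding into the double affine one, from
    which its relations are read off. *)
Record affine_sub (K : fieldType) (n : nat) (q t : K) (H : daha_alg n q t) := AffineSub {
  af_ring :> pzRingType;
  af_val : {rmorphism af_ring -> H};
  af_scal : {rmorphism K -> af_ring};
  af_T : nat -> af_ring;
  af_Y : nat -> af_ring;
  af_YV : nat -> af_ring;
  af_val_inj : injective af_val;
  af_valK : forall c, af_val (af_scal c) = alg_scal H c;
  af_valT : forall i, (0 < i < n)%N -> af_val (af_T i) = alg_T H i;
  af_valY : forall i, (0 < i <= n)%N -> af_val (af_Y i) = alg_Y H i;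
  af_valYV : forall i, (0 < i <= n)%N -> af_val (af_YV i) = alg_YV H i;
  af_ind : forall S : af_ring -> Prop, (forall c, S (af_scal c)) ->
    (forall a b, S a -> S b -> S (a - b)) -> (forall a b, S a -> S b -> S (a * b)) ->
    (forall i, (0 < i < n)%N -> S (af_T i)) -> (forall i, (0 < i <= n)%N -> S (af_Y i)) ->
    (forall i, (0 < i <= n)%N -> S (af_YV i)) -> forall a, S a
}.
Arguments af_val_inj {K n q t H _}.
Arguments af_valK {K n q t H _}.
Arguments af_valT {K n q t H _}.
Arguments af_valY {K n q t H _}.
Arguments af_valYV {K n q t H _}.
Arguments af_ind {K n q t H _}.

Section AffineRelations.
Variables (K : fieldType) (n : nat) (q t : K) (H : daha_alg n q t) (B : affine_sub H).
Local Notation sc := (af_scal B).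
Local Notation T := (af_T B).
Local Notation Y := (af_Y B).
Local Notation YV := (af_YV B).
Local Notation tau := (t - t^-1).

Lemma af_scalC c (b : B) : sc c * b = b * sc c.
Proof. by apply: af_val_inj; rewrite !rmorphM !af_valK alg_scalC. Qed.

Lemma af_quad i : (0 < i < n)%N -> T i * T i = 1 + sc tau * T i.
Proof.
by move=> hi; apply: af_val_inj; rewrite rmorphD !rmorphM rmorph1 af_valK !af_valT // alg_quad.
Qed.

Lemma af_braid i : (0 < i)%N -> (i.+1 < n)%N -> T i * T i.+1 * T i = T i.+1 * T i * T i.+1.
Proof.
move=> i0 iS; apply: af_val_inj; rewrite !rmorphM !af_valT ?alg_braid //; lia.
Qed.

Lemma af_TC i j : (0 < i)%N -> (i.+1 < j < n)%N -> T i * T j = T j * T i.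
Proof.
move=> i0 ij; apply: af_val_inj; rewrite !rmorphM !af_valT; try lia.
by apply: alg_TC; lia.
Qed.

Lemma af_YTi i : (0 < i < n)%N -> Y i * T i = (T i - sc tau) * Y i.+1.
Proof.
move=> hi; apply: af_val_inj; rewrite !rmorphM rmorphB af_valK af_valT // !af_valY; try lia.
exact: alg_YTi.
Qed.

Lemma af_YTSi i : (0 < i < n)%N -> Y i.+1 * T i = T i * Y i + sc tau * Y i.+1.
Proof.
move=> hi; apply: af_val_inj; rewrite rmorphD !rmorphM af_valK af_valT // !af_valY; try lia.
exact: alg_YTSi.
Qed.

Lemma af_YTC i j : (0 < i < n)%N -> (0 < j <= n)%N -> j != i -> j != i.+1 ->
  Y j * T i = T i * Y j.
Proof.
move=> hi hj ji jS; apply: af_val_inj; rewrite !rmorphM af_valT // !af_valY //.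
exact: alg_YTC.
Qed.

Lemma af_YVK i : (0 < i <= n)%N -> YV i * Y i = 1.
Proof. by move=> hi; apply: af_val_inj; rewrite rmorphM af_valYV // af_valY // alg_YVK rmorph1. Qed.

End AffineRelations.

Section WeightModules.
Variables (K : fieldType) (N k : nat) (q t : K).
Hypotheses (n_ge2 : (2 <= k * N)%N) (t_neq0 : t != 0).
Hypothesis t_nroot : forall m : nat, (0 < m)%N -> t ^+ m != 1.
Local Notation n := (k * N)%N.
Variables (H : daha_alg n q t) (B : affine_sub H).
Local Notation sc := (af_scal B).
Local Notation T := (af_T B).
Local Notation Y := (af_Y B).
Local Notation tau := (t - t^-1).
Local Notation sw := (psyt_swap n_ge2).
Local Notation ext := (psyt_of_syt n_ge2).
Local Notation dg := psyt_diag.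
Local Notation al D := (alpha t D).
Local Notation be D := (beta t D).

Section TShape.
Variables (E : lmodType B) (J : eqType) (kap : J -> psyt N k) (v : J -> E).
Hypotheses (kap_inj : injective kap) (fv : free_family sc v) (sv : spanning sc v).
Hypothesis vY : forall i j, (0 < i <= n)%N -> Y i *: v j = sc (t ^ (2 * dg (kap j) i%:Z)) *: v j.

Lemma diag_weight_inj (R R' : psyt N k) :
  (forall i, (0 < i <= n)%N -> t ^ (2 * dg R i%:Z) = t ^ (2 * dg R' i%:Z)) -> R = R'.
Proof.
move=> h; apply: (diag_inj_ord n_ge2) => i; apply: (weight_inj t_neq0 t_nroot).
by apply: h; have := ltn_ord i; lia.
Qed.

(** The intertwining property of [T_i - alpha], from Bernstein's relations. *)
Lemma intertwine i j m : (0 < i < n)%N -> (0 < m <= n)%N ->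
  let x := T i *: v j - sc (al (gap i%:Z (kap j))) *: v j in
  Y m *: x = sc (t ^ (2 * dg (kap j) (zswap n i%:Z m%:Z))) *: x.
Proof.
move=> hi hm x; have hi' : (0 < i <= n)%N by lia.
have hi1 : (0 < i.+1 <= n)%N by lia.
set z := fun e : int => t ^ (2 * dg (kap j) e).
have aw : al (gap i%:Z (kap j)) * z i%:Z = (al (gap i%:Z (kap j)) - tau) * z (i%:Z + 1).
  exact: (alpha_weight t_neq0 t_nroot (diag_neq1 n_ge2 _ _)).
have iS : i.+1%:Z = i%:Z + 1 by lia.
set a := al _ in aw x *; rewrite /x scalerBr.
have YZ : Y m *: (sc a *: v j) = sc (a * z m%:Z) *: v j.
  by rewrite scalerA -af_scalC -scalerA vY // scalerA -(rmorphM sc).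
have TZ e : T i *: (sc e *: v j) = sc e *: (T i *: v j).
  by rewrite !scalerA af_scalC.
have ZZ e e' (y : E) : sc e *: (sc e' *: y) = sc (e * e') *: y.
  by rewrite scalerA -(rmorphM sc).
rewrite YZ scalerA; case: (eqVneq m i) => [mi|mi].
  rewrite mi af_YTi // -scalerA vY // scalerBl TZ iS -/(z _) zswap_l.
  rewrite scalerBr !ZZ -addrA -opprD -scalerDl -(rmorphD sc) -/(z _).
  congr (_ + _); rewrite -!scaleNr -!(rmorphN sc); congr (sc _ *: _).
  by rewrite aw; ring.
case: (eqVneq m i.+1) => [mS|mS].
  rewrite mS af_YTSi // scalerDl -!scalerA !vY // TZ iS -!/(z _) zswap_r //.
  rewrite scalerBr !ZZ -addrA -scalerBl -(rmorphB sc) -/(z _); congr (_ + _).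
  rewrite -!scaleNr -!(rmorphN sc); congr (sc _ *: _).
  rewrite (_ : - (z i%:Z * a) = - (a * z i%:Z)); last by ring.
  by rewrite aw; ring.
rewrite af_YTC // -scalerA vY // TZ zswap_id.
- by rewrite scalerBr -/(z _) ZZ (mulrC a).
- by apply: not_dvd_small => //; lia.
- by apply: not_dvd_small => //; lia.
Qed.

(** By [intertwine], [(T_i - alpha) v_j] is a simultaneous eigenvector, hence zero or
    a multiple of a basis vector. *)
Lemma T_eigen i j : (0 < i < n)%N ->
  T i *: v j = sc (al (gap i%:Z (kap j))) *: v j \/
  exists j' c, [/\ c != 0, forall e, dg (kap j') e = dg (kap j) (zswap n i%:Z e)
    & T i *: v j = sc (al (gap i%:Z (kap j))) *: v j + sc c *: v j'].
Proof.
move=> hi; set x := T i *: v j - sc (al (gap i%:Z (kap j))) *: v j.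
have Tx : T i *: v j = sc (al (gap i%:Z (kap j))) *: v j + x by rewrite addrC subrK.
pose I := {m : nat | (0 < m <= n)%N}.
have := @eigenvector_basis K B sc J E v fv sv (@af_scalC _ _ _ _ _ B)
  I (fun m => Y (sval m)) (fun j m => t ^ (2 * dg (kap j) (sval m)%:Z)).
have h1 j1 (m : I) : Y (sval m) *: v j1 = sc (t ^ (2 * dg (kap j1) (sval m)%:Z)) *: v j1.
  by apply: vY; apply: (svalP m).
have h2 j1 j2 : (fun m : I => t ^ (2 * dg (kap j1) (sval m)%:Z)) =1
    (fun m : I => t ^ (2 * dg (kap j2) (sval m)%:Z)) -> j1 = j2.
  move=> e; apply: kap_inj; apply: diag_weight_inj => m hm.
  exact: (e (exist _ m hm)).
move=> /(_ h1 h2 (fun m => t ^ (2 * dg (kap j) (zswap n i%:Z (sval m)%:Z))) x).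
case=> [m|x0|[j' [c [wj c0 ex]]]].
- by apply: intertwine => //; apply: (svalP m).
- by left; rewrite Tx x0 addr0.
right; exists j', c; split=> //; last by rewrite -ex.
move=> e; have [m [a ->]] := entry_reduce n_ge2 e.
rewrite zswap_period // !diag_period //; congr (_ + _).
have hm : (0 < m.+1 <= n)%N by have := ltn_ord m; lia.
exact: (weight_inj t_neq0 t_nroot (wj (exist _ m.+1 hm))).
Qed.

(** The weight that the second term would have belongs to no tableau. *)
Lemma T_unswappable i j : (0 < i < n)%N -> ~~ swappable (kap j) i%:Z ->
  T i *: v j = sc (al (gap i%:Z (kap j))) *: v j.
Proof.
move=> hi ns; have [//|[j' [c [_ d _]]]] := T_eigen j hi.
by case: (not_swappable n_ge2 ns d).
Qed.

Lemma free_neq0 j c : sc c *: v j = 0 -> c = 0.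
Proof.
move=> e; apply: (fv (s := [:: j]) (c := fun=> c)) => //; last by rewrite inE.
by rewrite big_seq1.
Qed.

(** If the second term were zero, [alpha] would be a root of the quadratic relation,
    against [beta_neq0]. *)
Lemma T_swappable i j : (0 < i < n)%N -> swappable (kap j) i%:Z ->
  exists j' c, kap j' = sw i%:Z (kap j) /\
    T i *: v j = sc (al (gap i%:Z (kap j))) *: v j + sc c *: v j'.
Proof.
move=> hi s; have [e|[j' [c [_ d e]]]] := T_eigen j hi; last first.
  exists j', c; split=> //; apply: (diag_inj n_ge2) => x.
  by rewrite d diag_swap.
exfalso; set D := gap _ _ in e.
have D0 : D != 0 := gap_neq0 n_ge2 _ _.
have : 1 + tau * al D - al D ^+ 2 = 0.
  have TZ c (x : E) : T i *: (sc c *: x) = sc c *: (T i *: x).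
    by rewrite !scalerA af_scalC.
  have := congr1 (fun a => a *: v j) (af_quad B hi).
  rewrite scalerDl scale1r -!scalerA !e TZ e !scalerA -!(rmorphM sc) => e2.
  apply: (@free_neq0 j); rewrite (rmorphB sc) (rmorphD sc) rmorph1 scalerBl scalerDl scale1r.
  by rewrite -e2 expr2 subrr.
rewrite -(betaM t_neq0 t_nroot D0) => /eqP; rewrite mulf_eq0.
rewrite (negbTE (beta_neq0 t_neq0 t_nroot D0 s)) /= => /eqP b0.
have := beta_neq0 t_neq0 t_nroot (_ : - D != 0); rewrite b0 eqxx oppr_eq0 normrN.
by move=> h; have := h D0 s.
Qed.

End TShape.

Definition seminormal_syt (E : lmodType B) (v : syt N k -> E) : Prop :=
  (forall i S, (0 < i <= n)%N -> Y i *: v S = sc (t ^ (2 * dg (ext S) i%:Z)) *: v S) /\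
  (forall i S, (0 < i < n)%N -> T i *: v S = sc (al (syt_gap n_ge2 i S)) *: v S
     + sc (be (syt_gap n_ge2 i S)) *: v (syt_swap n_ge2 i S)).

Section NormalForm.
Variables (E : lmodType B) (v : syt N k -> E) (chi : syt N k -> E -> K).
Local Notation ssw := (syt_swap n_ge2).
Local Notation sg := (syt_gap n_ge2).
Hypothesis chiD : forall S x y, chi S (x + y) = chi S x + chi S y.
Hypothesis chiZ : forall S c x, chi S (sc c *: x) = c * chi S x.
Hypothesis chiv : forall S S', chi S (v S') = (S == S')%:R.
Hypothesis vY : forall i S, (0 < i <= n)%N -> Y i *: v S = sc (t ^ (2 * dg (ext S) i%:Z)) *: v S.
Hypothesis vT : forall i S, (0 < i < n)%N -> exists c, T i *: v S = sc (al (sg i S)) *: v S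
  + sc c *: v (ssw i S) /\ (~~ syt_swappable n_ge2 i S -> c = 0).

Lemma syt_swap_neq i S : (0 < i < n)%N -> syt_swappable n_ge2 i S -> (ssw i S == S) = false.
Proof.
move=> hi s; apply/eqP => e; have := syt_gap_swap hi s; rewrite e => h.
have : sg i S != 0 := gap_neq0 n_ge2 _ _; lia.
Qed.

(** The hypotheses of [rescaling] are the quadratic, commutation and braid relations
    applied to [v_S]: one compares the coefficient of the tableau reached by all the
    exchanges, which occurs once on either side, and the coefficient of [S] for the
    quadratic relation. *)
Lemma normal_form : exists c : syt N k -> K, (forall S, c S != 0) /\
  seminormal_syt (fun S => sc (c S) *: v S).
Proof.
have hb : exists b : nat -> syt N k -> K, forall i S, (0 < i < n)%N ->
    T i *: v S = sc (al (sg i S)) *: v S + sc (b i S) *: v (ssw i S)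
    /\ (~~ syt_swappable n_ge2 i S -> b i S = 0).
  have /choice[f hf] : forall p : nat * syt N k, exists c, (0 < p.1 < n)%N ->
      T p.1 *: v p.2 = sc (al (sg p.1 p.2)) *: v p.2 + sc c *: v (ssw p.1 p.2)
      /\ (~~ syt_swappable n_ge2 p.1 p.2 -> c = 0).
    move=> [i S] /=; case: (boolP (0 < i < n)%N) => hi; last by exists 0.
    by have [c hc] := vT S hi; exists c.
  by exists (fun i S => f (i, S)) => i S; apply: (hf (i, S)).
have [b /= {}hb] := hb.
have TE i S (hi : (0 < i < n)%N) := proj1 (hb i S hi).
have TZ i c (x : E) : T i *: (sc c *: x) = sc c *: (T i *: x).
  by rewrite !scalerA af_scalC.
have [|||c [c0 hc]] := @rescaling K N k t n_ge2 t_neq0 t_nroot b.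
- move=> i S hi s; have := congr1 (fun a => chi S (a *: v S)) (af_quad B hi) => /=.
  rewrite scalerDl -!scalerA scale1r !TE // scalerDr !TZ !TE // !(chiD, chiZ, chiv).
  rewrite syt_swapK // !eqxx (eq_sym S) syt_swap_neq // !(mulr0, mulr1, addr0, add0r) => e.
  rewrite (betaM t_neq0 t_nroot (gap_neq0 n_ge2 _ _)) -/(sg i S).
  by apply/eqP; rewrite -subr_eq0; apply/eqP; rewrite -[0](subrr (1 + tau * al (sg i S))) -{1}e; ring.
- move=> i j S i0 ij si sj; have hi : (0 < i < n)%N by lia.
  have hj : (0 < j < n)%N by lia.
  have [s1 s2 e g1 g2] := syt_swap_comm i0 ij si sj.
  have := congr1 (fun a => chi (ssw j (ssw i S)) (a *: v S)) (af_TC B i0 ij) => /=.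
  rewrite -!scalerA !TE // !scalerDr !TZ !TE // !(chiD, chiZ, chiv) -e eqxx.
  have n1 : (ssw j (ssw i S) == ssw i S) = false by apply: syt_swap_neq.
  have n2 : (ssw j (ssw i S) == ssw j S) = false by rewrite e; apply: syt_swap_neq.
  have n3 : (ssw j (ssw i S) == S) = false.
    apply/eqP => f; have f' : ssw i S = ssw j S by rewrite -{2}f syt_swapK.
    have := syt_gap_swap hi si; rewrite f' g2 => h.
    have : sg i S != 0 := gap_neq0 n_ge2 _ _; lia.
  by rewrite n1 n2 n3 !(mulr0, mulr1, addr0, add0r).
- move=> i S i0 iS si sj F; have hi : (0 < i < n)%N by lia.
  have hj : (0 < i.+1 < n)%N by lia.
  have [[s1 s2 s3 s4] e g1 g2 [g3 g4]] := syt_swap_braid i0 iS si sj F.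
  set Q := ssw i (ssw i.+1 (ssw i S)) in e *.
  have := congr1 (fun a => chi Q (a *: v S)) (af_braid B i0 iS) => /=.
  rewrite -!scalerA !TE // !scalerDr !TZ !TE // !scalerDr !TZ !TE //.
  rewrite !(chiD, chiZ, chiv) !syt_swapK // -/Q -e eqxx.
  have n1 : (Q == ssw i.+1 (ssw i S)) = false by apply: syt_swap_neq.
  have n2 : (Q == ssw i (ssw i.+1 S)) = false by rewrite e; apply: syt_swap_neq.
  have nij : ssw i S = ssw i.+1 S -> False.
    move=> f; have h1 := syt_gap_swap hi si; have h2 := syt_gap_swap hj sj.
    rewrite f g2 in h1; rewrite -f g1 in h2.
    by have : sg i S != 0 := gap_neq0 n_ge2 _ _; move: h1 h2; clear; lia.
  have n3 : (Q == ssw i S) = false.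
    apply/eqP => f; apply: nij.
    have := congr1 (ssw i) f; rewrite /Q !syt_swapK // => f'.
    by rewrite -[RHS](congr1 (ssw i.+1) f') syt_swapK.
  have n4 : (Q == ssw i.+1 S) = false.
    apply/eqP => f; apply: nij.
    have := congr1 (ssw i.+1) f; rewrite e !syt_swapK // => f'.
    by rewrite -[LHS](congr1 (ssw i) f') syt_swapK.
  have n5 : (Q == S) = false.
    apply/eqP => f; have := congr1 (ssw i) f; rewrite /Q syt_swapK // => /eqP.
    by rewrite syt_swap_neq.
  by rewrite n1 n2 n3 n4 n5 !(mulr0, mulr1, addr0, add0r) !mulrA.
exists c; split=> //; split=> i S hi.
  by rewrite scalerA -af_scalC -scalerA vY // !scalerA -!rmorphM mulrC.
rewrite TZ TE // scalerDr !scalerA -!rmorphM (mulrC (c S)); congr (_ + sc _ *: _).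
case: (boolP (syt_swappable n_ge2 i S)) => s; first exact: hc.
rewrite (proj2 (hb i S hi) s) mulr0.
by move: s; rewrite syt_swappableE negbK /beta => ->; rewrite mul0r.
Qed.

End NormalForm.

End WeightModules.

(** * The grading of the induced module *)

Lemma gen_residue n : (2 <= n)%N -> forall i, exists2 j, (0 < j <= n)%N & i = j %[mod n].
Proof.
move=> n_ge2 i.
case: (eqVneq (i %% n)%N 0%N) => e; first by exists n; [lia | rewrite e modnn].
have h : (i %% n < n)%N by rewrite ltn_mod; lia.
by exists (i %% n)%N; [lia | rewrite modn_mod].
Qed.

Section Filtration.
Variables (K : fieldType) (n : nat) (q t : K) (H : daha_alg n q t).
Hypotheses (n_ge2 : (2 <= n)%N) (q_neq0 : q != 0).

Local Notation sc := (alg_scal H).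
Local Notation T := (alg_T H).
Local Notation Y := (alg_Y H).
Local Notation YV := (alg_YV H).
Local Notation Pi := (alg_Pi H).
Local Notation PiV := (alg_PiV H).
Local Notation tau := (t - t^-1).
Local Notation Tinv := (alg_Tinv H).

(** The minimal representatives of the cosets of the subgroup of the symmetric group
    that fixes the first letter. *)
Fixpoint Tdown (j : nat) : H := if j is j'.+1 then T j * Tdown j' else 1.

Lemma Tdown_far i j : (j.+1 < i < n)%N -> T i * Tdown j = Tdown j * T i.
Proof.
elim: j => [|j IH] hi /=; first by rewrite mulr1 mul1r.
rewrite mulrA -(alg_TC j.+1 i); try lia.
by rewrite -!mulrA IH //; lia.
Qed.

Lemma Tdown_lt i j : (0 < i < j)%N -> (j < n)%N -> T i * Tdown j = Tdown j * T i.+1.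
Proof.
elim: j => [|j IH] hi hj /=; first by lia.
case: (eqVneq i j) => [ij|ij]; last first.
  rewrite mulrA (alg_TC i j.+1); try lia.
  by rewrite -!mulrA IH //; lia.
case: j ij {IH} hi hj => [|j] ij hi hj; first by lia.
rewrite ij /= !mulrA alg_braid // -!mulrA Tdown_far //; last by lia.
Qed.

Section Sets.
Variables (M : lmodType H) (P0 : M -> Prop).

(** The subspaces that are submodules over the affine Hecke algebra, here without
    reference to that algebra as a ring. *)
Record stable (P : M -> Prop) : Prop := Stable {
  st0 : P 0;
  stD : forall x y, P x -> P y -> P (x + y);
  stZ : forall c x, P x -> P (sc c *: x);
  stT : forall i x, (0 < i < n)%N -> P x -> P (T i *: x);
  stY : forall i x, (0 < i <= n)%N -> P x -> P (Y i *: x);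
  stYV : forall i x, (0 < i <= n)%N -> P x -> P (YV i *: x)
}.

Hypothesis stP0 : stable P0.
Hypothesis Y1P0 : forall x, P0 x -> Y 1 *: x = x.

Lemma st_sum P I (r : seq I) (F : I -> M) : stable P -> (forall i, P (F i)) ->
  P (\sum_(i <- r) F i).
Proof. by move=> sP h; apply: (big_ind P) => //; [exact: st0 | exact: stD]. Qed.

Lemma st_Tinv P i x : stable P -> (0 < i < n)%N -> P x -> P (Tinv i *: x).
Proof.
move=> sP hi Px; rewrite /alg_Tinv scalerBl -scaleNr -rmorphN.
by apply: stD => //; [apply: stT | apply: stZ].
Qed.

(** The product of the affine Hecke algebra, [Pi] and the stable subspace [P], written
    with the coset representatives [T_j ... T_1]. *)
Definition raised (P : M -> Prop) (x : M) : Prop := exists u : 'I_n -> M,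
  (forall j, P (u j)) /\ x = \sum_(j < n) Tdown j *: (Pi *: u j).

Lemma raised_op P (Q : M -> Prop) (a : H) x : stable Q -> raised P x ->
  (forall j u, (j < n)%N -> P u -> Q (a *: (Tdown j *: (Pi *: u)))) -> Q (a *: x).
Proof.
move=> sP [u [hu ->]] h; rewrite scaler_sumr; apply: st_sum => // j.
by apply: h.
Qed.

Lemma raised_Tdown P j u : stable P -> (j < n)%N -> P u ->
  raised P (Tdown j *: (Pi *: u)).
Proof.
move=> sP hj pu; exists (fun i : 'I_n => if i == j :> nat then u else 0); split.
  by move=> i; case: eqP => _ //; apply: st0.
rewrite (bigD1 (Ordinal hj)) //= eqxx big1 ?addr0 // => i ne.
by rewrite -val_eqE /= in ne; rewrite (negbTE ne) !scaler0.
Qed.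

Lemma raised_Pi P u : stable P -> P u -> raised P (Pi *: u).
Proof. by move=> sP pu; have := raised_Tdown sP (ltnW n_ge2) pu; rewrite /= scale1r. Qed.

Lemma TPi i (x : M) : T i.+1 *: (Pi *: x) = Pi *: (T i *: x).
Proof. by rewrite !scalerA alg_PiT. Qed.

Lemma raised_lin P : stable P ->
  [/\ raised P 0, forall y z, raised P y -> raised P z -> raised P (y + z)
    & forall c y, raised P y -> raised P (sc c *: y)].
Proof.
move=> sP; split.
- exists (fun _ => 0); split=> [j|]; first exact: st0.
  by rewrite big1 // => j _; rewrite !scaler0.
- move=> y z [u [hu ->]] [w [hw ->]]; exists (fun j => u j + w j).
  by split=> [j|]; [apply: stD | rewrite -big_split; apply: eq_bigr => j _; rewrite !scalerDr].
move=> c y [u [hu ->]]; exists (fun j => sc c *: u j); split=> [j|]; first exact: stZ.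
by rewrite scaler_sumr; apply: eq_bigr => j _; rewrite !scalerA alg_scalC -!mulrA alg_scalC.
Qed.

(** [T_i] permutes the cosets up to the quadratic relation, and what it leaves on the
    right of the representative passes through [Pi] into [P]. *)
Lemma raised_T P i x : stable P -> (0 < i < n)%N -> raised P x ->
  raised P (T i *: x).
Proof.
move=> sP hi px.
have [P0' PD PZ] := raised_lin sP.
case: px => u [hu ->]; rewrite scaler_sumr; apply: (big_ind (raised P)) => // j _.
have pu := hu j; move: (u j) pu => v pv; have hj := ltn_ord j; move: (j : nat) hj => m hm.
case: (ltngtP i m) => im.
- rewrite scalerA Tdown_lt; try lia.
  rewrite -scalerA TPi; apply: raised_Tdown => //; exact: stT.
- case: (ltngtP i m.+1) => im'; first by lia.
  + rewrite scalerA Tdown_far; try lia.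
    rewrite -scalerA -[i]prednK; last by lia.
    by rewrite TPi; apply: raised_Tdown => //; apply: stT => //; lia.
  + by rewrite im' scalerA -/(Tdown m.+1); apply: raised_Tdown => //; lia.
case: m im hm => [|m] im hm; first by lia.
rewrite im /= scalerA mulrA alg_quad mulrDl mul1r -mulrA -/(Tdown m.+1) scalerDl -scalerA.
apply: PD; first by apply: raised_Tdown => //; lia.
by apply: PZ; apply: raised_Tdown.
Qed.

(** Bernstein's relations reduce [Y_i T_j ... T_1 Pi] to the case [j = 0], where
    [Y_i Pi] is [Pi Y_{i-1}] or [q Pi Y_n]. *)
Lemma raised_stable P : stable P -> stable (raised P).
Proof.
move=> sP.
have [p0 pD pZ] := raised_lin sP.
have pT := raised_T sP.
have pTinv i x : (0 < i < n)%N -> raised P x -> raised P (Tinv i *: x).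
  move=> hi px; rewrite /alg_Tinv scalerBl -scaleNr -rmorphN.
  by apply: pD; [apply: pT | apply: pZ].
(* the passage from [x] to [T_j x] for the operators [Y_i] and their inverses *)
have stepY j x : (0 < j < n)%N -> raised P x ->
    (forall i, (0 < i <= n)%N -> raised P (Y i *: x)) ->
    forall i, (0 < i <= n)%N -> raised P (Y i *: (T j *: x)).
  move=> hj px h i hi; rewrite scalerA; case: (eqVneq i j) => [->|ij].
    rewrite alg_YTi // -scalerA; apply: pTinv => //; apply: h; lia.
  case: (eqVneq i j.+1) => [->|iSj].
    rewrite alg_YTSi // scalerDl -!scalerA; apply: pD; first by apply: pT => //; apply: h; lia.
    by apply: pZ; apply: h; lia.
  by rewrite alg_YTC // -scalerA; apply: pT => //; apply: h.
have stepYV j x : (0 < j < n)%N -> raised P x ->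
    (forall i, (0 < i <= n)%N -> raised P (YV i *: x)) ->
    forall i, (0 < i <= n)%N -> raised P (YV i *: (T j *: x)).
  move=> hj px h i hi; rewrite scalerA; case: (eqVneq i j) => [->|ij].
    rewrite alg_YVTi // scalerDl -!scalerA; apply: pD; first by apply: pT => //; apply: h; lia.
    by apply: pZ; apply: h; lia.
  case: (eqVneq i j.+1) => [->|iSj].
    by rewrite alg_YVTSi // -scalerA; apply: pTinv => //; apply: h; lia.
  by rewrite alg_YVTC // -scalerA; apply: pT => //; apply: h.
have baseY u : P u -> forall i, (0 < i <= n)%N -> raised P (Y i *: (Pi *: u)).
  move=> pu [//|[|i]] hi.
    have -> : Y 1 *: (Pi *: u) = sc q *: (Pi *: (Y n *: u)).
      by rewrite !scalerA -mulrA alg_PiYn !mulrA -rmorphM mulfV // rmorph1 mul1r.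
    by apply: pZ; apply: raised_Pi => //; apply: stY => //; lia.
  rewrite scalerA -alg_PiY; last by lia.
  by rewrite -scalerA; apply: raised_Pi => //; apply: stY => //; lia.
have baseYV u : P u -> forall i, (0 < i <= n)%N -> raised P (YV i *: (Pi *: u)).
  move=> pu [//|[|i]] hi.
    have -> : YV 1 *: (Pi *: u) = sc q^-1 *: (Pi *: (YV n *: u)).
      by rewrite !scalerA -mulrA alg_PiYVn // !mulrA -rmorphM mulVf // rmorph1 mul1r.
    by apply: pZ; apply: raised_Pi => //; apply: stYV => //; lia.
  rewrite scalerA -alg_PiYV; last by lia.
  by rewrite -scalerA; apply: raised_Pi => //; apply: stYV => //; lia.
have downY j u : (j < n)%N -> P u -> forall i, (0 < i <= n)%N ->
    raised P (Y i *: (Tdown j *: (Pi *: u))).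
  elim: j => [|j IH] hj pu i hi; first by rewrite scale1r; apply: baseY.
  rewrite /= -(scalerA (T j.+1)); apply: stepY => //.
    by apply: raised_Tdown => //; apply: ltnW.
  by apply: IH => //; apply: ltnW.
have downYV j u : (j < n)%N -> P u -> forall i, (0 < i <= n)%N ->
    raised P (YV i *: (Tdown j *: (Pi *: u))).
  elim: j => [|j IH] hj pu i hi; first by rewrite scale1r; apply: baseYV.
  rewrite /= -(scalerA (T j.+1)); apply: stepYV => //.
    by apply: raised_Tdown => //; apply: ltnW.
  by apply: IH => //; apply: ltnW.
split=> // i x hi [u [hu ->]]; rewrite scaler_sumr; apply: (big_ind (raised P)) => // j _.
  exact: downY.
exact: downYV.
Qed.

(** The degree filtration of an induced module: [Pi] raises the degree by one. *)
Definition piece (d : nat) : M -> Prop := iter d raised P0.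

Lemma piece_stable d : stable (piece d).
Proof. by elim: d => [|d IH]; [exact: stP0 | exact: raised_stable]. Qed.

(** In degree [0] it vanishes, as [Y_1] acts there by [1].  On a basis vector of [L(k^N)] it lowers all
    the entries by one, with a coefficient that vanishes when [1] is on the
    diagonal [0]. *)
Definition lowering : H := PiV * (Y 1 - 1).

Lemma PiVT i : PiV * T i.+1 = T i * PiV.
Proof.
by rewrite -[LHS]mulr1 -(@alg_PiK _ _ _ _ H) mulrA -(mulrA _ (T _)) -alg_PiT !mulrA alg_PiVK mul1r.
Qed.

Lemma lowering_T j : (0 < j)%N -> (j.+1 < n)%N -> lowering * T j.+1 = T j * lowering.
Proof.
move=> j0 jn; rewrite /lowering -mulrA mulrBl mul1r alg_YTC; try lia.
by rewrite -[X in _ - X]mulr1 -mulrBr !mulrA PiVT.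
Qed.

(** The commutation that is not homogeneous: it passes [lowering] through [T_1 Pi],
    at the cost of a term without [lowering], which has the right degree. *)
Lemma lowering_T1 : lowering * T 1 * Pi = Pi * Tinv n.-1 * lowering - sc tau.
Proof.
have T0 : T n = T 0 by apply: alg_T_mod; rewrite modnn mod0n.
have e1 : PiV * (T 1 * Pi) = T 0 by rewrite -alg_PiT mulrA alg_PiVK mul1r.
have e2 : PiV * (Tinv 1 * Pi) = Tinv 0.
  by rewrite /alg_Tinv mulrBl mulrBr e1 alg_scalC mulrA alg_PiVK mul1r.
have e3 : Pi * Tinv n.-1 = Tinv 0 * Pi.
  by rewrite /alg_Tinv mulrBr alg_PiT prednK ?(ltnW n_ge2) // T0 -alg_scalC mulrBl.
transitivity (Tinv 0 * Y 1 - T 0).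
  rewrite /lowering -!mulrA (mulrBl _ (Y 1)) mul1r mulrBr e1; congr (_ - _).
  by rewrite (mulrA (Y 1)) alg_YTi // -(mulrA (Tinv 1)) -alg_PiY // !mulrA -(mulrA PiV) e2.
rewrite e3 /lowering -(mulrA _ Pi) (mulrA Pi PiV) alg_PiK mul1r (mulrBr (Tinv 0)) mulr1.
by rewrite -addrA -opprD; congr (_ - _); rewrite /alg_Tinv subrK.
Qed.

Lemma lowering0 x : P0 x -> lowering *: x = 0.
Proof. by move=> px; rewrite -scalerA scalerBl scale1r Y1P0 // subrr scaler0. Qed.

(** [lowering] passes through [T_j ... T_2] by [lowering_T], and then through
    [T_1 Pi] by [lowering_T1]. *)
Lemma lowering_Tdown d u j : piece d u ->
  piece d (Pi *: (Tinv n.-1 *: (lowering *: u))) -> (j < n)%N ->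
  piece d (lowering *: (Tdown j *: (Pi *: u))).
Proof.
move=> pu h; have sP := piece_stable d; case: j => [|j].
  move=> _; rewrite /= scale1r /lowering scalerA -mulrA mulrBl mul1r mulrBr alg_PiVK.
  rewrite scalerBl scale1r -scaleN1r -(rmorphN1 sc).
  apply: stD => //; last exact: stZ.
  have -> : (PiV * (Y 1 * Pi)) *: u = sc q *: (Y n *: u).
    have -> : Y 1 * Pi = sc q * (Pi * Y n).
      by rewrite alg_PiYn !mulrA -rmorphM mulfV // rmorph1 mul1r.
    by rewrite mulrA -alg_scalC -mulrA (mulrA PiV) alg_PiVK mul1r scalerA.
  by apply: stZ => //; apply: stY => //; lia.
elim: j => [|j IH] hj.
  rewrite /= mulr1 !scalerA lowering_T1 scalerBl -(scalerA _ lowering) -(scalerA Pi).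
  by rewrite -scaleNr -(rmorphN sc); apply: stD => //; apply: stZ.
rewrite /= -(scalerA (T j.+2)) scalerA lowering_T // -scalerA.
by apply: stT => //; [lia | apply: IH; lia].
Qed.

Lemma lowering_piece d x : piece d.+1 x -> piece d (lowering *: x).
Proof.
elim: d x => [|d IH] x px; apply: (raised_op (piece_stable _) px) => j u hj pu.
  apply: lowering_Tdown => //; rewrite lowering0 // !scaler0.
  exact: (st0 (piece_stable 0)).
apply: lowering_Tdown => //; apply: raised_Pi; first exact: piece_stable.
by apply: st_Tinv; [exact: piece_stable | lia | exact: IH].
Qed.

(** For [m = n] this is central in the affine Hecke algebra, and [Pi] multiplies its
    eigenvalues by [q]: so it separates the degrees. *)
Fixpoint Yprod (m : nat) : H := if m is m'.+1 then Yprod m' * Y m else 1.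

Lemma YY_T i : (0 < i < n)%N -> T i * (Y i * Y i.+1) = Y i * Y i.+1 * T i.
Proof.
move=> hi; transitivity (Y i.+1 * (Tinv i * Y i.+1)).
  by rewrite [RHS]mulrA -{2}(alg_TY i hi) -(mulrA (T i * Y i)) alg_TK mulr1 mulrA.
by rewrite -alg_YTi // mulrA (alg_YC i.+1).
Qed.

Lemma Yprod_T i m : (0 < i < n)%N -> (m <= n)%N -> m != i -> T i * Yprod m = Yprod m * T i.
Proof.
move=> hi; elim/ltn_ind: m => -[|m] IH hm mi /=; first by rewrite mulr1 mul1r.
case: (eqVneq m i) => [e|ne]; last first.
  rewrite mulrA IH //; last exact: ltnW.
  rewrite -!mulrA alg_TYC //; lia.
case: m e IH hm mi => [|m] e IH hm mi; first by lia.
rewrite /= !mulrA IH; try lia.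
by rewrite -!mulrA; congr (_ * _); rewrite e YY_T // mulrA.
Qed.

Lemma Y1_Pi_Yprod m : (m < n)%N -> Y 1 * (Pi * Yprod m) = Yprod m.+1 * Pi.
Proof.
elim: m => [|m IH] hm; first by rewrite /= mulr1 mul1r.
rewrite [Yprod m.+1]/= (mulrA Pi) (mulrA (Y 1)) IH; last exact: ltnW.
by rewrite -mulrA alg_PiY ?mulrA //; lia.
Qed.

Lemma YprodC i m : Y i * Yprod m = Yprod m * Y i.
Proof.
by elim: m => [|m IH] /=; rewrite ?mulr1 ?mul1r // mulrA IH -!mulrA alg_YC.
Qed.

Lemma Yprod_Pi : Yprod n * Pi = sc q * (Pi * Yprod n).
Proof.
have n1 : (n.-1 < n)%N by lia.
have nS : n.-1.+1 = n by lia.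
have e : Yprod n = Y n * Yprod n.-1.
  by have := erefl (Yprod n.-1.+1); rewrite {2}/Yprod -/Yprod nS YprodC.
have := Y1_Pi_Yprod n1; rewrite nS => <-.
rewrite e (mulrA Pi) alg_PiYn !mulrA -rmorphM mulfV // rmorph1 mul1r.
by [].
Qed.

Lemma Yprod_Tdown j : (j < n)%N -> Yprod n * Tdown j = Tdown j * Yprod n.
Proof.
elim: j => [|j IH] hj /=; first by rewrite mulr1 mul1r.
rewrite mulrA -Yprod_T //; last by lia.
by rewrite -!mulrA IH // ltnW.
Qed.

Lemma Yprod_piece (kappa : K) : (forall x, P0 x -> Yprod n *: x = sc kappa *: x) ->
  forall d x, piece d x -> Yprod n *: x = sc (kappa * q ^+ d) *: x.
Proof.
move=> h0; elim=> [|d IH] x; first by rewrite mulr1; apply: h0.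
move=> [u [hu ->]]; rewrite !scaler_sumr; apply: eq_bigr => j _.
rewrite scalerA Yprod_Tdown // -scalerA (scalerA (Yprod n)) Yprod_Pi.
rewrite -!scalerA (IH _ (hu j)) !scalerA; congr (_ *: _).
by rewrite -(alg_scalC (kappa * q ^+ d)) -(alg_scalC q) exprSr !(mulrA, rmorphM).
Qed.

Definition graded (x : M) : Prop := exists D (f : nat -> M),
  (forall d, piece d (f d)) /\ x = \sum_(d < D) f d.

Lemma graded_stable : stable graded.
Proof.
have op (a : H) : (forall d x, piece d x -> piece d (a *: x)) ->
    forall x, graded x -> graded (a *: x).
  move=> ha x [D [f [hf ->]]]; exists D, (fun d => a *: f d).
  by split=> [d|]; [apply: ha | rewrite scaler_sumr].
split.
- exists 0%N, (fun _ => 0); split=> [d|]; first exact: st0 (piece_stable d).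
  by rewrite big_ord0.
- move=> x y [D [f [hf ->]]] [D' [g [hg ->]]].
  pose tr (D : nat) (f : nat -> M) d := if (d < D)%N then f d else 0.
  exists (D + D')%N, (fun d => tr D f d + tr D' g d); split=> [d|].
    apply: stD (piece_stable d) _ _ _ _; rewrite /tr; case: ifP => _ //;
      exact: st0 (piece_stable d).
  have trE (D1 D2 : nat) (h : nat -> M) : (D1 <= D2)%N -> \sum_(d < D1) h d = \sum_(d < D2) tr D1 h d.
    move=> le; rewrite (big_ord_widen _ h le) big_mkcond /=.
    by apply: eq_bigr => d _; rewrite /tr.
  by rewrite (trE D (D + D')%N) ?leq_addr // (trE D' (D + D')%N) ?leq_addl // -big_split.
- by move=> c; apply: op => d x; apply: stZ (piece_stable d) _ _.
- by move=> i x hi; apply: op => d y; apply: stT (piece_stable d) _ _ hi.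
- by move=> i x hi; apply: op => d y; apply: stY (piece_stable d) _ _ hi.
- by move=> i x hi; apply: op => d y; apply: stYV (piece_stable d) _ _ hi.
Qed.

Lemma graded_Pi x : graded x -> graded (Pi *: x).
Proof.
move=> [D [f [hf ->]]]; exists D.+1, (fun d => if d is d'.+1 then Pi *: f d' else 0).
split=> [[|d]|]; first exact: st0 (piece_stable 0).
  exact: raised_Pi (piece_stable d) (hf d).
by rewrite big_ord_recl add0r scaler_sumr.
Qed.

Lemma graded_lowering x : graded x -> graded (lowering *: x).
Proof.
move=> [[|D] [f [hf ->]]].
  by rewrite big_ord0 scaler0; apply: st0 graded_stable.
exists D, (fun d => lowering *: f d.+1); split=> [d|]; first exact: lowering_piece.
by rewrite big_ord_recl scalerDr lowering0 ?add0r ?scaler_sumr; last exact: (hf 0).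
Qed.

(** [Pi^-1] does not preserve the graded part, but a power of [Pi] brings any element
    back into it. *)
Definition covered (x : M) : Prop := exists m : nat, graded (Pi ^+ m *: x).

Lemma graded_PiX m x : graded x -> graded (Pi ^+ m *: x).
Proof.
by move=> gx; elim: m => [|m IH]; rewrite ?scale1r // exprS -scalerA; apply: graded_Pi.
Qed.

Lemma PiX_T m i : Pi ^+ m * T i = T (i + m) * Pi ^+ m.
Proof.
elim: m => [|m IH]; first by rewrite addn0 mulr1 mul1r.
by rewrite exprS -mulrA IH mulrA alg_PiT addnS -mulrA.
Qed.

Lemma PiX_Y m i : (0 < i <= n)%N -> exists c j, (0 < j <= n)%N /\
  Pi ^+ m * Y i = sc c * (Y j * Pi ^+ m).
Proof.
move=> hi; elim: m => [|m [c [j [hj IH]]]].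
  by exists 1, i; split=> //; rewrite mulr1 rmorph1 !mul1r.
case: (eqVneq j n) => [jn|jn].
  exists (c * q^-1), 1%N; split; first by lia.
  rewrite exprS -mulrA IH jn mulrA -alg_scalC -mulrA (mulrA Pi) alg_PiYn.
  by rewrite rmorphM !mulrA.
exists c, j.+1; split; first by lia.
rewrite exprS -mulrA IH mulrA -alg_scalC -mulrA (mulrA Pi) alg_PiY; last by lia.
by rewrite !mulrA.
Qed.

Lemma PiX_YV m i : (0 < i <= n)%N -> exists c j, (0 < j <= n)%N /\
  Pi ^+ m * YV i = sc c * (YV j * Pi ^+ m).
Proof.
move=> hi; elim: m => [|m [c [j [hj IH]]]].
  by exists 1, i; split=> //; rewrite mulr1 rmorph1 !mul1r.
case: (eqVneq j n) => [jn|jn].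
  exists (c * q), 1%N; split; first by lia.
  rewrite exprS -mulrA IH jn mulrA -alg_scalC -mulrA (mulrA Pi) alg_PiYVn //.
  by rewrite rmorphM !mulrA.
exists c, j.+1; split; first by lia.
rewrite exprS -mulrA IH mulrA -alg_scalC -mulrA (mulrA Pi) alg_PiYV; last by lia.
by rewrite !mulrA.
Qed.

Lemma covered_add y z : covered y -> covered z -> covered (y + z).
Proof.
move=> [m gy] [m' gz]; exists (m + m')%N; rewrite scalerDr; apply: stD; first exact: graded_stable.
  by rewrite addnC exprD -scalerA; apply: graded_PiX.
by rewrite exprD -scalerA; apply: graded_PiX.
Qed.

(** The powers of [Pi] normalise the generators up to scalars, so an element can be
    moved past [Pi^m] into the part where the generators act. *)
Lemma covered_alg (a : H) x : covered x -> covered (a *: x).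
Proof.
have gs := graded_stable.
have cY i y : covered y -> covered (Y i *: y).
  have [j hj /alg_Y_mod ->] := gen_residue n_ge2 i.
  move=> [m gy]; exists m; have [c [j' [hj' e]]] := PiX_Y m hj.
  by rewrite scalerA e -!scalerA; apply: stZ => //; apply: stY.
have cYV i y : covered y -> covered (YV i *: y).
  have [j hj /alg_YV_mod ->] := gen_residue n_ge2 i.
  move=> [m gy]; exists m; have [c [j' [hj' e]]] := PiX_YV m hj.
  by rewrite scalerA e -!scalerA; apply: stZ => //; apply: stYV.
have cT i y : covered y -> covered (T i *: y).
  (* one more shift when [i + m] is the residue of [T_0], which does not preserve
     the degrees *)
  move=> [m gy]; have [m' hm' [l lm]] : exists2 m', (m <= m')%N & exists l,
      (0 < l < n)%N /\ i + m' = l %[mod n].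
    case: (eqVneq ((i + m) %% n)%N 0%N) => e.
      exists m.+1 => //; exists 1%N; split; first by lia.
      by rewrite addnS -addn1 -modnDml e add0n.
    exists m => //; exists ((i + m) %% n)%N; rewrite modn_mod; split=> //.
    by have : ((i + m) %% n < n)%N by [rewrite ltn_mod; lia]; lia.
  exists m'; rewrite scalerA PiX_T (alg_T_mod _ _ (proj2 lm)) -scalerA.
  apply: stT => //; first exact: (proj1 lm).
  by rewrite -(subnK hm') exprD -scalerA; apply: graded_PiX.
move: a x; apply: alg_ind => [x cx|a b ha hb x cx|c x cx|a b ha hb x cx|i x|x cx|x cx|i x|i x].
- by exists 0%N; rewrite scale0r scaler0; apply: st0.
- by rewrite scalerDl; apply: covered_add; [apply: ha | apply: hb].
- case: cx => m gx; exists m; rewrite scalerA -alg_scalC -scalerA; exact: stZ.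
- by rewrite -scalerA; apply: ha; apply: hb.
- exact: cT.
- case: cx => m gx; exists m; rewrite scalerA -exprSr exprS -scalerA; exact: graded_Pi.
- case: cx => m gx; exists m.+1; rewrite scalerA exprSr -mulrA alg_PiK mulr1; exact: gx.
- exact: cY.
- exact: cYV.
Qed.

End Sets.
End Filtration.

(** * Quotient modules and induced modules *)

Section Submodules.
Variables (A : pzRingType) (M : lmodType A).

Lemma submodule_closed (P : M -> Prop) : is_submodule P ->
  exists J : submodClosed M, forall x, x \in J <-> P x.
Proof.
move=> sP; exists (span_gen P : submodClosed M) => x; split=> [/span_genP|px]; first exact.
by apply/span_genP => J _; apply.
Qed.

Lemma closed_submodule (J : submodClosed M) : is_submodule (fun x => x \in J).
Proof. by split=> [|a x y xJ yJ]; [exact: rpred0 | apply: rpredD; [exact: rpredZ|]]. Qed.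

Lemma submodD (P : M -> Prop) x y : is_submodule P -> P x -> P y -> P (x + y).
Proof. by case=> P0 PL px py; rewrite -[x]scale1r; apply: PL. Qed.

Lemma submodZ (P : M -> Prop) a x : is_submodule P -> P x -> P (a *: x).
Proof. by case=> P0 PL px; rewrite -[X in P X]addr0; apply: PL. Qed.

Lemma simple_submodule (P : M -> Prop) : simple_module M -> is_submodule P ->
  (exists2 x, P x & x <> 0) -> forall x, P x.
Proof.
move=> [_ sM] sP [x px x0]; have [J JP] := submodule_closed sP.
by case: (sM J) => h y; [case: x0; apply/h/JP | apply/JP/h].
Qed.

End Submodules.

Section Quotients.
Variables (A : pzRingType) (M : lmodType A) (J : submodClosed M).

Lemma mod_proj0 x : mod_proj J x = 0 <-> x \in J.
Proof.
rewrite -(linear0 (mod_proj J)) -[X in X \in _]subr0 mod_projP.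
by split=> [->|/eqP].
Qed.

(** The submodules of the quotient are those of [M] that contain [J]. *)
Lemma simple_quot (x0 : M) : x0 \notin J ->
  (forall P : M -> Prop, is_submodule P -> (exists2 x, P x & x \notin J) -> forall x, P x) ->
  simple_module (quot_mod J).
Proof.
move=> x0J h; split.
  by exists (mod_proj J x0); apply/eqP => /mod_proj0; rewrite (negbTE x0J).
move=> Q; case: (pselect (exists2 x, mod_proj J x \in Q & x \notin J)) => [ex|nex].
  right=> y; rewrite -[y]mod_repK; apply: (h (fun x => mod_proj J x \in Q)) => //.
  split=> [|a x z xQ zQ]; first by rewrite linear0 rpred0.
  by rewrite linearP rpredD // rpredZ.
left=> y; rewrite -[y]mod_repK => yQ; apply/mod_proj0; apply: contrapT => /negP yJ.
by apply: nex; exists (mod_rep y).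
Qed.

Lemma simple_quot_max (P : M -> Prop) : simple_module (quot_mod J) -> is_submodule P ->
  (forall x, x \in J -> P x) -> (exists2 x, P x & x \notin J) -> forall x, P x.
Proof.
move=> sQ sP JP [x px xJ] y.
pose Q (u : quot_mod J) := exists2 z, P z & u = mod_proj J z.
have : Q (mod_proj J y).
  apply: (simple_submodule sQ).
    split=> [|a u v [z pz ->] [z' pz' ->]]; first by exists 0; [case: sP | rewrite linear0].
    by exists (a *: z + z'); rewrite ?linearP //; apply: (proj2 sP).
  exists (mod_proj J x); first by exists x.
  by move/mod_proj0; rewrite (negbTE xJ).
case=> z pz /eqP; rewrite -mod_projP => /JP pyz.
by rewrite -[y](subrK z); apply: submodD.
Qed.

Lemma quot_isomorphic (L : lmodType A) (f : {linear M -> L}) :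
  (forall y, exists x, f x = y) -> (forall x, f x = 0 <-> x \in J) ->
  isomorphic (quot_mod J) L.
Proof.
move=> fs fJ; have fE x : f (mod_rep (mod_proj J x)) = f x.
  apply/eqP; rewrite -subr_eq0 -linearB; apply/eqP/fJ.
  by rewrite mod_projP mod_repK.
pose g (y : quot_mod J) := f (mod_rep y).
have gl : linear g.
  move=> a y z; rewrite /g -{1}[y]mod_repK -{1}[z]mod_repK -linearP fE.
  by rewrite linearP.
pose mx := GRing.isLinear.Build A (quot_mod J) L *:%R g gl.
pose G : {linear quot_mod J -> L} := HB.pack g mx.
exists G; have [s hs] := choice fs; exists (fun y => mod_proj J (s y)) => y.
  rewrite /= -[RHS]mod_repK; apply/eqP; rewrite -mod_projP; apply/fJ.
  by rewrite linearB hs subrr.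
by rewrite /= /g fE hs.
Qed.

End Quotients.

Section Induced.
Variables (A B : pzRingType) (f : {rmorphism B -> A}) (W : lmodType B).
Local Notation tens := (tensor f 1).

Lemma tensorE a (w : W) : tensor f a w = a *: tens w.
Proof.
rewrite /tensor -[RHS](linearZ_LR (mod_proj _)); congr mod_proj.
by apply/malgP => x; rewrite free_scaleE !mcoeffU mulrnAr mulr1.
Qed.

Lemma tensorD (w w' : W) : tens (w + w') = tens w + tens w'.
Proof.
apply/eqP; rewrite -subr_eq0 opprD addrA -!(raddfB (mod_proj _)); apply/eqP/mod_proj0.
by apply/span_genP => J _; apply; apply: TensorD.
Qed.

Lemma tensorB b (w : W) : f b *: tens w = tens (b *: w).
Proof.
have <- : tensor f (1 * f b) w = tens (b *: w); last by rewrite mul1r [RHS]tensorE.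
apply/eqP; rewrite -subr_eq0 -(raddfB (mod_proj _)); apply/eqP/mod_proj0.
by apply/span_genP => J _; apply; apply: TensorM.
Qed.

Lemma tensor0 : tens (0 : W) = 0.
Proof. by rewrite -(scale0r 0) -tensorB rmorph0 scale0r. Qed.

Lemma induced_ind (P : induced f W -> Prop) : P 0 ->
  (forall x y, P x -> P y -> P (x + y)) -> (forall a w, P (a *: tens w)) -> forall x, P x.
Proof.
move=> P0 PD PT x; rewrite -[x]mod_repK.
rewrite [mod_rep x](@monalgE _ A (mod_rep x : {malg A[W]})) raddf_sum.
by apply: big_ind => // w _; have := PT (mcoeff w (mod_rep x : {malg A[W]})) w; rewrite -tensorE.
Qed.

(** The universal property of the induced module: extend [g] to the free module and
    check the relations of the tensor product. *)
Lemma induced_map (L : lmodType A) (g : W -> L) :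
  (forall x y, g (x + y) = g x + g y) -> (forall b x, g (b *: x) = f b *: g x) ->
  exists h : {linear induced f W -> L}, forall w, h (tens w) = g w.
Proof.
move=> gD gB; pose G (x : free_mod A W) := free_ext g x.
have GB : {morph G : x y / x - y} := free_extB g.
have G0 : G 0 = 0 by rewrite -(subrr 0) GB subrr.
have GD x y : G (x + y) = G x + G y.
  by rewrite -{1}[y]opprK GB -[- y]sub0r GB G0 sub0r opprK.
have GU a w : G (free_elt a w) = a *: g w := free_extU g a w.
have GZ a x : G (a *: x) = a *: G x.
  rewrite [in LHS](@monalgE _ A (x : {malg A[W]})) scaler_sumr (big_morph G GD G0).
  rewrite [RHS]scaler_sumr; apply: eq_bigr => w _; rewrite [RHS]scalerA -GU; congr G.
  by apply/malgP => z; rewrite [LHS]free_scaleE !mcoeffU mulrnAr.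
have GK x y : mod_proj (span_gen (@tensor_rel B A f W)) x = mod_proj _ y -> G x = G y.
  move/eqP; rewrite -mod_projP => /span_genP/(_ (fun z => G z = 0)) e.
  apply/eqP; rewrite -subr_eq0 -GB; apply/eqP/e.
    by split=> // a u v hu hv; rewrite GD GZ hu hv scaler0 addr0.
  move=> s [a w w'|a b w]; rewrite !GB !GU ?gD ?gB ?scalerA ?subrr //.
  by rewrite scalerDr addrAC addrK subrr.
pose h (y : induced f W) := G (mod_rep y).
have hE x : h (mod_proj _ x) = G x by apply: GK; rewrite mod_repK.
have hl : linear h.
  move=> a y z; rewrite /h -{1}[y]mod_repK -{1}[z]mod_repK -linearP [LHS]hE.
  by rewrite GD GZ.
pose mx := GRing.isLinear.Build A (induced f W) L *:%R h hl.
pose F : {linear induced f W -> L} := HB.pack h mx.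
exists F => w; apply: (etrans (hE _)); by rewrite GU scale1r.
Qed.

End Induced.

(** * Maps from the inflated module *)

Section Restriction.
Variables (K : fieldType) (N k : nat) (q t : K).
Hypotheses (n_ge2 : (2 <= k * N)%N) (t_neq0 : t != 0).
Hypothesis t_nroot : forall m : nat, (0 < m)%N -> t ^+ m != 1.
Local Notation n := (k * N)%N.
Variables (H : daha_alg n q t) (B : affine_sub H).
Local Notation sc := (alg_scal H).
Local Notation scB := (af_scal B).
Local Notation dg := psyt_diag.
Local Notation ext := (psyt_of_syt n_ge2).
Local Notation infl := (inflation (af_val B)).

Section Elements.
Variable L : lmodType H.

Lemma infl_scal c (x : L) : scB c *: (x : infl L) = sc c *: x.
Proof. exact: (congr1 (fun a => a *: x) (@af_valK _ _ _ _ _ B c)). Qed.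

Lemma infl_T i (x : L) : (0 < i < n)%N -> af_T B i *: (x : infl L) = alg_T H i *: x.
Proof. by move=> hi; exact: (congr1 (fun a => a *: x) (@af_valT _ _ _ _ _ B i hi)). Qed.

Lemma infl_Y i (x : L) : (0 < i <= n)%N -> af_Y B i *: (x : infl L) = alg_Y H i *: x.
Proof. by move=> hi; exact: (congr1 (fun a => a *: x) (@af_valY _ _ _ _ _ B i hi)). Qed.

Lemma infl_free (I : eqType) (v : I -> L) : free_family sc v ->
  free_family scB (v : I -> infl L).
Proof.
move=> fv s c us e; apply: fv us _; rewrite -[RHS]e.
by apply: eq_bigr => i _; rewrite infl_scal.
Qed.

Lemma infl_spanning (I : eqType) (v : I -> L) : spanning sc v ->
  spanning scB (v : I -> infl L).
Proof.
move=> sv x; have [r e] := sv x; exists r; rewrite [LHS]e.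
by apply: eq_bigr => p _; rewrite infl_scal.
Qed.

End Elements.

(** The tableaux of shape [(k^N)] are closed under the exchanges with [0 < i < n], so
    the corresponding weight vectors can be rescaled among themselves. *)
Lemma restriction_form (L : lmodType H) (u : psyt N k -> L) :
  free_family sc u -> spanning sc u ->
  (forall i R, (0 < i <= n)%N -> alg_Y H i *: u R = sc (t ^ (2 * dg R i%:Z)) *: u R) ->
  exists c, (forall S, c S != 0) /\
    seminormal_syt n_ge2 (fun S => scB (c S) *: (u (ext S) : infl L)).
Proof.
move=> fu su uY; have fu' := infl_free fu; have su' := infl_spanning su.
have [chi [chiD chiZ chiv]] := coordinates fu' su'.
have uY' i R : (0 < i <= n)%N ->
    af_Y B i *: (u R : infl L) = scB (t ^ (2 * dg R i%:Z)) *: (u R : infl L).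
  by move=> hi; rewrite infl_Y // uY // infl_scal.
apply: (@normal_form K N k q t n_ge2 t_neq0 t_nroot H B (infl L)
  (fun S => u (ext S)) (fun S => chi (ext S))).
- by move=> S x y; exact: chiD.
- by move=> S c x; exact: chiZ.
- by move=> S S'; rewrite chiv (inj_eq (@psyt_of_syt_inj _ _ _)).
- by move=> i S hi; exact: uY'.
move=> i S hi; case: (boolP (syt_swappable n_ge2 i S)) => s.
  have [R [c [/= -> e]]] := T_swappable n_ge2 t_neq0 t_nroot (kap := id)
    (fun _ _ => id) fu' su' uY' hi s.
  by exists c; rewrite syt_swapE.
exists 0; rewrite rmorph0 scale0r addr0; split=> //.
exact: (T_unswappable n_ge2 t_neq0 t_nroot (kap := id) (fun _ _ => id) fu' su' uY' hi s).
Qed.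

Lemma seminormal_restriction (F : lmodType H) (v : psyt N k -> F) : seminormal n_ge2 v ->
  seminormal_syt n_ge2 (fun S => v (ext S) : infl F).
Proof.
case=> _ vT vY _ _; split=> i S hi; first by rewrite infl_Y // vY // infl_scal.
by rewrite infl_T // vT // !infl_scal syt_swapE.
Qed.

(** The seminormal form determines the action of the generators on the basis. *)
Lemma seminormal_map (E E' : lmodType B) (v : syt N k -> E) (v' : syt N k -> E') :
  free_family scB v -> spanning scB v -> seminormal_syt n_ge2 v -> seminormal_syt n_ge2 v' ->
  exists g : E -> E', [/\ forall x y, g (x + y) = g x + g y,
    forall b x, g (b *: x) = b *: g x & forall S, g (v S) = v' S].
Proof.
move=> fv sv [vY vT] [vY' vT'].
have [g [gD gZ gv]] := linear_extension fv sv v'.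
exists g; split=> //.
have gB x y : g (x - y) = g x - g y.
  by rewrite -scaleN1r -(rmorphN1 scB) gD gZ rmorphN1 scaleN1r.
have on_basis b : (forall S, g (b *: v S) = b *: v' S) -> forall x, g (b *: x) = b *: g x.
  move=> h x; have [r ->] := sv x; rewrite /combination.
  have g0 : g 0 = 0 by rewrite -(subrr 0) gB subrr.
  rewrite scaler_sumr !(big_morph g gD g0) scaler_sumr.
  by apply: eq_bigr => p _; rewrite scalerA -af_scalC -scalerA !gZ h gv !scalerA af_scalC.
have gY i : (0 < i <= n)%N -> forall x, g (af_Y B i *: x) = af_Y B i *: g x.
  by move=> hi; apply: on_basis => S; rewrite vY // gZ gv vY'.
apply: af_ind => [c x|a b ha hb x|a b ha hb x|i hi|i hi x|i hi x].
- exact: gZ.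
- by rewrite !scalerBl gB ha hb.
- by rewrite -!scalerA ha hb.
- by apply: on_basis => S; rewrite vT // gD !gZ !gv vT'.
- exact: gY.
have YK : af_Y B i * af_YV B i = 1.
  by apply: af_val_inj; rewrite rmorphM af_valYV // af_valY // alg_YK rmorph1.
by rewrite -[LHS]scale1r -(af_YVK B hi) -[LHS]scalerA -gY // scalerA YK scale1r.
Qed.

End Restriction.

(** * The simple quotient *)

Section ContentProduct.
Variables (K : fieldType) (N k : nat) (t : K).
Hypothesis n_ge2 : (2 <= k * N)%N.
Local Notation n := (k * N)%N.
Local Notation dg := psyt_diag.
Local Notation ext := (psyt_of_syt n_ge2).

(** The entry [1] lies in the corner, so [Y_1] acts by [1]: the quotient of the affine
    Hecke algebra by [Y_1 = 1] is the finite one. *)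
Lemma diag_first (S : syt N k) : dg (ext S) 1 = 0.
Proof.
have n0 : (0 < n)%N by apply: ltnW.
rewrite (@diag_of_syt N k n_ge2 S (Ordinal n0)) /syt_diag.
case e : (syt_box S (Ordinal n0)) => [j m] /=.
have e0 : syt_entry S (j, m) = Ordinal n0 by rewrite -e syt_boxK.
have [h1 h2] : (m = 0 :> nat) /\ (j = 0 :> nat); last by rewrite h1 h2.
split; apply/eqP; rewrite -leqn0 leqNgt; apply/negP => lt.
  by have := @syt_row _ _ S j (Ordinal (k_pos n_ge2)) m lt; rewrite e0.
by have := @syt_col _ _ S (Ordinal (N_pos n_ge2)) j m lt; rewrite e0.
Qed.

(** The scalar by which the central element [Y_1 ... Y_n] acts, a product over the
    boxes and so the same for all the tableaux. *)
Definition content_prod : K := \prod_(b : 'I_N * 'I_k) t ^ (2 * (b.2%:Z - b.1%:Z)).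

Lemma content_prodE (S : syt N k) : \prod_(i < n) t ^ (2 * dg (ext S) i.+1%:Z) = content_prod.
Proof.
rewrite (reindex (syt_entry S)) /=; last first.
  by exists (syt_box S) => x _; [exact: syt_entryK | exact: syt_boxK].
by apply: eq_bigr => b _; rewrite diag_of_syt /syt_diag syt_entryK.
Qed.

End ContentProduct.

Section SimpleQuotient.
Variables (K : fieldType) (N k : nat) (q t : K).
Hypotheses (n_ge2 : (2 <= k * N)%N) (t_neq0 : t != 0) (q_neq0 : q != 0).
Hypothesis t_nroot : forall m : nat, (0 < m)%N -> t ^+ m != 1.
Hypothesis q_nroot : forall m : nat, (0 < m)%N -> q ^+ m != 1.
Local Notation n := (k * N)%N.
Variables (H : daha_alg n q t) (B : affine_sub H).
Variables (W : lmodType B) (w : syt N k -> W).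
Local Notation sc := (alg_scal H).
Local Notation scB := (af_scal B).
Local Notation Y := (alg_Y H).
Local Notation T := (alg_T H).
Local Notation Pi := (alg_Pi H).
Local Notation dg := psyt_diag.
Local Notation ext := (psyt_of_syt n_ge2).
Local Notation infl := (inflation (af_val B)).
Local Notation M := (induced (af_val B) W).
Local Notation tens := (tensor (af_val B) (1 : H)).

Hypotheses (W_simple : simple_module W) (fw : free_family scB w) (sw : spanning scB w).
Hypothesis wY : forall i S, (0 < i <= n)%N ->
  af_Y B i *: w S = scB (t ^ (2 * dg (ext S) i%:Z)) *: w S.

Definition bottom (x : M) : Prop := exists y, x = tens y.

Lemma bottom_stable : stable bottom.
Proof.
split.
- by exists 0; rewrite tensor0.
- by move=> x y [a ->] [b ->]; exists (a + b); rewrite tensorD.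
- by move=> c x [a ->]; exists (scB c *: a); rewrite -tensorB af_valK.
- by move=> i x hi [a ->]; exists (af_T B i *: a); rewrite -tensorB af_valT.
- by move=> i x hi [a ->]; exists (af_Y B i *: a); rewrite -tensorB af_valY.
- by move=> i x hi [a ->]; exists (af_YV B i *: a); rewrite -tensorB af_valYV.
Qed.

Lemma bottom_span (a : H) (c : K) : (forall S, a *: tens (w S) = sc c *: tens (w S)) ->
  forall x, bottom x -> a *: x = sc c *: x.
Proof.
move=> h _ [y ->]; have [r ->] := sw y; rewrite /combination.
rewrite (big_morph _ (@tensorD _ _ _ _) (tensor0 _ _)) !scaler_sumr.
apply: eq_bigr => p _; rewrite -tensorB af_valK scalerA -alg_scalC -scalerA h.
by rewrite !scalerA alg_scalC.
Qed.

Lemma bottom_Y1 x : bottom x -> Y 1 *: x = x.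
Proof.
have h1 : (0 < 1 <= n)%N by lia.
move=> bx; rewrite (@bottom_span _ 1 _ _ bx) ?rmorph1 ?scale1r // => S.
by rewrite -(@af_valY _ _ _ _ _ B _ h1) tensorB wY // diag_first mulr0 expr0z !rmorph1 !scale1r.
Qed.

Lemma Yprod_weight (L : lmodType H) (x : L) (z : nat -> K) m :
  (forall i, (0 < i <= m)%N -> Y i *: x = sc (z i) *: x) ->
  Yprod H m *: x = sc (\prod_(i < m) z i.+1) *: x.
Proof.
elim: m => [|m IH] h; first by rewrite big_ord0 rmorph1.
rewrite big_ord_recr /= -scalerA h; last by lia.
rewrite scalerA -alg_scalC -scalerA IH => [|i hi]; last by apply: h; lia.
by rewrite scalerA -rmorphM mulrC.
Qed.

Lemma bottom_Yprod x : bottom x -> Yprod H n *: x = sc (content_prod N k t) *: x.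
Proof.
apply: bottom_span => S; rewrite (@Yprod_weight _ _ (fun i => t ^ (2 * dg (ext S) i%:Z))).
  by rewrite content_prodE.
move=> i hi; rewrite -(@af_valY _ _ _ _ _ B _ hi) tensorB wY //.
by rewrite -tensorB af_valK.
Qed.

Lemma M_covered (x : M) : covered bottom x.
Proof.
have c0 y : bottom y -> covered bottom y.
  move=> by_; exists 0%N, 1%N, (fun d => if d is 0 then y else 0); split=> [[|d]|] //.
    exact: (st0 (piece_stable n_ge2 q_neq0 bottom_stable d.+1)).
  by rewrite big_ord1 scale1r.
elim/induced_ind: x => [|x y|a y].
- by apply: c0; exists 0; rewrite tensor0.
- by apply: (covered_add n_ge2 q_neq0 bottom_stable).
by apply: (covered_alg n_ge2 q_neq0 bottom_stable); apply: c0; exists y.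
Qed.

(** The inducing module is simple, and it generates [M]. *)
Lemma bottom_generates (P : M -> Prop) : is_submodule P ->
  (exists2 x, P x & bottom x /\ x <> 0) -> forall x, P x.
Proof.
move=> sP [x px [[y e] x0]]; rewrite e in px x0.
have allW : forall y, P (tens y).
  apply: (simple_submodule (P := fun y => P (tens y)) W_simple).
    split=> [|b u u' pu pu']; first by rewrite tensor0; case: sP.
    by rewrite tensorD -tensorB; apply: (proj2 sP).
  by exists y => // y0; apply: x0; rewrite y0 tensor0.
apply: induced_ind => [|u u' pu pu'|a u]; first by case: sP.
  exact: submodD.
exact: submodZ.
Qed.

Section Image.
Variables (F : lmodType H) (v : psyt N k -> F) (h : {linear M -> F}).
Hypothesis v_sn : seminormal n_ge2 v.
Hypothesis hw : forall S, exists2 c, c != 0 & h (tens (w S)) = sc c *: v (ext S).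

Lemma v_neq0 R c : c != 0 -> sc c *: v R <> 0.
Proof.
move=> c0 e; case/eqP: c0; apply: (sn_free v_sn (s := [:: R]) (c := fun=> c)) => //.
  by rewrite big_seq1.
by rewrite inE.
Qed.

Definition in_span (y : F) : Prop := exists r, y = combination sc v r.

Lemma span_v R : in_span (v R).
Proof. by exists [:: (1, R)]; rewrite /combination big_seq1 rmorph1 scale1r. Qed.

Lemma span_add y z : in_span y -> in_span z -> in_span (y + z).
Proof. by move=> [r ->] [r' ->]; exists (r ++ r'); rewrite combination_cat. Qed.

Lemma span_scal c y : in_span y -> in_span (sc c *: y).
Proof. by move=> [r ->]; exists (scale_comb c r); rewrite combination_scale. Qed.

Lemma span_alg (a : H) y : in_span y -> in_span (a *: y).
Proof.
have on_v (b : H) : (forall R, in_span (b *: v R)) -> forall y, in_span y -> in_span (b *: y).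
  move=> hb _ [r ->]; rewrite /combination scaler_sumr.
  apply: big_ind => [||p _]; [by exists [::]; rewrite /combination big_nil | exact: span_add |].
  by rewrite scalerA -alg_scalC -scalerA; apply: span_scal.
have hPi := on_v Pi; have hPiV := on_v (alg_PiV H).
have {}hPi z : in_span z -> in_span (Pi *: z).
  by apply: hPi => R; rewrite (sn_Pi v_sn); apply: span_v.
have {}hPiV z : in_span z -> in_span (alg_PiV H *: z).
  by apply: hPiV => R; rewrite (sn_PiV v_sn); apply: span_v.
have hT i z : (0 < i < n)%N -> in_span z -> in_span (T i *: z).
  move=> hi; apply: on_v => R; rewrite (sn_T v_sn) //.
  by apply: span_add; apply: span_scal; apply: span_v.
move: a y; apply: alg_ind => [y _|a b ha hb y sy|c y|a b ha hb y sy|i y sy|||i y sy|i].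
- by exists [::]; rewrite scale0r /combination big_nil.
- by rewrite scalerDl; apply: span_add; [apply: ha | apply: hb].
- exact: span_scal.
- by rewrite -scalerA; apply: ha; apply: hb.
- have [j hj /alg_T_mod ->] := gen_residue n_ge2 i.
  case: (ltngtP j n) => jn; [by apply: hT => //; lia | by lia |].
  have -> : T j = Pi * T n.-1 * alg_PiV H.
    by rewrite alg_PiT -mulrA alg_PiK mulr1 jn prednK // ltnW.
  by rewrite -!scalerA; apply: hPi; apply: hT; [lia | apply: hPiV].
- exact: hPi.
- exact: hPiV.
- have [j hj /alg_Y_mod ->] := gen_residue n_ge2 i.
  apply: on_v sy => R; rewrite (sn_Y v_sn) //; exact: span_scal (span_v R).
have [j hj /alg_YV_mod ->] := gen_residue n_ge2 i.
apply: on_v => R; set z := t ^ (2 * dg R j%:Z).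
have z0 : z != 0 by apply: expfz_neq0.
have -> : alg_YV H j *: v R = sc z^-1 *: v R.
  rewrite -[in RHS](scale1r (v R)) -(alg_YVK j) -scalerA (sn_Y v_sn) // -/z.
  by rewrite (scalerA (alg_YV H j)) -alg_scalC -scalerA scalerA -rmorphM mulVf // rmorph1 scale1r.
exact: span_scal (span_v R).
Qed.

Lemma image_span x : in_span (h x).
Proof.
elim/induced_ind: x => [|x y hx hy|a y].
- by exists [::]; rewrite linear0 /combination big_nil.
- by rewrite linearD; apply: span_add.
rewrite linearZ; apply: span_alg; have [r ->] := sw y; rewrite /combination.
rewrite (big_morph _ (@tensorD _ _ _ _) (tensor0 _ _)) linear_sum.
apply: big_ind => [||p _]; [by exists [::]; rewrite /combination big_nil | exact: span_add |].
rewrite -tensorB af_valK linearZ; apply: span_scal; have [c _ ->] := hw p.2.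
exact: span_scal (span_v _).
Qed.

(** The moves of [reach_fundamental] are realised by [Pi], by [T_i - alpha] and by
    [lowering], each with a nonzero coefficient. *)
Lemma climb (S : F -> Prop) :
  (forall x y, S x -> S y -> S (x + y)) -> (forall c x, S x -> S (sc c *: x)) ->
  (forall i x, (0 < i < n)%N -> S x -> S (T i *: x)) ->
  (forall x, S x -> S (Pi *: x)) -> (forall x, S x -> S (lowering H *: x)) ->
  forall R, S (v R) -> exists S0, S (v (ext S0)).
Proof.
move=> SD SZ ST SPi Slow R SR.
have unit c x : c != 0 -> S (sc c *: x) -> S x.
  by move=> c0 /(SZ c^-1); rewrite scalerA -rmorphM mulVf // rmorph1 scale1r.
have swp R1 (i : nat) : (0 < i < n)%N -> swappable R1 i%:Z -> S (v R1) ->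
    S (v (psyt_swap n_ge2 i%:Z R1)).
  move=> hi s S1; set b := beta t (gap i%:Z R1).
  have b0 : b != 0 := beta_neq0 t_neq0 t_nroot (gap_neq0 n_ge2 _ _) s.
  apply: (unit b) => //; have := sn_T v_sn R1 hi; rewrite -/b addrC => /eqP.
  rewrite -subr_eq => /eqP <-; rewrite -scaleNr -(rmorphN sc).
  by apply: SD; [apply: ST | apply: SZ].
have [R1 S1|R1 R10 S1|R' [fR' SR']] := @reach_fundamental N k n_ge2 (fun R => S (v R)) _ swp _ R SR.
- by rewrite -(sn_Pi v_sn); apply: SPi.
- have h1 : (0 < 1 <= n)%N by lia.
  have := Slow _ S1; rewrite /lowering -scalerA scalerBl scale1r (sn_Y v_sn) //.
  rewrite -{2}[v R1]scale1r -(rmorph1 sc) -scalerBl -(rmorphB sc) scalerA -alg_scalC.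
  rewrite -scalerA (sn_PiV v_sn); apply: unit.
  by rewrite subr_eq0; apply: weight_neq1.
have [S0 e] := syt_of_fundamental n_ge2 fR'.
by exists S0; rewrite -e.
Qed.

(** Multiply [x] by a power of [Pi] to make it graded.  Some weight component of its
    image is a nonzero multiple of a basis vector [v_R]; separating the weights and
    applying [climb] gives a graded [y] in [P] whose image is a basis vector of a
    fundamental tableau.  On this image [Y_1 ... Y_n] has its degree [0] eigenvalue.
    As [q] is not a root of unity, the components of [y] in positive degrees can be
    removed by [Y_1 ... Y_n], without killing the image: what is left is a nonzero
    element of [1 (x) W] in [P]. *)
Lemma full_submodule (P : M -> Prop) : is_submodule P -> (exists2 x, P x & h x <> 0) -> forall x, P x.
Proof.
move=> sP [x px hx].
have gs := graded_stable n_ge2 q_neq0 bottom_stable.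
pose S z := exists x', [/\ P x', graded bottom x' & h x' = z].
have Sop (a : H) : (forall x, graded bottom x -> graded bottom (a *: x)) ->
    forall z, S z -> S (a *: z).
  move=> ha _ [x' [px' gx' <-]]; exists (a *: x'); rewrite linearZ.
  by split=> //; [apply: submodZ | apply: ha].
have SD y z : S y -> S z -> S (y + z).
  move=> [x1 [p1 g1 <-]] [x2 [p2 g2 <-]]; exists (x1 + x2); rewrite linearD.
  by split=> //; [apply: submodD | apply: (stD gs)].
have SZ c : forall z, S z -> S (sc c *: z) by apply: Sop => y; apply: (stZ gs).
have [R SR] : exists R, S (v R).
  have [m gx] := M_covered x; set x' := Pi ^+ m *: x in gx.
  have px' : P x' by apply: submodZ.
  have hx' : h x' <> 0.
    rewrite /x' linearZ_LR; elim: m {x' gx px'} => [|m IH]; first by rewrite expr0 scale1r.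
    rewrite exprS -scalerA => /(congr1 (fun z => alg_PiV H *: z)).
    by rewrite scaler0 scalerA alg_PiVK scale1r.
  have [r hr] := image_span x'; have e := hr; rewrite combination_group in e.
  set s := undup _ in e; set c := total_coef r in e.
  have [R Rs cR] : exists2 R, R \in s & c R != 0.
    apply: contrapT => no; apply: hx'; rewrite e big1_seq // => R /andP[_ Rs].
    case: (eqVneq (c R) 0) => [->|cR]; first by rewrite rmorph0 scale0r.
    by case: no; exists R.
  pose I := {m : nat | (0 < m <= n)%N}.
  have vw R' (m' : I) : Y (sval m') *: v R' = sc (t ^ (2 * dg R' (sval m')%:Z)) *: v R'.
    exact: sn_Y v_sn _ _ (svalP m').
  have w_inj (R1 R2 : psyt N k) : (fun m' : I => t ^ (2 * dg R1 (sval m')%:Z)) =1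
      (fun m' : I => t ^ (2 * dg R2 (sval m')%:Z)) -> R1 = R2.
    move=> e'; apply: (diag_weight_inj n_ge2 t_neq0 t_nroot) => i hi.
    exact: (e' (exist _ i hi)).
  have [z Sz m' a||b b0 Sb] := isolate (@alg_scalC _ _ _ _ H) vw w_inj (P := S)
      (undup_uniq _) Rs cR.
    rewrite -scaleNr -(rmorphN sc); apply: SD; last exact: SZ.
    by apply: Sop Sz => y; apply: (stY gs); exact: (svalP m').
    by exists x'.
  exists R; have := SZ b^-1 _ Sb.
  by rewrite scalerA -rmorphM mulVf // rmorph1 scale1r.
have [S0 [y [py [D [f [fp yE]]] hy]]] : exists S0, S (v (ext S0)).
  apply: (climb SD SZ) SR => [i z hi||].
  - by apply: Sop => y; apply: (stT gs).
  - by apply: Sop => y; apply: (graded_Pi n_ge2 q_neq0 bottom_stable).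
  - by apply: Sop => y; apply: (graded_lowering n_ge2 q_neq0 bottom_stable bottom_Y1).
suff [z pz [bz hz]] : exists2 z, P z & bottom z /\ h z <> 0.
  by apply: (bottom_generates sP); exists z => //; split=> // z0; apply: hz; rewrite z0 linear0.
have hy0 : h y <> 0 by rewrite hy -[v _]scale1r -(rmorph1 sc); apply/v_neq0/oner_neq0.
have yw : Yprod H n *: h y = sc (content_prod N k t) *: h y.
  rewrite hy (@Yprod_weight _ _ (fun i => t ^ (2 * dg (ext S0) i%:Z))) ?content_prodE //.
  by move=> i hi; apply: sn_Y.
have kap0 : content_prod N k t != 0 by apply/prodf_neq0 => b _; apply: expfz_neq0.
set kap := content_prod N k t in yw kap0.
(* remove the component of highest degree *)
elim: D f fp y py yE hy0 yw {hy} => [|D IH] f fp y py yE hy0 yw.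
  by case: hy0; rewrite yE big_ord0 linear0.
case: D IH yE => [|D] IH yE.
  by rewrite big_ord1 in yE; exists y => //; split=> //; rewrite yE; apply: (fp 0%N).
pose a := kap * q ^+ D.+1.
have ka : kap - a != 0.
  by rewrite /a -{1}[kap]mulr1 -mulrBr mulf_neq0 // subr_eq0 eq_sym; apply: q_nroot.
have ps := piece_stable n_ge2 q_neq0 bottom_stable.
have hE : h (Yprod H n *: y - sc a *: y) = sc (kap - a) *: h y.
  by rewrite linearB !(linearZ_LR h) yw -scalerBl -(rmorphB sc).
apply: (IH (fun d => sc (kap * q ^+ d - a) *: f d) _ (Yprod H n *: y - sc a *: y)).
- by move=> d; apply: (stZ (ps d)).
- rewrite -scaleNr; apply: (submodD sP); exact: submodZ.
- rewrite yE !scaler_sumr -sumrB big_ord_recr /=.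
  have E d : Yprod H n *: f d - sc a *: f d = sc (kap * q ^+ d - a) *: f d.
    rewrite (Yprod_piece n_ge2 q_neq0 bottom_Yprod (fp d)) -/kap.
    by rewrite -scalerBl -(rmorphB sc).
  rewrite E subrr rmorph0 scale0r addr0.
  by apply: eq_bigr => d _; rewrite E.
- rewrite hE => e; apply: hy0; have := congr1 (fun z => sc (kap - a)^-1 *: z) e.
  by rewrite scaler0 scalerA -rmorphM mulVf // rmorph1 scale1r.
by rewrite hE scalerA -alg_scalC -scalerA yw !scalerA (alg_scalC (kap - a)).
Qed.

(** From any tableau a fundamental one is reached by invertible moves, so if one
    basis vector were missed, so would be that of a fundamental tableau. *)
Lemma image_all R : exists x, h x = v R.
Proof.
apply: contrapT => nR.
have [R1 n1|R1 i hi s n1 [x hx]|R1 _ n1 [x hx]|R' [fR' nR']] :=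
    @reach_fundamental N k n_ge2 (fun R => ~ exists x, h x = v R) _ _ _ R nR.
- move=> [x hx]; apply: n1; exists (alg_PiV H *: x).
  by rewrite linearZ_LR hx (sn_PiV v_sn) shiftK.
- apply: n1; set R2 := psyt_swap n_ge2 i%:Z R1 in hx.
  have b0 : beta t (gap i%:Z R2) != 0.
    exact: (beta_neq0 t_neq0 t_nroot (gap_neq0 n_ge2 _ _) (swappable_sym n_ge2 s)).
  have := sn_T v_sn R2 hi; set b := beta t _ in b0 *; rewrite psyt_swapK -hx -(linearZ_LR h).
  rewrite addrC -(linearZ_LR h) => /eqP; rewrite -subr_eq -linearB => /eqP e.
  exists (sc b^-1 *: (T i *: x - sc (alpha t (gap i%:Z R2)) *: x)).
  by rewrite linearZ_LR e scalerA -rmorphM mulVf // rmorph1 scale1r.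
- apply: n1; exists (Pi *: x); rewrite linearZ_LR hx (sn_Pi v_sn).
  by have := shiftK n_ge2 (-1) R1; rewrite opprK => ->.
have [S e] := syt_of_fundamental n_ge2 fR'; apply: nR'; rewrite e.
have [c c0 hc] := hw S; exists (sc c^-1 *: tens (w S)).
by rewrite linearZ_LR hc scalerA -rmorphM mulVf // rmorph1 scale1r.
Qed.

End Image.
Lemma syt_inhabited : exists S : syt N k, True.
Proof.
have [[y y0] _] := W_simple; have [r e] := sw y; case: r e => [|[c S] r] e; last by exists S.
by case/eqP: y0; rewrite e /combination big_nil.
Qed.

(** The basis of [W] can be rescaled to seminormal form too; the resulting map from
    [W] extends to the induced module. *)
Lemma induced_seminormal (L : lmodType H) (x : syt N k -> L) :
  seminormal_syt n_ge2 (x : syt N k -> infl L) ->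
  exists h : {linear M -> L}, forall S, exists2 c, c != 0 & h (tens (w S)) = sc c *: x S.
Proof.
move=> xs; have [chi [chiD chiZ chiv]] := coordinates fw sw.
have [c [c0 wc]] : exists c, (forall S, c S != 0) /\
    seminormal_syt n_ge2 (fun S => scB (c S) *: w S).
  apply: (normal_form t_neq0 t_nroot chiD chiZ chiv wY) => i S hi.
  case: (boolP (syt_swappable n_ge2 i S)) => s.
    have [S' [c [/= e1 e]]] := T_swappable n_ge2 t_neq0 t_nroot
      (@psyt_of_syt_inj _ _ n_ge2) fw sw wY hi s.
    exists c; split=> //; rewrite [LHS]e; congr (_ + _ *: w _).
    by apply: (@psyt_of_syt_inj _ _ n_ge2); rewrite e1 syt_swapE.
  exists 0; rewrite rmorph0 scale0r addr0; split=> //.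
  exact: (T_unswappable n_ge2 t_neq0 t_nroot (@psyt_of_syt_inj _ _ n_ge2) fw sw wY hi s).
have [fw' sw'] := rescale_basis c0 fw sw.
have [g [gD gB gw]] := seminormal_map fw' sw' wc xs.
have [h hE] := @induced_map H B (af_val B) W L g gD gB.
exists h => S; exists (c S)^-1; first by rewrite invr_eq0.
rewrite hE -gw gB infl_scal scalerA -rmorphM mulVf // rmorph1 scale1r //.
Qed.

(** [J] is the kernel of the map to the module of periodic tableaux.  By
    [full_submodule] every proper submodule is contained in [J]; this gives simplicity
    and uniqueness, and it identifies the kernel of a nonzero map from [M] to any
    simple module. *)
Lemma simple_quotient (F : lmodType H) (v : psyt N k -> F) : seminormal n_ge2 v ->
  exists J : submodClosed M,
  [/\ simple_module (quot_mod J),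
     forall J' : submodClosed M, simple_module (quot_mod J') -> J' =i J,
     exists u : psyt N k -> quot_mod J, [/\ free_family sc u, spanning sc u &
       forall i R, (0 < i <= n)%N -> Y i *: u R = sc (t ^ (2 * dg R i%:Z)) *: u R]
   & forall (L : lmodType H) (u : psyt N k -> L), simple_module L ->
       free_family sc u -> spanning sc u ->
       (forall i R, (0 < i <= n)%N -> Y i *: u R = sc (t ^ (2 * dg R i%:Z)) *: u R) ->
       isomorphic (quot_mod J) L].
Proof.
move=> v_sn; have [S0 _] := syt_inhabited.
have [h hw] := induced_seminormal (seminormal_restriction B v_sn).
have ker_submod (L : lmodType H) (f : {linear M -> L}) : is_submodule (fun x => f x = 0).
  split=> [|a x y fx fy]; first exact: linear0.
  by rewrite linearP fx fy scaler0 addr0.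
have [J JE] := submodule_closed (ker_submod F h).
have full := full_submodule v_sn hw.
have nJ x : x \notin J -> h x <> 0 by move=> /negP xJ e; apply: xJ; apply/JE.
have Jw : tens (w S0) \notin J.
  by apply/negP => /JE; have [c c0 ->] := hw S0; apply: v_neq0.
have simpleJ : simple_module (quot_mod J).
  apply: (simple_quot Jw) => P sP [x px xJ]; apply: full => //.
  by exists x => //; apply: nJ.
exists J; split=> //.
- move=> J' sJ' x.
  have J'J y : y \in J' -> y \in J.
    move=> yJ'; apply: contrapT => /negP/nJ hy.
    case: (proj1 sJ') => z /eqP; apply; rewrite -[z]mod_repK; apply/mod_proj0.
    by apply: (full (fun x => x \in J')); [exact: closed_submodule | exists y].
  apply/idP/idP => [|xJ]; first exact: J'J.
  apply: contrapT => /negP xJ'.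
  have := simple_quot_max sJ' (closed_submodule J) J'J (ex_intro2 _ _ x xJ xJ') (tens (w S0)).
  by apply/negP.
- have [z hz] := choice (image_all v_sn hw).
  have hu (u : seq (K * psyt N k)) : h (combination sc z u) = combination sc v u.
    by rewrite linear_sum; apply: eq_bigr => p _; rewrite linearZ_LR hz.
  exists (fun R => mod_proj J (z R)); split.
  + move=> s c us; rewrite -[X in X = 0 -> _](_ : mod_proj J (\sum_(R <- s) sc (c R) *: z R) = _).
      move/mod_proj0/JE; rewrite linear_sum => e; apply: (sn_free v_sn us).
      by rewrite -[RHS]e; apply: eq_bigr => R _; rewrite linearZ_LR hz.
    by rewrite linear_sum; apply: eq_bigr => R _; rewrite linearZ_LR.
  + move=> y; have [r hr] := image_span v_sn hw (mod_rep y); exists r.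
    transitivity (mod_proj J (combination sc z r)).
      rewrite -[LHS]mod_repK; apply/eqP; rewrite -mod_projP; apply/JE.
      by rewrite linearB hu hr subrr.
    by rewrite linear_sum; apply: eq_bigr => p _; rewrite linearZ_LR.
  move=> i R hi; rewrite -!(linearZ_LR (mod_proj J)); apply/eqP; rewrite -mod_projP; apply/JE.
  by rewrite linearB !(linearZ_LR h) hz (sn_Y v_sn) // subrr.
move=> L u sL fu su uY.
have [c [c0 uc]] := restriction_form n_ge2 t_neq0 t_nroot B fu su uY.
have [f fw'] := induced_seminormal uc.
have fw0 : f (tens (w S0)) <> 0.
  have [d d0 ->] := fw' S0; rewrite infl_scal scalerA -rmorphM => e.
  have : d * c S0 = 0.
    apply: (fu [:: ext S0] (fun=> d * c S0)) => //; last by rewrite inE.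
    by rewrite big_seq1.
  by move/eqP; rewrite mulf_eq0 (negbTE d0) (negbTE (c0 S0)).
have kerJ x : f x = 0 -> x \in J.
  move=> fx; apply: contrapT => /negP/nJ hx; apply: fw0.
  by apply: (full (fun x => f x = 0)); [exact: ker_submod | exists x].
have im (P : M -> Prop) : is_submodule P -> is_submodule (fun y => exists2 x, P x & y = f x).
  move=> sP; split=> [|a y y' [x px ->] [x' px' ->]].
    by exists 0; [case: sP | rewrite linear0].
  by exists (a *: x + x'); [apply: (proj2 sP) | rewrite linearP].
apply: (quot_isomorphic (f := f)) => [y|x].
  have imT : is_submodule (fun _ : M => True) by [].
  have [|x _ e] := simple_submodule sL (im _ imT) _ y; last by exists x.
  by exists (f (tens (w S0))) => //; exists (tens (w S0)).
split=> [|xJ]; first exact: kerJ.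
apply: contrapT => fx; case/negP: Jw.
have [x' x'J e] : exists2 x', x' \in J & f (tens (w S0)) = f x'.
  apply: (simple_submodule sL (im _ (closed_submodule J))).
  by exists (f x) => //; exists x.
rewrite -[tens _](subrK x'); apply: rpredD => //; apply: kerJ.
by rewrite linearB e subrr.
Qed.

End SimpleQuotient.

(** * The affine and finite Hecke algebras *)

Section SubalgebraElements.
Variables (K A : pzRingType) (scal : {rmorphism K -> A}) (G : A -> Prop).
Local Notation B := (subalg scal G).

(** Total in [x]: elements outside the subalgebra are sent to [0]. *)
Definition subalg_elt (x : A) : B := insubd (0 : B) x.

Lemma subalg_eltK x : G x -> subalg_val (subalg_elt x) = x.
Proof. by move=> Gx; apply: (insubdK (0 : B)); apply: subalg_gen_incl. Qed.

Lemma subalg_ind (S : B -> Prop) : (forall c, S (subalg_scal scal G c)) ->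
  (forall a b, S a -> S b -> S (a - b)) -> (forall a b, S a -> S b -> S (a * b)) ->
  (forall g, G g -> S (subalg_elt g)) -> forall a, S a.
Proof.
move=> Sc SB SM SG a.
have /subalg_genP/(_ (fun x => exists2 b, subalg_val b = x & S b)) := subalg_valP a.
case=> [||b e Sb]; last by rewrite -(val_inj e).
  split=> [c|_ _ [x <- Sx] [y <- Sy]|_ _ [x <- Sx] [y <- Sy]].
  - by exists (subalg_scal scal G c).
  - by exists (x - y); [rewrite rmorphB | exact: SB].
  - by exists (x * y); [rewrite rmorphM | exact: SM].
by move=> g Gg; exists (subalg_elt g); [exact: subalg_eltK | exact: SG].
Qed.

End SubalgebraElements.

Section Concrete.
Variables (K : fieldType) (N k : nat) (q t : K).
Hypotheses (n_ge2 : (2 <= k * N)%N) (t_neq0 : t != 0).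
Local Notation n := (k * N)%N.
Local Notation D := (daha_inst q n_ge2 t_neq0).
Local Notation A := (affine_hecke n q t).
Local Notation C := (finite_hecke n q t).
Local Notation elt := (@subalg_elt K (daha n q t) (daha_scal n q t) (@affine_gen K n q t)).
Local Notation felt := (@subalg_elt K (daha n q t) (daha_scal n q t) (@finite_gen K n q t)).
Local Notation ascal := (@subalg_scal K (daha n q t) (daha_scal n q t) (@affine_gen K n q t)).

Definition affine_inst : affine_sub D.
Proof.
apply: (@AffineSub K n q t D A (@affine_val K n q t) ascal
  (fun i => elt (daha_T n q t i)) (fun i => elt (daha_Y n q t i))
  (fun i => elt (daha_YV n q t i))).
- exact: val_inj.
- by [].
- by move=> i hi; apply: subalg_eltK; apply: AffineT.
- by move=> i hi; apply: subalg_eltK; apply: AffineY.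
- by move=> i hi; apply: subalg_eltK; apply: AffineYV.
move=> S Sc SB SM ST SY SYV; apply: subalg_ind => // _ [i hi|i hi|i hi].
- exact: ST.
- exact: SY.
- exact: SYV.
Defined.

Variable phi : {rmorphism A -> C}.
Hypothesis phiP : is_affine_to_finite phi.

Lemma phi_scal c : phi (ascal c) = finite_scal n q t c.
Proof. by apply: val_inj; case: phiP => h _ _; apply: h. Qed.

Lemma phi_surj (a : C) : exists b, phi b = a.
Proof.
elim/subalg_ind: a => [c|a a' [b <-] [b' <-]|a a' [b <-] [b' <-]|_ [i hi]].
- by exists (ascal c); exact: phi_scal.
- by exists (b - b'); exact: (rmorphB phi).
- by exists (b * b'); exact: (rmorphM phi).
have [_ h _] := phiP; exists (elt (daha_T n q t i)).
apply: val_inj; apply: (etrans (h _ i hi _)).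
  by apply: subalg_eltK; apply: AffineT.
by symmetry; apply: subalg_eltK; apply: FiniteT.
Qed.

(** [Y_{i+1} = T_i Y_i T_i] and [Y_1] is sent to [1]. *)
Lemma phi_jm i : (i < n)%N -> forall a : A, affine_val a = daha_Y n q t i.+1 ->
  finite_val (phi a) = jucys_murphy n q t i.
Proof.
have [_ hT hY] := phiP; elim: i => [|i IH] hi a ha; first exact: hY.
have h1 : (0 < i.+1 < n)%N by rewrite hi.
have h2 : (0 < i.+1 <= n)%N by apply: ltnW.
have eT : affine_val (elt (daha_T n q t i.+1)) = daha_T n q t i.+1.
  by apply: subalg_eltK; apply: AffineT.
have eY : affine_val (elt (daha_Y n q t i.+1)) = daha_Y n q t i.+1.
  by apply: subalg_eltK; apply: AffineY.
have -> : a = elt (daha_T n q t i.+1) * elt (daha_Y n q t i.+1) * elt (daha_T n q t i.+1).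
  apply: val_inj; apply: (etrans ha); symmetry.
  apply: (etrans (rmorphM (@affine_val K n q t) _ _)).
  apply: (etrans (congr1 ( *%R^~ _) (rmorphM (@affine_val K n q t) _ _))).
  apply: (etrans (congr2 (fun x y => x * y * x) eT eY)).
  exact: (@alg_TY K n q t D i.+1 h1).
apply: (etrans (congr1 (@finite_val K n q t) (rmorphM phi _ _))).
apply: (etrans (rmorphM (@finite_val K n q t) _ _)).
apply: (etrans (congr2 *%R _ (hT _ _ h1 eT))
  (_ : jucys_murphy n q t i.+1 = jucys_murphy n q t i.+1)); last by [].
apply: (etrans (congr1 (@finite_val K n q t) (rmorphM phi _ _))).
apply: (etrans (rmorphM (@finite_val K n q t) _ _)).
exact: (congr2 *%R (hT _ _ h1 eT) (IH (ltnW hi) _ eY)).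
Qed.

Variable V : lmodType C.
Local Notation W := (inflation phi V).

(** The map [phi] is onto, so the submodules are the same. *)
Lemma inflation_simple : simple_module V -> simple_module W.
Proof.
move=> sV; split; first by case: sV.
move=> J; case: (pselect (exists2 x : V, (x : W) \in J & x <> 0)) => [ex|nex]; last first.
  by left=> x xJ; apply: contrapT => x0; apply: nex; exists x.
right; apply: (simple_submodule sV (P := fun x : V => (x : W) \in J)) ex.
split=> [|a x y xJ yJ]; first exact: (rpred0 J).
have [b <-] := phi_surj a; apply: (rpredD (S := J)) => //.
exact: (@rpredZ _ W J b x).
Qed.

Hypotheses (t_nroot : forall m : nat, (0 < m)%N -> t ^+ m != 1).

Lemma psyt_wt_inj : injective (@psyt_wt K t N k).
Proof.
move=> R R' /ffunP e; apply: (diag_weight_inj n_ge2 t_neq0 t_nroot) => -[//|i] hi.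
by have := e (Ordinal (hi : (i < n)%N)); rewrite !ffunE.
Qed.

End Concrete.

Section Support.
Variables (K : fieldType) (N k : nat) (q t : K).
Hypotheses (n_ge2 : (2 <= k * N)%N) (t_neq0 : t != 0).
Hypothesis t_nroot : forall m : nat, (0 < m)%N -> t ^+ m != 1.
Local Notation n := (k * N)%N.
Local Notation D := (daha_inst q n_ge2 t_neq0).
Variables (L : lmodType (daha n q t)) (u : psyt N k -> L).
Hypotheses (fu : free_family (daha_scal n q t) u) (su : spanning (daha_scal n q t) u).
Hypothesis uY : forall R, eigenvector (psyt_wt t R) (u R).

Lemma psyt_wt_neq0 (R : psyt N k) i : psyt_wt t R i != 0.
Proof. by rewrite ffunE; apply: expfz_neq0. Qed.

Lemma tableau_basis_semisimple : Y_semisimple L.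
Proof.
have wi := psyt_wt_inj n_ge2 t_neq0 t_nroot.
have scC := @alg_scalC K n q t D.
split=> [x|s f us fs].
  have [s [f [hs e]]] := eigenvector_sum su scC (fun R i => uY R i) wi x.
  exists s, f; split=> // z zs; have [[R zR] fz] := hs z zs.
  by split=> [i|//]; rewrite zR psyt_wt_neq0.
apply: (eigenvector_free fu su scC (fun R i => uY R i) wi us) => z zs.
by have [_] := fs z zs.
Qed.

Lemma tableau_basis_support z : Y_support L z <-> exists R : psyt N k, z = psyt_wt t R.
Proof.
have wi := psyt_wt_inj n_ge2 t_neq0 t_nroot.
have scC := @alg_scalC K n q t D.
have h := eigenvector_weight fu su scC (fun R i => uY R i) wi z.
split=> [[_ ex]|ex]; first exact/h.
split; last exact/h.
by case: ex => R -> i; apply: psyt_wt_neq0.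
Qed.

End Support.

Theorem corollary6p9 (K : fieldType) (N k : nat) (q t : K)
    (char0 : [pchar K] =i pred0)
    (N_gt0 : (0 < N)%N) (k_gt0 : (0 < k)%N) (n_ge2 : (2 <= k * N)%N)
    (t_neq0 : t != 0) (t_nroot : forall m : nat, (0 < m)%N -> t ^+ m != 1)
    (q_neq0 : q != 0) (q_nroot : forall m : nat, (0 < m)%N -> q ^+ m != 1)
    (qE : q = t ^- (2 * k))
    (phi : {rmorphism affine_hecke (k * N) q t -> finite_hecke (k * N) q t})
    (phiP : is_affine_to_finite phi)
    (V : lmodType (finite_hecke (k * N) q t))
    (V_rect : is_rect_module N k V) :
  exists J : submodClosed (M_module phi V),
    [/\ simple_module (quot_mod J),
        forall J' : submodClosed (M_module phi V),
          simple_module (quot_mod J') -> J' =i J,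
        is_L_module N k (quot_mod J)
          /\ (forall L : lmodType (daha (k * N) q t),
                is_L_module N k L -> isomorphic (quot_mod J) L),
        Y_semisimple (quot_mod J)
      & forall z : {ffun 'I_(k * N) -> K},
          Y_support (quot_mod J) z <-> exists R : psyt N k, z = psyt_wt t R].
Proof.
have [V_simple [v [/is_basisP [fv sv] vY]]] := V_rect.
pose B := affine_inst q n_ge2 t_neq0.
pose W : lmodType B := inflation phi V.
have scE c (x : V) : af_scal B c *: (x : W) = finite_scal (k * N) q t c *: x.
  exact: (congr1 (fun a => a *: x) (phi_scal phiP c)).
have fw : free_family (af_scal B) (v : syt N k -> W).
  move=> s c us e; apply: fv us _; apply: etrans e.
  by apply: eq_bigr => S _; apply/esym/scE.
have sw : spanning (af_scal B) (v : syt N k -> W).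
  move=> x; have [r e] := sv x; exists r; apply: (etrans e).
  by apply: eq_bigr => p _; apply/esym/scE.
have wY i S : (0 < i <= k * N)%N -> af_Y B i *: (v S : W) =
    af_scal B (t ^ (2 * psyt_diag (psyt_of_syt n_ge2 S) i%:Z)) *: (v S : W).
  case: i => [//|i] hi; apply: etrans (esym (scE _ _)).
  have := @diag_of_syt N k n_ge2 S (Ordinal (hi : (i < k * N)%N)) => /= ->.
  apply: (vY S (Ordinal (hi : (i < k * N)%N))).
  by apply: (phi_jm n_ge2 t_neq0 phiP) => //; exact: (@af_valY _ _ _ _ _ B i.+1 hi).
have [F [f f_sn]] := exists_seminormal n_ge2 t_neq0 t_nroot qE.
have W_simple : simple_module W := inflation_simple phiP V_simple.
have [J [sJ uJ [u [fu su uY]] LJ]] := simple_quotient t_neq0 q_neq0 t_nroot q_nroot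
  W_simple fw sw wY f_sn.
have uE R : eigenvector (psyt_wt t R) (u R).
  by move=> i; rewrite ffunE; apply: uY; exact: ltn_ord.
exists J; split.
- exact: sJ.
- exact: uJ.
- split; first by split=> //; exists u; split=> //; apply/is_basisP.
  move=> L [sL [x [/is_basisP [fx sx] xY]]]; apply: (LJ L x) => // -[//|i] R hi.
  by have := xY R (Ordinal (hi : (i < k * N)%N)); rewrite ffunE.
- exact: (tableau_basis_semisimple n_ge2 t_neq0 t_nroot fu su uE).
exact: (tableau_basis_support n_ge2 t_neq0 t_nroot fu su uE).
Qed.
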